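(* There is a set $\mathcal{L}$ of linear maps $L:\mathbb{R}^d\to\mathbb{R}^{k-d}$ (identified with a subset of $\mathbb{R}^{d(k-d)}$ via their matrix entries $\alpha_{ij}$) of Hausdorff dimension $d(k-d)$ with the following property. For every $L\in\mathcal{L}$, the graph $E$ of $L$ is totally irrational, and for every admissible choice of $F_0$, $\Omega$ and regular $s$, and every window $\mathcal{W}$ that is a parallelotope generated by vectors in $F\cap\mathbb{Z}^k$, there exists a constant $C$ such that \[\#\xi_1(r)\le C\quad\text{and}\quad\#\xi_2(r)\le C\quad\text{for all } r\ge 0.\]
   Context: Fix integers $1\le d<k$. For $x\in\mathbb{R}^m$, $|x|=\max_i|x_i|$. Let $L:\mathbb{R}^d\to\mathbb{R}^{k-d}$ be linear, $L(x)=Ax$ with $A=(\alpha_{ij})$, and let $E=\{(x,L(x)):x\in\mathbb{R}^d\}\subseteq\mathbb{R}^k$. We say $E$ is totally irrational if $E+\mathbb{Z}^k$ is dense in $\mathbb{R}^k$. Let $F=\{0\}\times\mathbb{R}^{k-d}$, and let $F_0$ be a subspace complementary to $E$ with $F_0\cap\mathbb{Z}^k=\{0\}$. Denote by $\pi_1:\mathbb{R}^k\to E$ the projection along $F_0$, by $\pi_2:\mathbb{R}^k\to E$ the projection along $F$, and by $\pi^*:\mathbb{R}^k\to F$ the projection along $E$. A window is a compact $\mathcal{W}\subseteq F$ equal to the closure of its interior (in $F$). The strip is $\mathcal{S}=(\pi^* )^{-1}(\mathcal{W})$. A point $s\in\mathbb{R}^k$ is regular if $(\mathbb{Z}^k+s)\cap\partial\mathcal{S}=\emptyset$.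 The cut and project set is $Y=\pi_1(\mathcal{S}\cap(\mathbb{Z}^k+s))$. For $y\in Y$, $\tilde y$ denotes the unique point of $\mathcal{S}\cap(\mathbb{Z}^k+s)$ with $\pi_1(\tilde y)=y$. Let $\Omega\subseteq E$ be a bounded convex set containing a neighborhood of $0$ in $E$. For $y\in Y$ and $r\ge0$, define \[P_1(y,r)=\{y'\in Y: y'-y\in r\Omega\},\qquad P_2(y,r)=\{y'\in Y:\pi_2(\tilde y'-\tilde y)\in r\Omega\}.\] For $i\in\{1,2\}$, the patches $P_i(y_1,r)$ and $P_i(y_2,r)$ are equivalent if $P_i(y_1,r)=P_i(y_2,r)+y_1-y_2$; write $\mathcal{P}_i(y,r)$ for the equivalence class. The frequency of a class $\mathcal{P}$ is \[\xi_{\mathcal{P}}=\lim_{R\to\infty}\frac{\#\{y'\in Y:|y'|\le R,\ \mathcal{P}_i(y',r)=\mathcal{P}\}}{\#\{y'\in Y:|y'|\le R\}};\] this limit exists. $\xi_i(r)$ is the set of distinct values of $\xi_{\mathcal{P}}$ as $\mathcal{P}$ runs over the equivalence classes of type $i$ patches of size $r$. These notions are defined under the standing assumption that $E$ is totally irrational, and $\xi_i(r)$ does not depend on the regular point $s$. A window $\mathcal{W}$ is a parallelotope generated by vectors in $F\cap\mathbb{Z}^k$ if $\mathcal{W}=\{\sum_{j=1}^{k-d}t_jw_j:0\le t_j\le1\}$ for some linearly independent $w_1,\dots,w_{k-d}\in F\cap\mathbb{Z}^k$. *)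

(* Defs.v *)
From HB Require Import structures.
From mathcomp Require Import all_boot all_order all_algebra.
From mathcomp Require Import all_classical all_reals all_analysis.
From mathcomp Require Import Rstruct Rstruct_topology finmap.

Set Implicit Arguments.
Unset Strict Implicit.
Unset Printing Implicit Defensive.

Import Order.TTheory GRing.Theory Num.Theory.
Import numFieldNormedType.Exports.
Local Open Scope classical_set_scope.
Local Open Scope ring_scope.

Section CutProject.
Variable R : realType.

Definition supn (n : nat) (v : 'rV[R]_n) : R :=
  \big[Num.max/0]_(i < n) `|v ord0 i|.

Definition mdist (p q : nat) (X Y : 'M[R]_(p, q)) : R :=
  \big[Num.max/0]_(i < p) \big[Num.max/0]_(j < q) `|X i j - Y i j|.

Definition diam_le (p q : nat) (U : set 'M[R]_(p, q)) (delta : R) : Prop :=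
  forall x y, U x -> U y -> mdist x y <= delta.

Definition diam (p q : nat) (U : set 'M[R]_(p, q)) : R :=
  sup [set mdist x y | x in U & y in U].

Definition cover_cost (p q : nat) (s : R) (U : set 'M[R]_(p, q)) : R :=
  if `[< U = set0 >] then 0 else powR (diam U) s.

Definition hausdorff_delta (p q : nat) (s delta : R) (A : set 'M[R]_(p, q))
  : \bar R :=
  ereal_inf [set (\sum_(n <oo) (cover_cost s (U n))%:E)%E |
     U in [set U : nat -> set 'M[R]_(p, q) |
            A `<=` \bigcup_n U n /\ forall n, diam_le (U n) delta]].

(* H^s(A) = lim_{delta -> 0+} H^s_delta(A) = sup_{delta>0} H^s_delta(A)
   (H^s_delta is nonincreasing in delta) *)
Definition hausdorff_measure (p q : nat) (s : R) (A : set 'M[R]_(p, q))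
  : \bar R :=
  ereal_sup [set hausdorff_delta s delta A | delta in [set delta : R | 0 < delta]].

Definition hausdorff_dim (p q : nat) (A : set 'M[R]_(p, q)) : \bar R :=
  ereal_inf [set s%:E | s in [set s : R | 0 <= s /\ hausdorff_measure s A = 0%E]].

Definition is_subspace (n : nat) (U : set 'rV[R]_n) : Prop :=
  U 0 /\ forall (a : R) u v, U u -> U v -> U (a *: u + v).

Definition complementary (n : nat) (U W : set 'rV[R]_n) : Prop :=
  U `&` W = [set 0] /\ forall v, exists u w, U u /\ W w /\ v = u + w.

(* projection onto U along W (well defined when U, W are complementary) *)
Definition proj_along (n : nat) (U W : set 'rV[R]_n) (v : 'rV[R]_n) : 'rV[R]_n :=
  xget 0 [set u | U u /\ W (v - u)].

Definition Zpts (n : nat) : set 'rV[R]_n :=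
  [set v | forall i, v ord0 i \is a Num.int].
Arguments Zpts n : clear implicits.

Definition Egraph (d m : nat) (A : 'M[R]_(d, m)) : set 'rV[R]_(d + m) :=
  [set row_mx x (x *m A) | x in [set: 'rV[R]_d]].

Definition Fspace (d m : nat) : set 'rV[R]_(d + m) :=
  [set row_mx 0 y | y in [set: 'rV[R]_m]].
Arguments Fspace d m : clear implicits.

Definition totally_irrational (d m : nat) (A : 'M[R]_(d, m)) : Prop :=
  closure [set e + z | e in (Egraph A) & z in (Zpts (d + m)%N)] = [set: 'rV[R]_(d + m)].

Definition admissible_F0 (d m : nat) (A : 'M[R]_(d, m)) (F0 : set 'rV[R]_(d + m))
  : Prop :=
  is_subspace F0 /\ complementary (Egraph A) F0 /\ F0 `&` Zpts (d + m)%N = [set 0].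

Definition admissible_Omega (d m : nat) (A : 'M[R]_(d, m))
  (Om : set 'rV[R]_(d + m)) : Prop :=
  Om `<=` Egraph A /\
  (exists M : R, forall x, Om x -> supn x <= M) /\
  (forall x y (t : R), Om x -> Om y -> 0 <= t <= 1 -> Om (t *: x + (1 - t) *: y)) /\
  (exists eps : R, 0 < eps /\ forall e, Egraph A e -> supn e < eps -> Om e).

Definition rel_interior_F (d m : nat) (W : set 'rV[R]_(d + m)) : set 'rV[R]_(d + m) :=
  [set x | W x /\ exists eps : R, 0 < eps /\
             forall y, Fspace d m y -> supn (y - x) < eps -> W y].

Definition is_window (d m : nat) (W : set 'rV[R]_(d + m)) : Prop :=
  W `<=` Fspace d m /\ compact W /\ W = closure (rel_interior_F W).

Definition integral_parallelotope (d m : nat) (W : set 'rV[R]_(d + m)) : Prop :=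
  exists w : 'I_m -> 'rV[R]_(d + m),
    (forall j, Fspace d m (w j) /\ Zpts (d + m)%N (w j)) /\
    row_free (\matrix_(j < m) w j) /\
    W = [set \sum_(j < m) t j *: w j |
           t in [set t : 'I_m -> R | forall j, 0 <= t j <= 1]].

Definition boundary (n : nat) (S : set 'rV[R]_n) : set 'rV[R]_n :=
  closure S `\` interior S.

Section CP.
Variables (d m : nat) (A : 'M[R]_(d, m)) (F0 : set 'rV[R]_(d + m))
          (W : set 'rV[R]_(d + m)) (s : 'rV[R]_(d + m)).

Definition pi1 := proj_along (Egraph A) F0.
Definition pi2 := proj_along (Egraph A) (Fspace d m).
Definition pistar := proj_along (Fspace d m) (Egraph A).

Definition strip : set 'rV[R]_(d + m) := pistar @^-1` W.

Definition regular : Prop :=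
  forall z, Zpts (d + m)%N z -> ~ boundary strip (z + s).

Definition lifted : set 'rV[R]_(d + m) :=
  strip `&` [set z + s | z in (Zpts (d + m)%N)].

Definition Yset : set 'rV[R]_(d + m) := pi1 @` lifted.

Definition tilde (y : 'rV[R]_(d + m)) : 'rV[R]_(d + m) :=
  xget 0 [set t | lifted t /\ pi1 t = y].

Definition scaled (r : R) (Om : set 'rV[R]_(d + m)) : set 'rV[R]_(d + m) :=
  [set r *: w | w in Om].

Definition patch1 (Om : set 'rV[R]_(d + m)) (y : 'rV[R]_(d + m)) (r : R) :=
  [set y' | Yset y' /\ scaled r Om (y' - y)].

Definition patch2 (Om : set 'rV[R]_(d + m)) (y : 'rV[R]_(d + m)) (r : R) :=
  [set y' | Yset y' /\ scaled r Om (pi2 (tilde y' - tilde y))].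

Definition patch_equiv (P : 'rV[R]_(d + m) -> R -> set 'rV[R]_(d + m))
  (r : R) (y1 y2 : 'rV[R]_(d + m)) : Prop :=
  P y1 r = [set p + (y1 - y2) | p in P y2 r].

Definition count_set (S : set 'rV[R]_(d + m)) : R := (#|` fset_set S |)%:R.

Definition frequency (P : 'rV[R]_(d + m) -> R -> set 'rV[R]_(d + m))
  (r : R) (y : 'rV[R]_(d + m)) : R :=
  lim ((fun T : R =>
          count_set [set y' | Yset y' /\ supn y' <= T /\ patch_equiv P r y' y]
          / count_set [set y' | Yset y' /\ supn y' <= T]) @ +oo).

Definition freq_values (P : 'rV[R]_(d + m) -> R -> set 'rV[R]_(d + m)) (r : R)
  : set R := [set frequency P r y | y in Yset].

End CP.

End CutProject.

(* Main.v *)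
(** Take for L the matrices A with entries in [0, 1] such that A b is a badly
approximable linear form for every nonzero integer vector b.  The dimension
of this set is maximal: on nested grid cubes one can avoid, at each stage, a
neighbourhood of the single hyperplane that carries all rational points of
small height (simplex lemma), and still keep enough children to escape any
cover of small s-dimensional cost.

In coordinates adapted to the window the strip is the preimage of a unit
cube, and the patch of a point t is the set of displacements z in Z^k for
which t + z stays in the strip and z lies in a region comparable to a ball of
radius r.  The walls of the resulting partition of the cube are cut out by
coordinates of integer points of size at most a multiple of r.  Each patch
class lies in a box whose sides are cuts given by integer points of size at
most a small multiple of r, hence of length O(r^(-d)), whereas bad
approximability separates cuts by at least c r^(-d).  So a class is a union of
cells of a grid with a bounded number of walls, and up to translation there
are boundedly many such unions.  Translates have the same frequency, because
the total orbit is dense. *)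

Require Import Defs.
From HB Require Import structures.
From mathcomp Require Import all_boot all_order all_algebra.
From mathcomp Require Import all_classical all_reals all_analysis.
From mathcomp Require Import Rstruct Rstruct_topology finmap.
From mathcomp Require Import perm ring lra zify.
Set Implicit Arguments.
Unset Strict Implicit.
Unset Printing Implicit Defensive.
Import Order.TTheory GRing.Theory Num.Theory.
Import numFieldNormedType.Exports.
Local Open Scope classical_set_scope.
Local Open Scope ring_scope.

(** Up to the factor [\det B], the cuts of a window with edge matrix [B] are values of the forms
    [A *m b], where [b] runs over the columns of the adjugate of [B]. As the window is arbitrary,
    every nonzero integral [b] has to be served, and one play of the game interleaves these
    countably many tasks. The simplex lemma controls rational points near the vector [A *m b],
    whereas cuts are values of a linear form, so a transference argument links the two. Bad
    approximability also bounds the box sides from above: pigeonhole yields small positive values of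
    the form, the lower bound keeps them from being too small, and boundedly many steps at each
    dyadic scale reach any target. Integrality of the edges permits moving any orbit point into the
    strip without changing its first [d] coordinates. Frequencies are compared by counting: the
    orbit in the strip has order [T ^ d] points up to radius [T], so a set with many disjoint
    lattice translates is sparse, which disposes of the points near walls and near the sphere of
    radius [T]. *)

Lemma pigeon (T T' : finType) (F : T -> T') : (#|T'| < #|T|)%N ->
  exists x y, x != y /\ F x = F y.
Proof.
move=> lt; case: (pselect (injective F)) => [inj|ninj].
  by move: (leq_card F inj); rewrite leqNgt lt.
have [x /existsNP [y /not_implyP [e /eqP n]]] : exists x, ~ forall y, F x = F y -> x = y.
  by apply/existsNP => H; apply: ninj => x y; apply: H.
by exists x, y.
Qed.

(** * Badly approximable forms *)

Section Basics.
Variable R : realType.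
Implicit Types x y : R.

Definition fr x : R := x - (Num.floor x)%:~R.

Lemma fr_itv x : 0 <= fr x < 1.
Proof. by have := floor_itv x; rewrite intrD /fr; lra. Qed.

Definition fbox (H : nat) x : 'I_H.+1 := inord (`|Num.floor (H.+1%:R * fr x)|)%N.

Lemma fbox_eq H x y : fbox H x = fbox H y -> `|fr x - fr y| < H.+1%:R^-1.
Proof.
have hv z : (fbox H z : nat)%:R <= H.+1%:R * fr z < (fbox H z : nat)%:R + 1.
  have /andP[f0 f1] := fr_itv z.
  have h0 : 0 <= H.+1%:R * fr z by rewrite mulr_ge0.
  have h1 : H.+1%:R * fr z < H.+1%:R by rewrite gtr_pMr.
  have g0 : (0 <= Num.floor (H.+1%:R * fr z))%R by rewrite floor_ge0.
  have E : (`|Num.floor (H.+1%:R * fr z)|%N)%:R = (Num.floor (H.+1%:R * fr z))%:~R :> R.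
    by rewrite -[in RHS](gez0_abs g0).
  rewrite /fbox inordK; last first.
    rewrite -(ltr_nat R) E; apply: le_lt_trans h1; exact: floor_le.
  by rewrite E; have := floor_itv (H.+1%:R * fr z); rewrite intrD.
move=> e; have := hv x; have := hv y; rewrite e => hy hx.
have H0 : 0 < H.+1%:R :> R by [].
rewrite -[X in _ < X]mul1r ltr_pdivlMr // mulrC -{1}(gtr0_norm H0) -normrM mulrBr.
by move: hx hy; move: (_ * fr x) (_ * fr y) => X Y hx hy; rewrite ltr_norml; lra.
Qed.

Lemma supn_ge n (v : 'rV[R]_n) i : `|v ord0 i| <= supn v.
Proof. by rewrite /supn; apply: le_bigmax. Qed.

Lemma supn_ge0 n (v : 'rV[R]_n) : 0 <= supn v.
Proof. by rewrite /supn; apply: bigmax_ge_id. Qed.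

Lemma supn_le n (v : 'rV[R]_n) c : 0 <= c -> (forall i, `|v ord0 i| <= c) -> supn v <= c.
Proof. by move=> c0 h; rewrite /supn; apply: bigmax_le. Qed.

Lemma supn_lt n (v : 'rV[R]_n) c : 0 < c -> (forall i, `|v ord0 i| < c) -> supn v < c.
Proof. by move=> c0 h; rewrite /supn; apply: bigmax_lt. Qed.

Lemma supnD n (u v : 'rV[R]_n) : supn (u + v) <= supn u + supn v.
Proof.
apply: supn_le => [|i]; first by rewrite addr_ge0 ?supn_ge0.
by rewrite mxE (le_trans (ler_normD _ _)) // lerD ?supn_ge.
Qed.

Lemma supnZ n a (v : 'rV[R]_n) : supn (a *: v) = `|a| * supn v.
Proof.
apply/eqP; rewrite eq_le; apply/andP; split.
  by apply: supn_le => [|i]; rewrite ?mulr_ge0 ?supn_ge0 // mxE normrM ler_wpM2l ?supn_ge.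
case: (eqVneq a 0) => [->|a0]; first by rewrite normr0 mul0r supn_ge0.
rewrite -ler_pdivlMl ?normr_gt0 // mulrC; apply: supn_le => [|i].
  by rewrite divr_ge0 ?supn_ge0.
rewrite ler_pdivlMr ?normr_gt0 // mulrC -normrM.
by have := supn_ge (a *: v) i; rewrite mxE.
Qed.

Lemma supnN n (v : 'rV[R]_n) : supn (- v) = supn v.
Proof. by rewrite -scaleN1r supnZ normrN1 mul1r. Qed.

Lemma supn0 n : supn (0 : 'rV[R]_n) = 0.
Proof. by rewrite -(scale0r (0 : 'rV[R]_n)) supnZ normr0 mul0r. Qed.

Lemma supn_gt0 n (v : 'rV[R]_n) : v != 0 -> 0 < supn v.
Proof.
move=> v0; rewrite lt_neqAle supn_ge0 andbT; apply: contra v0 => /eqP e.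
apply/eqP/rowP => i; apply/eqP; rewrite mxE -normr_le0 e; exact: supn_ge.
Qed.

Lemma supnB n (u v : 'rV[R]_n) : supn (u - v) <= supn u + supn v.
Proof. by rewrite -(supnN v); apply: supnD. Qed.

Lemma supn_attained n (v : 'rV[R]_n) : v != 0 -> exists i, supn v = `|v ord0 i|.
Proof.
move=> v0; have s0 := supn_gt0 v0.
apply: contrapT => /forallNP h.
have : supn v < supn v.
  by apply: supn_lt => // i; rewrite lt_neqAle supn_ge andbT; apply/eqP => e; apply: (h i).
by rewrite ltxx.
Qed.

Lemma supn_mulmx n p (M : 'M[R]_(n, p)) :
  exists C, 0 < C /\ forall v : 'rV[R]_n, supn (v *m M) <= C * supn v.
Proof.
exists (1 + \sum_i \sum_j `|M i j|); split.
  by rewrite ltr_wpDr // sumr_ge0 // => i _; rewrite sumr_ge0.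
move=> v; apply: supn_le => [|j].
  by rewrite mulr_ge0 ?supn_ge0 // addr_ge0 // sumr_ge0 // => i _; rewrite sumr_ge0.
rewrite mxE (le_trans (ler_norm_sum _ _ _)) //.
rewrite mulrDl mul1r mulr_suml ler_wpDl ?supn_ge0 //.
apply: ler_sum => i _; rewrite normrM mulrC; apply: ler_pM => //; last exact: supn_ge.
by rewrite (bigD1 j) //= ler_wpDr // sumr_ge0.
Qed.

Lemma ZptsD n (u v : 'rV[R]_n) : Zpts u -> Zpts v -> Zpts (u + v).
Proof. by move=> hu hv i; rewrite mxE rpredD. Qed.
Lemma ZptsN n (u : 'rV[R]_n) : Zpts u -> Zpts (- u).
Proof. by move=> hu i; rewrite mxE rpredN. Qed.
Lemma ZptsB n (u v : 'rV[R]_n) : Zpts u -> Zpts v -> Zpts (u - v).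
Proof. by move=> hu hv; apply: ZptsD => //; apply: ZptsN. Qed.
Lemma Zpts0 n : Zpts (0 : 'rV[R]_n).
Proof. by move=> i; rewrite mxE. Qed.
Lemma ZptsZ n a (u : 'rV[R]_n) : a \is a Num.int -> Zpts u -> Zpts (a *: u).
Proof. by move=> ha hu i; rewrite mxE rpredM. Qed.
Lemma Zpts_mulmx n p (M : 'M[R]_(n, p)) (u : 'rV[R]_n) :
  Zpts u -> (forall i j, M i j \is a Num.int) -> Zpts (u *m M).
Proof. by move=> hu hM j; rewrite mxE rpred_sum // => i _; rewrite rpredM. Qed.

Lemma int_norm_ge1 x : x \is a Num.int -> x != 0 -> 1 <= `|x|.
Proof. by move=> /norm_intr_ge1; apply. Qed.

Lemma int_gtN1 x : x \is a Num.int -> -1 < x -> 0 <= x.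
Proof.
move=> /intrP [z ->]; rewrite -(mulrN1z 1) ltr_int ler0z; lia.
Qed.

Definition badform d (b : 'cV[R]_d) : Prop := exists c, 0 < c /\
  forall (h : 'rV[R]_d) p, Zpts h -> h != 0 -> p \is a Num.int ->
    c <= supn h ^+ d * `|(h *m b) 0 0 + p|.

(** The usual condition $q^{1/d}\|qb-r\|\ge c$ raised to the power [d], which avoids roots. *)
Definition badsim d (b : 'cV[R]_d) : Prop := exists c, 0 < c /\
  forall (q : nat) (r : 'cV[R]_d), (0 < q)%N -> (forall i, r i 0 \is a Num.int) ->
    exists i, c <= q%:R * `|q%:R * b i 0 - r i 0| ^+ d.

Lemma fr_sub x y : exists2 k, k \is a @Num.int R & fr x - fr y = x - y + k.
Proof.
exists ((Num.floor y)%:~R - (Num.floor x)%:~R); first by rewrite rpredB ?intr_int.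
by rewrite /fr; ring.
Qed.

(** Pigeonhole as in Dirichlet's theorem; [badform] excludes the value 0, and passing to opposites
    makes the value positive. *)
Lemma dirichlet_form d (b : 'cV[R]_d) (I : nat) : (0 < d)%N -> badform b ->
  exists (h : 'rV[R]_d) p, [/\ Zpts h, p \is a Num.int, h != 0, supn h <= (2 ^ I)%:R &
    0 < (h *m b) 0 0 + p <= ((2 ^ I) ^ d)%:R^-1].
Proof.
move=> d0 [c [c0 bad]].
have [H EH] : exists H, ((2 ^ I) ^ d)%N = H.+1.
  by exists (((2 ^ I) ^ d).-1); rewrite prednK // expn_gt0 expn_gt0.
pose hv (f : {ffun 'I_d -> 'I_(2 ^ I).+1}) : 'rV[R]_d := \row_i (f i : nat)%:R.
have cardlt : (#|'I_H.+1| < #|{ffun 'I_d -> 'I_(2 ^ I).+1}|)%N.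
  by rewrite card_ord card_ffun !card_ord -EH ltn_exp2r.
have [f [g [fg /fbox_eq]]] := pigeon (fun f => fbox H ((hv f *m b) 0 0)) cardlt.
have [k ki ->] := fr_sub ((hv f *m b) 0 0) ((hv g *m b) 0 0).
rewrite -EH => lt.
pose h := hv f - hv g.
have hE : (h *m b) 0 0 = (hv f *m b) 0 0 - (hv g *m b) 0 0 by rewrite mulmxBl !mxE.
rewrite -hE in lt.
have hZ : Zpts h by apply: ZptsB => i; rewrite mxE natr_int.
have h0 : h != 0.
  apply: contra fg => /eqP /rowP e; apply/eqP/ffunP => i; apply: val_inj => /=.
  move/(_ i): e; rewrite !mxE => /eqP; rewrite subr_eq0 => /eqP /eqP.
  by rewrite eqr_nat => /eqP.
have hs : supn h <= (2 ^ I)%:R.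
  apply: supn_le => // i; rewrite !mxE.
  have a1 : (f i : nat)%:R <= (2 ^ I)%:R :> R by rewrite ler_nat -ltnS.
  have a2 : (g i : nat)%:R <= (2 ^ I)%:R :> R by rewrite ler_nat -ltnS.
  have a3 : 0 <= (f i : nat)%:R :> R by [].
  have a4 : 0 <= (g i : nat)%:R :> R by [].
  by rewrite ler_norml; lra.
have n0 : (h *m b) 0 0 + k != 0.
  apply/eqP => e; have := bad h k hZ h0 ki; rewrite e normr0 mulr0; lra.
case: (ltrgt0P ((h *m b) 0 0 + k)) => [pos|neg|/eqP]; last by rewrite (negbTE n0).
  by exists h, k; split => //; rewrite pos /= -(gtr0_norm pos) ltW.
exists (- h), (- k); split; rewrite ?oppr_eq0 ?supnN ?rpredN //; first exact: ZptsN.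
by rewrite mulNmx mxE -opprD oppr_gt0 neg /= -(ltr0_norm neg) ltW.
Qed.

(** Induction on the scale: the remainder at scale [I] is at most $2^{-Id}$, while the vector of
    [dirichlet_form] at scale [I.+1] has value at least $c\,2^{-(I+1)d}$, so at most [2 ^ d / c]
    copies of it refine the approximation. *)
Lemma greedy d (b : 'cV[R]_d) : (0 < d)%N -> badform b ->
  exists C, 0 < C /\ forall (I : nat) x, exists (h : 'rV[R]_d) p,
    [/\ Zpts h, p \is a Num.int, supn h <= C * (2 ^ I)%:R &
      0 < (h *m b) 0 0 + p - x <= ((2 ^ I) ^ d)%:R^-1].
Proof.
move=> d0 bf; have [c [c0 bad]] := bf.
(* The added vector has size at most [2 ^ d / c * 2 ^ I.+1], half of [C * 2 ^ I.+1]; the other half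
   is the inherited [C * 2 ^ I]. *)
pose C := 2 * (2 ^ d)%:R / c.
have C0 : 0 < C by rewrite divr_gt0 // mulr_gt0 // ltr0n expn_gt0.
exists C; split=> //; elim=> [|I IH] x.
  exists 0, ((Num.floor x)%:~R + 1); split; first exact: Zpts0.
  - by rewrite rpredD ?rpred1 ?intr_int.
  - by rewrite supn0 mulr_ge0 ?(ltW C0).
  rewrite mul0mx mxE expn0 exp1n invr1.
  by have := floor_itv x; rewrite intrD; lra.
have [h [p [hZ pi hs /andP[e0 e1]]]] := IH x.
have [g [q [gZ qi g0 gs /andP[v0 v1]]]] := dirichlet_form I.+1 d0 bf.
set v := (g *m b) 0 0 + q in v0 v1.
set e := (h *m b) 0 0 + p - x in e0 e1.
have vc : c <= ((2 ^ I.+1) ^ d)%:R * v.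
  apply: (le_trans (bad g q gZ g0 qi)); rewrite -/v gtr0_norm // ler_wpM2r ?(ltW v0) //.
  by rewrite natrX; apply: lerXn2r; rewrite ?nnegrE ?supn_ge0 ?ler0n.
(* Ceiling minus one rather than floor: the remainder [e - j * v] must stay positive and at most
   [v]. *)
pose j := (Num.ceil (e / v) - 1)%:~R : R.
have ji : j \is a Num.int by exact: intr_int.
have /andP[j1 j2] : j < e / v <= j + 1.
  by rewrite /j intrD; have := ceil_itv (e / v); rewrite intrD; lra.
have j0 : 0 <= j.
  have jN1 : -1 < j by have := divr_gt0 e0 v0; lra.
  exact: int_gtN1.
exists (h - j *: g), (p - j * q); split.
- by apply: ZptsB => //; apply: ZptsZ.
- by rewrite rpredB // rpredM.
- apply: le_trans (supnB _ _) _; rewrite supnZ ger0_norm //.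
  have J : j <= (2 ^ d)%:R / c.
    apply: (le_trans (ltW j1)); rewrite ler_pdivrMr // mulrAC ler_pdivlMr //.
    have P0 : 0 < ((2 ^ I) ^ d)%:R :> R by rewrite ltr0n expn_gt0 expn_gt0.
    have : e * c <= ((2 ^ I) ^ d)%:R^-1 * (((2 ^ I.+1) ^ d)%:R * v).
      by apply: ler_pM => //; exact: ltW.
    suff -> : ((2 ^ I) ^ d)%:R^-1 * (((2 ^ I.+1) ^ d)%:R * v) = (2 ^ d)%:R * v by [].
    by rewrite expnS expnMn natrM; field; rewrite gt_eqF.
  have : j * supn g <= (2 ^ d)%:R / c * (2 ^ I.+1)%:R.
    by apply: ler_pM => //; exact: supn_ge0.
  by move: hs; rewrite /C expnS natrM; lra.
- have -> : ((h - j *: g) *m b) 0 0 + (p - j * q) - x = e - j * v.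
    by rewrite mulmxBl -scalemxAl !mxE /e /v !mxE; ring.
  move: j1 j2; rewrite ltr_pdivlMr // ler_pdivrMr // => j1 j2.
  by apply/andP; split; lra.
Qed.

(* Pigeonhole on the multiples of [b]: a small value of the form at [h] would give a denominator
   approximating all coordinates of [b] too well. *)
Lemma transference d (b : 'cV[R]_d.+1) : badsim b -> badform b.
Proof.
move=> [c [c0 bad]].
pose D : R := d.+1%:R ^+ d.+1.
have D0 : 0 < D by rewrite exprn_gt0.
(* With [M] and [Q] below, this makes $Q(d+1)^{d+1}M^{-(d+1)} = D/T$ smaller than [c], the final
   contradiction. *)
pose T := (`|Num.floor (D / c)|%N).+1.
have T0 : 0 < T%:R :> R by [].
have TD : D < c * T%:R.
  rewrite mulrC -ltr_pdivrMr // /T -[_.+1]addn1 natrD.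
  rewrite -[X in X + _](_ : (Num.floor (D / c))%:~R = _).
    by have := floor_itv (D / c); rewrite intrD; lra.
  by rewrite -[in LHS](gez0_abs (_ : 0 <= Num.floor (D / c))) // floor_ge0 divr_ge0 ?ltW.
exists (T%:R ^- d.+1); split; first by rewrite invr_gt0 exprn_gt0.
move=> h p hZ h0 pint; rewrite leNgt; apply/negP => lt.
have [i1 hi1] := supn_attained h0.
pose hz i := Num.floor (h 0 i).
have hzE i : h 0 i = (hz i)%:~R by rewrite /hz floorK ?hZ.
pose pz := Num.floor p.
have pzE : p = pz%:~R by rewrite /pz floorK.
pose N := `|hz i1|%N.
have NE : supn h = N%:R.
  by rewrite hi1 hzE /N -intr_norm natr_absz.
have N0 : (0 < N)%N by rewrite -(ltr_nat R) -NE supn_gt0.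
set dl := (h *m b) 0 0 + p in lt.
pose M := (T * N)%N.
have M0 : (0 < M)%N by rewrite muln_gt0.
have [M' EM] : exists M', M = M'.+1 by exists M.-1; rewrite prednK.
have [N' EN] : exists N', N = N'.+1 by exists N.-1; rewrite prednK.
pose Q := (M ^ d * N)%N.
(* The residue of [X q] modulo [N] joins the pigeonhole so that the numerator at [i1] can be solved
   for: [h 0 i1] divides the difference [S], and $\sum_i h_i(qb_i-r_i)$ becomes [q] times [dl]. *)
pose X (q : nat) : int := pz * q%:Z + \sum_(k < d) hz (lift i1 k) * Num.floor (q%:R * b (lift i1 k) 0).
have cardlt : (#|{: {ffun 'I_d -> 'I_M'.+1} * 'I_N'.+1}| < #|'I_Q.+1|)%N.
  by rewrite card_prod card_ffun !card_ord -EM -EN.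
have [q1' [q2' [neq E]]] := pigeon (fun q : 'I_Q.+1 =>
   ([ffun k => fbox M' ((q : nat)%:R * b (lift i1 k) 0)],
    (inord `|(X q %% N%:Z)%Z|%N : 'I_N'.+1))) cardlt.
have [q1 [q2 [ltq q2Q e1 e2]]] : exists q1 q2 : nat, [/\ (q1 < q2)%N, (q2 <= Q)%N,
    (forall k, `|fr (q2%:R * b (lift i1 k) 0) - fr (q1%:R * b (lift i1 k) 0)| < M%:R^-1) &
    (N%:Z %| X q2 - X q1)%Z].
  wlog lt12 : q1' q2' neq E / (q1' < q2')%N.
    move=> W; case: (ltngtP q1' q2') => [l|l|/val_inj e]; first exact: W neq E l.
      by apply: (W _ _ _ (esym E) l); rewrite eq_sym.
    by rewrite e eqxx in neq.
  move: E => -[/ffunP E1 /(congr1 val) E2]; exists q1', q2'; split => //.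
  - by rewrite -ltnS.
  - by move=> k; have := E1 k; rewrite !ffunE distrC EM => /fbox_eq.
  - move: E2; rewrite /=.
    have Nz : N%:Z != 0 by rewrite eqz_nat -lt0n.
    have modlt (z : int) : (`|(z %% N%:Z)%Z| < N'.+1)%N.
      by rewrite -EN -ltz_nat gez0_abs ?modz_ge0 // ltz_pmod.
    rewrite !inordK ?modlt // => /(congr1 Posz).
    rewrite !(gez0_abs (modz_ge0 _ Nz)) => /eqP E2.
    by rewrite -eqz_mod_dvd eq_sym.
pose q := (q2 - q1)%N.
have q0 : (0 < q)%N by rewrite subn_gt0.
have qE : q%:R = q2%:R - q1%:R :> R by rewrite natrB // ltnW.
pose rr i : int := Num.floor (q2%:R * b i 0) - Num.floor (q1%:R * b i 0).
pose S : int := X q2 - X q1.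
have SE : S = pz * q%:Z + \sum_(k < d) hz (lift i1 k) * rr (lift i1 k).
  rewrite /S /X /rr opprD addrACA -mulrBr -subzn ?(ltnW ltq) // -sumrB.
  by congr (_ + _); apply: eq_bigr => k _; rewrite mulrBr.
have hi0 : h 0 i1 != 0 by rewrite -normr_gt0 -hi1 supn_gt0.
have [S' ES] : exists S' : int, S%:~R = - (h 0 i1 * S'%:~R) :> R.
  have : (hz i1 %| S)%Z by rewrite dvdzE; move: e2; rewrite dvdzE.
  move=> /dvdzP [S' ->]; exists (- S').
  by rewrite hzE intrM mulrNz mulrN opprK mulrC.
have lift_cases i : i = i1 \/ exists k, i = lift i1 k.
  by case: (unliftP i1 i) => [k ->|->]; [right; exists k | left].
pose r : 'cV[R]_d.+1 := \col_i (if i == i1 then S'%:~R else (rr i)%:~R).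
have rlift k : q%:R * b (lift i1 k) 0 - r (lift i1 k) 0
   = fr (q2%:R * b (lift i1 k) 0) - fr (q1%:R * b (lift i1 k) 0).
  by rewrite mxE eq_sym (negbTE (neq_lift _ _)) qE /rr /fr intrB; ring.
have Minv : 0 < M%:R^-1 :> R by rewrite invr_gt0 ltr0n.
have small i : `|q%:R * b i 0 - r i 0| <= d.+1%:R * M%:R^-1.
  case: (lift_cases i) => [->|[k ->]]; last first.
    rewrite rlift (le_trans (ltW (e1 k))) // ler_peMl ?(ltW Minv) //.
    by rewrite ler1n.
  have key : h 0 i1 * (q%:R * b i1 0 - r i1 0) = q%:R * dl
     - \sum_(k < d) h 0 (lift i1 k) * (q%:R * b (lift i1 k) 0 - r (lift i1 k) 0).
    have hbE : (h *m b) 0 0 = h 0 i1 * b i1 0 + \sum_(k < d) h 0 (lift i1 k) * b (lift i1 k) 0.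
      by rewrite mxE (bigD1_ord i1).
    rewrite /dl hbE mulrBr [r i1 0]mxE eqxx.
    have -> : h 0 i1 * S'%:~R = - S%:~R by rewrite ES opprK.
    rewrite SE intrD intrM -pzE opprK.
    rewrite (_ : (q%:Z)%:~R = q%:R) //.
    have -> : (\sum_(k < d) hz (lift i1 k) * rr (lift i1 k))%:~R =
      \sum_(k < d) h 0 (lift i1 k) * r (lift i1 k) 0 :> R.
      rewrite raddf_sum /=; apply: eq_bigr => k _.
      by rewrite mxE eq_sym (negbTE (neq_lift _ _)) intrM -hzE.
    under [X in _ - X]eq_bigr do rewrite mulrBr.
    rewrite sumrB opprB.
    have -> : \sum_(k < d) h 0 (lift i1 k) * (q%:R * b (lift i1 k) 0) =
      q%:R * \sum_(k < d) h 0 (lift i1 k) * b (lift i1 k) 0.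
      by rewrite mulr_sumr; apply: eq_bigr => k _; ring.
    by ring.
  have Nn : `|h 0 i1| = N%:R by rewrite -hi1 NE.
  have N0R : 0 < N%:R :> R by rewrite ltr0n.
  rewrite -(ler_pM2l N0R) -{1}Nn -normrM key.
  apply: (le_trans (ler_normB _ _)).
  have -> : N%:R * (d.+1%:R * M%:R^-1) = N%:R * (d%:R * M%:R^-1) + N%:R * M%:R^-1 :> R.
    by rewrite -[d.+1%:R]natr1; ring.
  rewrite addrC; apply: lerD.
    apply: (le_trans (ler_norm_sum _ _ _)).
    have -> : N%:R * (d%:R * M%:R^-1) = \sum_(k < d) (N%:R * M%:R^-1) :> R.
      by rewrite sumr_const card_ord -mulr_natr; ring.
    apply: ler_sum => k _.
    rewrite normrM; apply: ler_pM => //; first by rewrite -NE supn_ge.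
    by rewrite rlift ltW.
  rewrite normrM normr_nat.
  have qQ : q%:R <= Q%:R :> R by rewrite ler_nat (leq_trans (leq_subr _ _)).
  apply: (le_trans (ler_wpM2r (normr_ge0 _) qQ)).
  move: lt; rewrite NE -ltr_pdivlMl ?exprn_gt0 // => /ltW lt.
  apply: (le_trans (ler_wpM2l (ler0n _ _) lt)).
  rewrite /Q /M !natrM natrX natrM !exprS exprMn.
  rewrite le_eqVlt; apply/orP; left; apply/eqP; field.
  by rewrite !gt_eqF ?exprn_gt0.
have : c < c.
  apply: le_lt_trans (_ : D / T%:R < c); last by rewrite ltr_pdivrMr.
  have qQ : q%:R <= Q%:R :> R by rewrite ler_nat (leq_trans (leq_subr _ _)).
  have [|i hi] := bad q r q0.
    by move=> i; rewrite mxE; case: ifP => _; rewrite intr_int.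
  apply: (le_trans hi).
  have : q%:R * `|q%:R * b i 0 - r i 0| ^+ d.+1 <= Q%:R * (d.+1%:R * M%:R^-1) ^+ d.+1.
    apply: ler_pM => //.
    by apply: lerXn2r; rewrite ?nnegrE ?small // mulr_ge0 // ltW.
  move=> /le_trans; apply.
  rewrite exprMn -/D exprVn /Q /M !natrM natrX natrM !exprMn !exprS.
  rewrite le_eqVlt; apply/orP; left; apply/eqP; field.
  by rewrite !gt_eqF ?exprn_gt0 // ltr0n.
by rewrite ltxx.
Qed.

End Basics.

(** * Kronecker's theorem *)

Section LinearAlgebra.
Variable F : fieldType.

Lemma row_free_col_mx k n (M : 'M[F]_(k, n)) (v : 'rV[F]_n) :
  row_free M -> ~~ (v <= M)%MS -> row_free (col_mx M v).
Proof.
move=> /eqP fM nv; rewrite /row_free eqn_leq rank_leq_row /= -addsmxE.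
rewrite addn1 -{1}fM.
have : (M < M + v)%MS by rewrite /ltmx addsmxSl /= addsmx_sub submx_refl.
by rewrite ltmxErank => /andP[].
Qed.

Lemma not_row_full_ker k n (X : 'M[F]_(k, n)) : ~~ row_full X ->
  exists2 f : 'cV[F]_n, f != 0 & X *m f = 0.
Proof.
move=> nf; have : kermx X^T != 0.
  rewrite -mxrank_eq0 mxrank_ker mxrank_tr subn_eq0 -ltnNge.
  by rewrite ltn_neqAle rank_leq_col andbT.
case/rowV0Pn => v /sub_kermxP vX v0; exists v^T.
  by rewrite -(inj_eq (@trmx_inj _ _ _)) trmxK trmx0.
by apply: (@trmx_inj _ _ _); rewrite trmx_mul trmxK trmx0.
Qed.

(** An independent family in [V] is extended greedily; if it gets stuck below size [n], a form
    killing its span kills all of [V]. *)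
Lemma span_dichotomy n (V : set 'rV[F]_n) :
  (exists M : 'M[F]_n, (forall i, V (row i M)) /\ M \in unitmx) \/
  (exists2 f : 'cV[F]_n, f != 0 & forall v, V v -> v *m f = 0).
Proof.
suff H k : (k <= n)%N ->
  (exists M : 'M[F]_(k, n), (forall i, V (row i M)) /\ row_free M) \/
  (exists2 f : 'cV[F]_n, f != 0 & forall v, V v -> v *m f = 0).
  case: (H n (leqnn n)) => [[M [VM fM]]|]; last by right.
  by left; exists M; split => //; rewrite -row_free_unit.
elim: k => [|k IH] kn.
  left; exists 0; split => [[]//|]; by rewrite /row_free mxrank0.
case: (IH (ltnW kn)) => [[M [VM fM]]|]; last by right.
case: (pselect (exists2 v, V v & ~~ (v <= M)%MS)) => [[v Vv nv]|no].
  left; rewrite -addn1; exists (col_mx M v); split; last exact: row_free_col_mx.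
  move=> i; rewrite -(splitK i); case: (fintype.split i) => j /=.
    by rewrite rowKu.
  by rewrite rowKd row_id.
right; have [|f f0 Mf] := @not_row_full_ker _ _ M.
  by rewrite /row_full (eqP fM) neq_ltn kn.
exists f => // v Vv; case: (boolP (v <= M)%MS) => [/submxP [D ->]|nv].
  by rewrite -mulmxA Mf mulmx0.
by case: no; exists v.
Qed.

End LinearAlgebra.

Section Kronecker.
Variable R : realType.

(** Pigeonhole produces a denominator that depends on the element; the factorial of the common bound
    clears all of them at once. *)
Lemma natr_fact_int (q Q : nat) (x : R) : (0 < q <= Q)%N ->
  q%:R * x \is a Num.int -> (Q`!)%:R * x \is a Num.int.
Proof.
move=> qQ xi; have /dvdnP [k ->] : (q %| Q`!)%N by apply: dvdn_fact.
by rewrite natrM -mulrA rpredM ?natr_int.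
Qed.

Lemma small_inv (e : R) : 0 < e -> exists H : nat, H.+1%:R^-1 < e.
Proof.
move=> e0; exists `|Num.floor e^-1|%N.
have f0 : 0 <= Num.floor e^-1 by rewrite floor_ge0 invr_ge0 ltW.
rewrite invf_plt ?posrE // -[_.+1]addn1 natrD.
rewrite -[X in X + _](_ : (Num.floor e^-1)%:~R = _); last by rewrite -[in LHS](gez0_abs f0).
by have := floor_itv e^-1; rewrite intrD => /andP[].
Qed.

(* Let V be spanned by the arbitrarily small vectors of the group Z^d A + Z^m.  If V is proper, a
   pigeonhole on multiples of group elements makes a linear form vanishing on V rational, against
   the hypothesis. *)
Lemma kronecker d m (A : 'M[R]_(d, m)) :
  (forall b : 'cV[R]_m, (forall i, b i 0 \is a Num.int) -> b != 0 ->
     ~ (forall i, (A *m b) i 0 \is a Num.int)) ->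
  forall (tau : 'rV[R]_m) (eps : R), 0 < eps ->
    exists (n : 'rV[R]_d) (p : 'rV[R]_m),
      [/\ Zpts n, Zpts p & supn (n *m A + p - tau) < eps].
Proof.
move=> irr.
pose G (v : 'rV[R]_m) := exists n p, [/\ @Zpts R d n, @Zpts R m p & v = n *m A + p].
have GD u v : G u -> G v -> G (u + v).
  move=> [n [p [hn hp ->]]] [n' [p' [hn' hp' ->]]]; exists (n + n'), (p + p').
  by split; rewrite ?mulmxDl 1?addrACA //; apply: ZptsD.
have GN u : G u -> G (- u).
  move=> [n [p [hn hp ->]]]; exists (- n), (- p).
  by split; rewrite ?mulNmx ?opprD //; apply: ZptsN.
have GZ a u : a \is a Num.int -> G u -> G (a *: u).
  move=> ai [n [p [hn hp ->]]]; exists (a *: n), (a *: p).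
  by split; rewrite -?scalemxAl ?scalerDr //; apply: ZptsZ.
have Gint p : Zpts p -> G p.
  by move=> hp; exists 0, p; split => //; rewrite ?mul0mx ?add0r //; apply: Zpts0.
have G0 : G 0 by apply: Gint; exact: Zpts0.
pose P k eps := exists M : 'M[R]_(k, m),
  row_free M /\ forall i, G (row i M) /\ supn (row i M) < eps.
have Pm k eps : P k eps -> (k <= m)%N.
  by move=> [M [fM _]]; move: fM => /eqP <-; exact: rank_leq_col.
have approx k (M : 'M[R]_(k, m)) eps v : 0 < eps -> (forall i, G (row i M) /\ supn (row i M) < eps) ->
    (v <= M)%MS -> exists2 w, G w /\ (w <= M)%MS & supn (v - w) <= k%:R * eps.
  move=> e0 hM /submxP [D ->]; pose fl : 'rV[R]_k := \row_j (Num.floor (D 0 j))%:~R.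
  exists (fl *m M); first split.
  - rewrite mulmx_sum_row; elim/big_ind: _ => // j _.
    by apply: GZ; rewrite ?mxE ?intr_int //; case: (hM j).
  - exact: submxMl.
  - rewrite -mulmxBl mulmx_sum_row.
    apply: supn_le => [|i]; first by rewrite mulr_ge0 // ltW.
    rewrite summxE (le_trans (ler_norm_sum _ _ _)) //.
    rewrite mulrC -[k in k%:R]card_ord mulr_natr -sumr_const; apply: ler_sum => j _.
    rewrite mxE normrM -[eps]mul1r; apply: ler_pM => //.
      rewrite !mxE; have := fr_itv (D 0 j); rewrite /fr => /andP[a b].
      by rewrite ger0_norm // ltW.
    by rewrite (le_trans (supn_ge _ _)) // ltW //; case: (hM j).
(* The largest such [k] is the dimension of $V$. If it is [m], rounding coordinates in a basis of
   short group vectors finishes. *)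
pose Pall k := `[< forall eps, 0 < eps -> P k eps >].
have exP : exists k, Pall k.
  exists 0%N; apply/asboolP => eps e0; exists 0; split; last by case.
  by rewrite /row_free mxrank0.
have bP k : Pall k -> (k <= m)%N.
  by move/asboolP => /(_ 1 ltr01) /Pm.
case: (ex_maxnP exP bP) => k /asboolP Pk kmax.
have km := bP k (asboolT Pk).
case: (ltnP k m) => [ltkm|gekm]; last first.
  have {km gekm} km : k = m by apply/eqP; rewrite eqn_leq km.
  subst k; move=> tau eps e0.
  have m0 : 0 < m.+1%:R :> R by [].
  have [|M [fM hM]] := Pk (eps / m.+1%:R); first by rewrite divr_gt0.
  have [||w [[n [p [hn hp wE]]] _] ws] := approx _ M (eps / m.+1%:R) tau _ hM.
  - by rewrite divr_gt0.
  - by rewrite submx_full // /row_full (eqP fM).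
  exists n, p; split => //; rewrite -wE -supnN opprB; apply: (le_lt_trans ws).
  by rewrite mulrCA gtr_pMr // ltr_pdivrMr // mul1r ltr_nat.
exfalso.
have [e0 e00 nP] : exists2 e0, 0 < e0 & ~ P k.+1 e0.
  apply: contrapT => H.
  have : Pall k.+1 by apply/asboolP => eps e0; apply: contrapT => nP; apply: H; exists eps.
  by move/kmax; rewrite ltnn.
have small_in eps (M : 'M[R]_(k, m)) : eps <= e0 -> row_free M ->
    (forall i, G (row i M) /\ supn (row i M) < eps) ->
    forall v, G v -> supn v < e0 -> (v <= M)%MS.
  move=> le fM hM v Gv vs; apply: contrapT => /negP nv; apply: nP.
  rewrite -addn1; exists (col_mx M v); split; first exact: row_free_col_mx.
  move=> i; rewrite -(splitK i); case: (fintype.split i) => j /=.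
    rewrite rowKu; have [h1 h2] := hM j; split => //; exact: lt_le_trans le.
  by rewrite rowKd row_id.
(* Below the length [e0] there is no further independent direction, so every group vector shorter
   than [e0] lies in the row space of [M]. *)
have [M [fM hM]] := Pk _ e00.
have inV := small_in e0 M (lexx _) fM hM.
(* Coordinate vectors are added to $V$ until one more would fill the space. The form [f'] below
   vanishes on $V$ and on the vectors indexed by [J] and is 1 at [i0], hence is integral on integral
   vectors supported on [i0 |: J]. *)
pose VJ (J : {set 'I_m}) := (M + \sum_(i in J) <<delta_mx 0 i : 'rV[R]_m>>)%MS.
have [|J /maxsetP [nfJ maxJ] _] := @maxset_exists _ (fun J => ~~ row_full (VJ J)) finset.set0.
  by rewrite /VJ big_set0 /row_full addsmx0 (eqP fM) neq_ltn ltkm.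
have [f f0 VJf] := not_row_full_ker nfJ.
have ann v : (v <= VJ J)%MS -> v *m f = 0.
  by move=> /submxP [D ->]; rewrite -mulmxA VJf mulmx0.
have annM v : (v <= M)%MS -> v *m f = 0.
  by move=> vM; apply: ann; exact: submx_trans vM (addsmxSl _ _).
have fJ i : i \in J -> f i 0 = 0.
  move=> iJ; have : (delta_mx 0 i : 'rV[R]_m) *m f = 0.
    apply: ann; apply: submx_trans (addsmxSr _ _).
    by rewrite (sumsmx_sup i) // genmxE.
  by rewrite -rowE => /rowP /(_ 0); rewrite !mxE.
have [i0 fi0] : exists i0, f i0 0 != 0.
  by case/cV0Pn: f0 => i0 h; exists i0.
have i0J : i0 \notin J by apply: contra fi0 => /fJ ->.
have full : row_full (VJ (i0 |: J)).
  apply: contrapT => /negP nf; move: (maxJ _ nf (finset.subsetUr _ _)) => e.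
  by move: i0J; rewrite -e finset.setU11.
pose f' := (f i0 0)^-1 *: f.
have ann' v : (v <= M)%MS -> v *m f' = 0.
  by move=> /annM e; rewrite /f' -scalemxAr e scaler0.
have f'z (z : 'rV[R]_m) : (forall l, l \notin i0 |: J -> z 0 l = 0) -> (z *m f') 0 0 = z 0 i0.
  move=> hz; rewrite mxE (bigD1 i0) //= mxE mulVf // mulr1 big1 ?addr0 // => l li0.
  rewrite mxE; case: (boolP (l \in J)) => [/fJ ->|nJ]; first by rewrite mulr0 mulr0.
  by rewrite hz ?mul0r // finset.in_setU1 negb_or li0.
have decomp g : exists c : 'rV[R]_m, (forall l, l \notin i0 |: J -> c 0 l = 0) /\ (g - c <= M)%MS.
  have : (g <= VJ (i0 |: J))%MS by rewrite submx_full.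
  case/sub_addsmxP => u gE; exists (u.2 *m (\sum_(i in i0 |: J) <<delta_mx 0 i : 'rV[R]_m>>)%MS).
  split; last by rewrite gE addrK submxMl.
  move=> l nl.
  have : (u.2 *m (\sum_(i in i0 |: J) <<delta_mx 0 i : 'rV[R]_m>>)%MS <= kermx (delta_mx l 0 : 'cV[R]_m))%MS.
    apply: submx_trans (submxMl _ _) _; apply/sumsmx_subP => i iJ; rewrite genmxE.
    apply/sub_kermxP; rewrite mul_delta_mx_cond; case: eqP => [e|]; last by rewrite mulr0n.
    by move: nl; rewrite -e iJ.
  by move/sub_kermxP; rewrite -colE => /rowP /(_ 0); rewrite !mxE.
have [H HH] := @small_inv (e0 / 2) (divr_gt0 e00 (ltr0n _ 2)).
pose eps := e0 / (2 * m.+1%:R).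
have eps0 : 0 < eps by rewrite divr_gt0 // mulr_gt0.
have epse : eps <= e0.
  by rewrite /eps ler_pdivrMr ?mulr_gt0 // ler_peMr ?(ltW e00) // -natrM ler1n.
have keps : k%:R * eps < e0 / 2.
  have -> : k%:R * eps = (e0 / 2) * (k%:R / m.+1%:R).
    by rewrite /eps invfM; ring.
  rewrite gtr_pMr ?divr_gt0 //.
  by rewrite ltr_pdivrMr // mul1r ltr_nat ltnS ltnW.
have [M' [fM' hM']] := Pk eps eps0.
have MM' : (M <= M')%MS.
  apply/row_subP => i; have [h1 h2] := hM i.
  exact: (small_in eps M').
have M'M : (M' <= M)%MS.
  apply/row_subP => i; have [h1 h2] := hM' i.
  apply: inV => //; exact: lt_le_trans epse.
pose Q := (H.+1 ^ m)%N.
(* Modulo $V$, [g] is a vector [c] supported on [i0 |: J], and some multiple [q *: c] with [q <= Q]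
   is close to an integral [z]. Then [q *: g - z] is within [e0] of a group element of $V$, so it
   lies in $V$ itself and [f'] takes the value [z 0 i0] at [q *: g]. *)
have qint g : G g -> (Q`!)%:R * (g *m f') 0 0 \is a Num.int.
  move=> Gg; have [c [cJ gcM]] := decomp g.
  have cardlt : (#|{ffun 'I_m -> 'I_H.+1}| < #|'I_Q.+1|)%N.
    by rewrite card_ffun !card_ord.
  have [k1 [k2 [neq E]]] := pigeon (fun q : 'I_Q.+1 => [ffun l => fbox H ((q : nat)%:R * c 0 l)]) cardlt.
  wlog lt12 : k1 k2 neq E / (k1 < k2)%N.
    move=> W; case: (ltngtP k1 k2) => [l|l|/val_inj e]; first exact: W neq E l.
      by apply: (W _ _ _ (esym E) l); rewrite eq_sym.
    by rewrite e eqxx in neq.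
  pose q := (k2 - k1)%N.
  have qE : q%:R = k2%:R - k1%:R :> R by rewrite natrB // ltnW.
  pose z : 'rV[R]_m := \row_l ((Num.floor (k2%:R * c 0 l))%:~R - (Num.floor (k1%:R * c 0 l))%:~R).
  have zZ : Zpts z by move=> l; rewrite mxE rpredB ?intr_int.
  have zJ l : l \notin i0 |: J -> z 0 l = 0.
    by move=> nl; rewrite mxE cJ // !mulr0 subrr.
  pose g' := q%:R *: g - z.
  have Gg' : G g'.
    by apply: GD; [apply: GZ => //; rewrite natr_int | apply: GN; apply: Gint].
  have vM : (q%:R *: (g - c) <= M')%MS by rewrite scalemx_sub // (submx_trans gcM).
  have [w [Gw wM'] ws] := approx _ M' eps _ eps0 hM' vM.
  have wM : (w <= M)%MS := submx_trans wM' M'M.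
  have : (g' - w <= M)%MS.
    apply: inV; first by apply: GD => //; apply: GN.
    have -> : g' - w = (q%:R *: (g - c) - w) + (q%:R *: c - z).
      by rewrite /g' scalerBr; apply/rowP => l; rewrite !mxE; ring.
    apply: (le_lt_trans (supnD _ _)).
    have s2 : supn (q%:R *: c - z) <= H.+1%:R^-1.
      apply: supn_le => [|l]; first by rewrite invr_ge0.
      rewrite !mxE.
      move/ffunP: (E) => /(_ l); rewrite !ffunE => /fbox_eq; rewrite distrC.
      rewrite /fr qE => /ltW; apply: le_trans.
      rewrite le_eqVlt; apply/orP; left; apply/eqP; congr (`|_|); ring.
    by rewrite [X in _ < X](splitr e0); apply: ler_ltD (le_lt_trans s2 HH); rewrite (le_trans ws) // ltW.
  move/ann'; rewrite mulmxBl (ann' _ _ wM) subr0 /g' mulmxBl -scalemxAl.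
  move=> e1; have : q%:R * (g *m f') 0 0 - (z *m f') 0 0 = 0.
    transitivity ((q%:R *: (g *m f') - z *m f') 0 0); last by rewrite e1 mxE.
    by rewrite [RHS]mxE [X in _ = X + _]mxE [X in _ = _ + X]mxE.
  rewrite (f'z z zJ) => /eqP; rewrite subr_eq0 => /eqP e.
  apply: (@natr_fact_int q Q); first by rewrite subn_gt0 lt12 (leq_trans (leq_subr _ _)) // -ltnS.
  rewrite e; exact: zZ.
pose b := (Q`!)%:R *: f'.
apply: (irr b).
- move=> i; have : G (delta_mx 0 i).
    by apply: Gint => j; rewrite mxE natr_int.
  by move/qint; rewrite -rowE !mxE.
- apply/eqP => /colP /(_ i0); rewrite !mxE mulVf // mulr1 => /eqP.
  by rewrite pnatr_eq0 eqn0Ngt fact_gt0.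
- move=> i; have : G (row i A).
    exists (delta_mx 0 i), 0; split; [|exact: Zpts0|by rewrite addr0 -rowE].
    by move=> j; rewrite mxE natr_int.
  move/qint => h; have -> : (A *m b) i 0 = (Q`!)%:R * (row i A *m f') 0 0; last exact: h.
  by rewrite /b -scalemxAr -row_mul [LHS]mxE [in RHS]mxE.
Qed.
End Kronecker.

(** * The hyperplane game *)

(** The counting device of the game: indices confined to a short range are determined by a residue,
    so an injection into residues bounds their number. *)
Lemma nat_dist_lt (R : realType) (j k L : nat) : `|j%:R - k%:R : R| < L%:R -> (j %% L = k %% L)%N -> j = k.
Proof.
wlog jk : j k / (j <= k)%N.
  move=> W; case: (leqP j k) => [l|/ltnW l]; first exact: W.
  by rewrite distrC => h /esym e; rewrite (W k j).
rewrite distrC -natrB // normr_nat ltr_nat => lt /esym /eqP.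
rewrite eqn_mod_dvd // => dv; case: (posnP (k - j)%N) => [|p0]; first lia.
by have := dvdn_leq p0 dv; rewrite leqNgt lt.
Qed.

Section GridCubes.
Variables (R : realType) (d m K : nat).
Hypothesis K_gt0 : (0 < K)%N.
Implicit Types (x y a : 'M[R]_(d, m)) (i : 'M['I_K]_(d, m)).

Definition mesh (t : nat) : R := (K%:R : R) ^- t.
Definition cube x t : set 'M[R]_(d, m) :=
  [set y | forall u v, x u v <= y u v <= x u v + mesh t].
Definition child t x i : 'M[R]_(d, m) :=
  \matrix_(u, v) (x u v + mesh t.+1 * (i u v : nat)%:R).
Definition dotm a y : R := \sum_u \sum_v a u v * y u v.
Definition l1 a : R := \sum_u \sum_v `|a u v|.

Lemma mesh_gt0 t : 0 < mesh t.
Proof. by rewrite /mesh invr_gt0 exprn_gt0 // ltr0n. Qed.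

Lemma meshS t : mesh t = K%:R * mesh t.+1.
Proof.
have K0 : K%:R != 0 :> R by rewrite pnatr_eq0 -lt0n.
by rewrite /mesh exprS; field; rewrite K0 expf_neq0.
Qed.

Lemma child_sub t x i : cube (child t x i) t.+1 `<=` cube x t.
Proof.
move=> y hy u v; have /andP[h1 h2] := hy u v.
rewrite mxE in h1 h2; have r0 := mesh_gt0 t.+1.
have iK : (i u v : nat)%:R + 1 <= K%:R :> R by rewrite natr1 ler_nat ltn_ord.
have i0 : 0 <= (i u v : nat)%:R :> R by [].
apply/andP; split; first by apply: le_trans h1; rewrite lerDl mulr_ge0 // ltW.
apply: le_trans h2 _; rewrite -addrA lerD2l (meshS t).
by have := ler_wpM2r (ltW r0) iK; lra.
Qed.

Lemma dotm_close a y y' e : (forall u v, `|y u v - y' u v| <= e) ->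
  `|dotm a y - dotm a y'| <= l1 a * e.
Proof.
move=> h; rewrite /dotm /l1 -sumrB mulr_suml (le_trans (ler_norm_sum _ _ _)) //.
apply: ler_sum => u _; rewrite -sumrB mulr_suml (le_trans (ler_norm_sum _ _ _)) //.
by apply: ler_sum => v _; rewrite -mulrBr normrM ler_wpM2l.
Qed.

Definition bad_child t x a c i : bool :=
  `[< exists2 y, cube (child t x i) t.+1 y & `|dotm a y - c| < mesh t.+1 * l1 a >].

(** On each line of children parallel to the axis of the largest entry of [a], the form moves by a
    definite amount from one child to the next, so boundedly many of the [K] children on the line
    are bad. *)
Lemma card_bad_child t x a c : a != 0 ->
  (K * #|[pred i | bad_child t x a c i]| <= (4 * (d * m)).+1 * #|{: 'M['I_K]_(d, m)}|)%N.
Proof.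
move=> a0.
have [u1 [v1 h1]] : exists u v, a u v != 0.
  apply: contrapT => /forallNP H; case/eqP: a0; apply/matrixP => u v; rewrite mxE.
  by apply: contrapT => /eqP n; apply: (H u); exists v.
pose P := [arg max_(p > (u1, v1)) `|a p.1 p.2|]%O.
have Pmax p : `|a p.1 p.2| <= `|a P.1 P.2|.
  by rewrite /P; case: arg_maxP => // q _ /(_ p isT).
set u0 := P.1 in Pmax; set v0 := P.2 in Pmax.
have a00 : 0 < `|a u0 v0| by apply: lt_le_trans (Pmax (u1, v1)); rewrite normr_gt0.
have l1le : l1 a <= (d * m)%:R * `|a u0 v0|.
  rewrite /l1; apply: le_trans (_ : \sum_(u < d) \sum_(v < m) `|a u0 v0| <= _).
    by apply: ler_sum => u _; apply: ler_sum => v _; exact: (Pmax (u, v)).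
  under eq_bigr do rewrite sumr_const card_ord.
  by rewrite sumr_const card_ord -mulrnA mulnC mulr_natl.
have r0 := mesh_gt0 t.+1.
have l10 : 0 <= l1 a by apply: sumr_ge0 => u _; apply: sumr_ge0.
have badP i : bad_child t x a c i -> `|dotm a (child t x i) - c| < 2 * (mesh t.+1 * l1 a).
  case/asboolP => y hy lt; rewrite (_ : _ - c = (dotm a (child t x i) - dotm a y) + (dotm a y - c)); last by ring.
  rewrite (le_lt_trans (ler_normD _ _)) // mulr_natl mulr2n; apply: ler_ltD lt.
  rewrite mulrC; apply: dotm_close => u v; have /andP[g1 g2] := hy u v.
  by rewrite ler_norml; apply/andP; split; lra.
pose L := (4 * (d * m)).+1.
pose upd i (k : 'I_K) : 'M['I_K]_(d, m) :=
  \matrix_(u, v) (if (u == u0) && (v == v0) then k else i u v).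
(* The extra index [k] overwrites the position on the line, which is kept as a residue modulo [L];
   this yields the factor [K] without choosing representatives of lines. *)
pose f (p : 'M['I_K]_(d, m) * 'I_K) : 'M['I_K]_(d, m) * 'I_L :=
  (upd p.1 p.2, inord (p.1 u0 v0 %% L)%N).
have finj : {in [pred p : 'M['I_K]_(d, m) * 'I_K | bad_child t x a c p.1] &, injective f}.
  move=> [i k] [i' k'] /= bi bi' [/matrixP e1 e2].
  have kk : k = k' by have := e1 u0 v0; rewrite !mxE !eqxx.
  have off u v : ~~ ((u == u0) && (v == v0)) -> i u v = i' u v.
    by move=> n; have := e1 u v; rewrite !mxE (negbTE n).
  suff e00 : i u0 v0 = i' u0 v0.
    congr pair => //; apply/matrixP => u v; case: (boolP ((u == u0) && (v == v0))); last exact: off.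
    by case/andP => /eqP -> /eqP ->.
  apply: val_inj => /=; apply: (@nat_dist_lt R _ _ L); last first.
    by move/(congr1 val): e2; rewrite /= !inordK // ltn_pmod.
  have /badP l := bi; have /badP l' := bi'.
  have D : dotm a (child t x i) - dotm a (child t x i') =
      a u0 v0 * (mesh t.+1 * ((i u0 v0 : nat)%:R - (i' u0 v0 : nat)%:R)).
    rewrite /dotm -sumrB (bigD1 u0) //= [X in _ + X]big1 ?addr0; last first.
      move=> u nu; rewrite -sumrB big1 // => v _; rewrite !mxE off ?subrr //.
      by rewrite (negbTE nu).
    rewrite -sumrB (bigD1 v0) //= [X in _ + X]big1 ?addr0; last first.
      by move=> v nv; rewrite !mxE off ?subrr // (negbTE nv) andbF.
    by rewrite !mxE; ring.
  have : `|dotm a (child t x i) - dotm a (child t x i')| < 4 * (mesh t.+1 * l1 a).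
    rewrite (_ : _ - _ = (dotm a (child t x i) - c) - (dotm a (child t x i') - c)); last by ring.
    by rewrite (le_lt_trans (ler_normB _ _)) //; lra.
  rewrite D !normrM (gtr0_norm r0) => lt.
  have : `|a u0 v0| * (mesh t.+1 * `|(i u0 v0 : nat)%:R - (i' u0 v0 : nat)%:R|)
      < `|a u0 v0| * (mesh t.+1 * (4 * (d * m))%:R).
    apply: (lt_le_trans lt); rewrite natrM.
    have : mesh t.+1 * l1 a <= mesh t.+1 * ((d * m)%:R * `|a u0 v0|) by rewrite ler_wpM2l // ltW.
    lra.
  rewrite ltr_pM2l // ltr_pM2l // => h; apply: lt_trans h _.
  by rewrite ltr_nat.
have := @leq_card_in _ _ f _ finj.
rewrite card_prod card_ord [X in (_ <= X)%N]mulnC; apply: leq_trans.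
have -> : (K * #|[pred i | bad_child t x a c i]|)%N =
    #|[predX [pred i | bad_child t x a c i] & 'I_K]| by rewrite cardX card_ord mulnC.
by apply: subset_leq_card; apply/fintype.subsetP => -[i k]; rewrite !inE => /andP[].
Qed.

(** Two children met by [U] have indices differing by at most 1 in every entry, so the parities of
    the entries identify them. *)
Lemma card_meeting_children t x (U : set 'M[R]_(d, m)) :
  (forall y y', U y -> U y' -> forall u v, `|y u v - y' u v| < mesh t.+1) ->
  (#|[pred i | asbool (U `&` cube (child t x i) t.+1 !=set0)]| <= 2 ^ (d * m))%N.
Proof.
move=> hU; have r0 := mesh_gt0 t.+1.
pose f i : 'M['I_2]_(d, m) := \matrix_(u, v) inord (i u v %% 2)%N.
have finj : {in [pred i | asbool (U `&` cube (child t x i) t.+1 !=set0)] &, injective f}.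
  move=> i i' /asboolP [y [Uy hy]] /asboolP [y' [Uy' hy']] /matrixP e.
  apply/matrixP => u v; apply: val_inj; apply: (@nat_dist_lt R _ _ 2); last first.
    by have /(congr1 val) := e u v; rewrite !mxE /= !inordK ?ltn_pmod.
  have := hU _ _ Uy Uy' u v; have := hy u v; have := hy' u v; rewrite !mxE => h1 h2 h3.
  have : mesh t.+1 * `|(i u v : nat)%:R - (i' u v : nat)%:R| < mesh t.+1 * 2.
    rewrite -[in X in X < _](gtr0_norm r0) -normrM mulrBr; move: h3; rewrite !ltr_norml; lra.
  by rewrite ltr_pM2l.
by have := @leq_card_in _ _ f _ finj; rewrite card_mx card_ord.
Qed.

End GridCubes.

Section Game.
Variables (R : realType) (d m K : nat) (s : R).
Hypotheses (s_gt0 : 0 < s) (K_large : (2 * (4 * (d * m)).+1 <= K)%N).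
Let kappa : R := K%:R `^ s.
Hypothesis K_large_powR : 2 * (2 ^ (d * m))%:R * kappa <= (K ^ (d * m))%:R.
Variables (U : nat -> set 'M[R]_(d, m)) (w : nat -> R).
Hypothesis w_gt0 : forall n, 0 < w n.
Hypothesis w_diam : forall n y y', U n y -> U n y' ->
  forall u v, `|y u v - y' u v| `^ s <= w n.

Let K_gt0 : (0 < K)%N. Proof. exact: leq_trans K_large. Qed.
Let kappa_gt0 : 0 < kappa. Proof. by apply: powR_gt0; rewrite ltr0n. Qed.

Definition weight (Q : set 'M[R]_(d, m)) : \bar R :=
  (\sum_(n <oo) (if asbool (U n `&` Q !=set0) then w n else 0)%:E)%E.

Let term_ge0 Q n : (0 <= (if asbool (U n `&` Q !=set0) then w n else 0)%:E)%E.
Proof. by rewrite lee_fin; case: ifP => // _; rewrite ltW. Qed.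

Lemma weight_ge Q n : U n `&` Q !=set0 -> ((w n)%:E <= weight Q)%E.
Proof.
move=> h; apply: le_trans (nneseries_lim_ge n.+1 _) => //.
rewrite big_nat_recr //= asboolT //; apply: leeDr.
by apply: sume_ge0 => k _; exact: term_ge0.
Qed.

Lemma powR_mesh t : mesh R K t `^ s = kappa ^- t.
Proof.
have K0 : 0 < K%:R :> R by rewrite ltr0n.
elim: t => [|t IH]; first by rewrite /mesh !expr0 invr1 powR1.
have : kappa * (mesh R K t.+1 `^ s) = kappa ^- t.
  by rewrite -IH (meshS R K_gt0 t) powRM ?ler0n // ltW // mesh_gt0.
by rewrite exprS invfM => <-; rewrite mulKf // gt_eqF.
Qed.

(** Averaging: each relevant [U n] meets at most [2 ^ (d * m)] children, and by [K_large] at least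
    half of the children are good, so by [K_large_powR] the mean weight of a good child is smaller
    by the factor [kappa]. *)
Lemma child_step t x a c : a != 0 ->
  (weight (cube K x t) < (kappa ^- t.+1)%:E)%E ->
  exists2 i : 'M['I_K]_(d, m), ~~ bad_child t x a c i &
    (weight (cube K (child t x i) t.+1) < (kappa ^- t.+2)%:E)%E.
Proof.
move=> a0 Wx; apply: contrapT => H.
pose Gd := [pred i : 'M['I_K]_(d, m) | ~~ bad_child t x a c i].
have big i : Gd i -> ((kappa ^- t.+2)%:E <= weight (cube K (child t x i) t.+1))%E.
  by move=> gi; rewrite leNgt; apply/negP => lt; apply: H; exists i.
have cardGd : (K ^ (d * m) <= 2 * #|Gd|)%N.
  have h := @card_bad_child R d m K K_gt0 t x a c a0.
  have e : (#|[pred i : 'M['I_K]_(d, m) | bad_child t x a c i]| + #|Gd| = K ^ (d * m))%N.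
    rewrite -[RHS](_ : #|{: 'M['I_K]_(d, m)}| = _); last by rewrite card_mx card_ord.
    by rewrite -(cardC [pred i | bad_child t x a c i]); congr addn; apply: eq_card => i.
  rewrite -[X in (X <= _)%N]e.
  have : (K * (2 * #|[pred i : 'M['I_K]_(d, m) | bad_child t x a c i]|) <= K * K ^ (d * m))%N.
    rewrite mulnCA; move: h; rewrite card_mx card_ord; nia.
  by rewrite leq_pmul2l // -e; lia.
have meets n (i : 'M['I_K]_(d, m)) : U n `&` cube K (child t x i) t.+1 !=set0 -> U n `&` cube K x t !=set0.
  by move=> [y [Uy hy]]; exists y; split => //; exact: (child_sub K_gt0 hy).
have up : (\sum_(i | Gd i) weight (cube K (child t x i) t.+1) <=
   (2 ^ (d * m))%:R%:E * weight (cube K x t))%E.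
  rewrite /weight -nneseriesZl; last by move=> n _; exact: term_ge0.
  rewrite -nneseries_sum; last by move=> i n _; exact: term_ge0.
  apply: lee_nneseries => [n _ _|n _]; first by apply: sume_ge0 => i _; exact: term_ge0.
  rewrite sumEFin -EFinM lee_fin.
  case: (asboolP (U n `&` cube K x t !=set0)) => [me|nme]; last first.
    rewrite mulr0 big1 // => i _; case: asboolP => // me; by case: nme; apply: meets me.
  rewrite -big_mkcondr /= sumr_const -[X in X <= _]mulr_natl ler_wpM2r ?(ltW (w_gt0 n)) // ler_nat.
  apply: leq_trans (@card_meeting_children R d m K K_gt0 t x (U n) _).
    by apply: subset_leq_card; apply/fintype.subsetP => i; rewrite !inE => /andP[].
  (* A set as wide as a child would alone weigh at least [kappa ^- t.+1], more than the whole cube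
     is allowed. *)
  move=> y y' Uy Uy' u v; rewrite ltNge; apply/negP => le.
  have := lt_le_trans Wx (lexx _); apply/negP; rewrite -leNgt.
  apply: le_trans (weight_ge me); rewrite lee_fin -powR_mesh.
  apply: le_trans (w_diam Uy Uy' u v).
  by apply: ge0_ler_powR; rewrite ?nnegrE ?(ltW s_gt0) // ltW // mesh_gt0.
have low : ((#|Gd|%:R * kappa ^- t.+2)%:E <= \sum_(i | Gd i) weight (cube K (child t x i) t.+1))%E.
  apply: le_trans (_ : (\sum_(i | Gd i) (kappa ^- t.+2)%:E <= _)%E); last exact: lee_sum.
  by rewrite sumEFin sumr_const mulr_natl.
have : ((#|Gd|%:R * kappa ^- t.+2)%:E < (#|Gd|%:R * kappa ^- t.+2)%:E)%E.
  apply: (le_lt_trans (le_trans low up)).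
  have p2 : 0 < (2 ^ (d * m))%:R :> R by rewrite ltr0n expn_gt0.
  apply: lt_le_trans (_ : ((2 ^ (d * m))%:R * kappa ^- t.+1)%:E <= _)%E.
    by rewrite EFinM lte_pmul2l // lte_fin.
  rewrite lee_fin.
  have e : kappa ^- t.+1 = kappa * kappa ^- t.+2.
    by rewrite [in RHS]exprS invfM mulrA divff ?mul1r // gt_eqF.
  rewrite e mulrA ler_wpM2r ?invr_ge0 ?exprn_ge0 ?(ltW kappa_gt0) //.
  have : (K ^ (d * m))%:R <= (2 * #|Gd|)%:R :> R by rewrite ler_nat.
  by rewrite natrM; move: K_large_powR; lra.
by rewrite ltxx.
Qed.

Variables (a : nat -> 'M[R]_(d, m) -> 'M[R]_(d, m)) (c : nat -> 'M[R]_(d, m) -> R).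
Hypothesis a_neq0 : forall t x, a t x != 0.
Hypothesis w_sum : (\sum_(n <oo) (w n)%:E < (kappa^-1)%:E)%E.

(* The weight of the sets [U n] meeting the current cube decreases like [kappa ^- t.+1], while each
   single weight is a positive constant: eventually no [U n] meets the cube. *)
Lemma hyperplane_game : exists (x : nat -> 'M[R]_(d, m)) y,
  [/\ x 0%N = 0, (forall t, cube K (x t) t y),
      (forall t y', cube K (x t.+1) t.+1 y' ->
         mesh R K t.+1 * l1 (a t (x t)) <= `|dotm (a t (x t)) y' - c t (x t)|) &
      forall n, ~ U n y].
Proof.
have start : (weight (cube K 0 0) < (kappa ^- 1)%:E)%E.
  rewrite expr1; apply: le_lt_trans w_sum; apply: lee_nneseries => [n _ _|n _].
    exact: term_ge0.
  by rewrite lee_fin; case: ifP => // _; exact: ltW.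
have next t x : exists i : 'M['I_K]_(d, m), (weight (cube K x t) < (kappa ^- t.+1)%:E)%E ->
    ~~ bad_child t x (a t x) (c t x) i /\
    (weight (cube K (child t x i) t.+1) < (kappa ^- t.+2)%:E)%E.
  case: (pselect (weight (cube K x t) < (kappa ^- t.+1)%:E)%E) => [h|n]; last first.
    by exists (const_mx (Ordinal K_gt0)).
  by have [i b wi] := child_step (c t x) (a_neq0 t x) h; exists i.
pose ch t x := projT1 (cid (next t x)).
pose X := fix X t := if t is t'.+1 then child t' (X t') (ch t' (X t')) else (0 : 'M[R]_(d, m)).
have WX t : (weight (cube K (X t) t) < (kappa ^- t.+1)%:E)%E.
  elim: t => [|t IH]; first exact: start.
  by rewrite /= /ch; case: cid => i /= /(_ IH) [].
have sub t k : cube K (X (t + k)%N) (t + k)%N `<=` cube K (X t) t.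
  elim: k => [|k IH]; first by rewrite addn0.
  by rewrite addnS; apply: subset_trans IH; exact: child_sub.
have corner t : cube K (X t) t (X t).
  by move=> u v; rewrite lexx lerDl /= ltW // mesh_gt0.
have corner_le t t' u v : X t' u v <= X t u v + mesh R K t.
  case: (leqP t t') => h.
    by have /(_ u v)/andP[] : cube K (X t) t (X t') by rewrite -(subnKC h); exact/sub/corner.
  have /(_ u v)/andP[h1 _] : cube K (X t') t' (X t).
    by rewrite -(subnKC (ltnW h)); exact/sub/corner.
  by rewrite ler_wpDr // ltW // mesh_gt0.
pose y : 'M[R]_(d, m) := \matrix_(u, v) sup [set X t u v | t in setT].
have hy t : cube K (X t) t y.
  move=> u v; rewrite mxE; apply/andP; split.
    by apply: ub_le_sup; [exists (X 0%N u v + mesh R K 0) => _ [t' _ <-] | exists t].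
  by apply: ge_sup; [exists (X 0%N u v), 0%N | move=> _ [t' _ <-]].
exists X, y; split => //.
- move=> t y' hy'; rewrite leNgt; apply/negP => lt.
  have : bad_child t (X t) (a t (X t)) (c t (X t)) (ch t (X t)) by apply/asboolP; exists y'.
  by apply/negP; rewrite /ch; case: cid => i /= /(_ (WX t)) [].
- move=> n Uy.
  have wn t : w n < kappa ^- t.+1.
    by rewrite -lte_fin; apply: le_lt_trans (WX t); apply: weight_ge; exists y.
  have k1 : 1 < kappa.
    have -> : 1 = 1 `^ s :> R by rewrite powR1.
    rewrite gt0_ltr_powR // ?nnegrE // ltr1n.
    by apply: leq_trans K_large; lia.
  have cv : (fun t => kappa^-1 ^+ t) @ \oo --> (0 : R).
    by apply: cvg_expr; rewrite ger0_norm ?invr_ge0 ?(ltW kappa_gt0) // invf_lt1.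
  have [N _ /(_ N.+1)] := cvgr0_norm_lt _ cv (w n) (w_gt0 n).
  move=> /(_ (leqnSn _)); rewrite /= ger0_norm ?exprn_ge0 ?invr_ge0 ?(ltW kappa_gt0) //.
  by rewrite exprVn => /lt_trans /(_ (wn N)); rewrite ltxx.
Qed.

End Game.

(** * Rational points of small height near a cube *)

Section Simplex.
Variable R : realType.

Lemma det_int n (M : 'M[R]_n) : (forall i j, M i j \is a Num.int) -> \det M \is a Num.int.
Proof.
move=> h; rewrite /determinant rpred_sum // => s _.
by rewrite rpredM ?rpredX ?rpredN ?rpred1 // rpred_prod.
Qed.

Lemma det_le_fact n (M : 'M[R]_n) : (forall i j, `|M i j| <= 1) -> `|\det M| <= (n`!)%:R.
Proof.
move=> h; rewrite /determinant (le_trans (ler_norm_sum _ _ _)) //.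
apply: le_trans (_ : \sum_(s : 'S_n) (1 : R) <= _); last first.
  by rewrite sumr_const -(card_Sn n).
apply: ler_sum => s _; rewrite normrM normrX normrN1 expr1n mul1r normr_prod.
apply: le_trans (_ : \prod_(i < n) (1 : R) <= 1); last by rewrite big1.
by apply: ler_prod => i _; rewrite normr_ge0 h.
Qed.

Definition intcol m (b : 'cV[int]_m) : 'cV[R]_m := map_mx intr b.

Lemma intcol_norm_ge1 m (b : 'cV[int]_m) : b != 0 -> 1 <= \sum_v `|intcol b v 0|.
Proof.
move=> /cV0Pn [v bv]; rewrite (bigD1 v) //= ler_wpDr ?sumr_ge0 //.
by rewrite int_norm_ge1 // mxE ?intr_int // intr_eq0.
Qed.

Lemma mulmx_cube_close K d m (b : 'cV[int]_m) t (x y : 'M[R]_(d, m)) u : cube K x t y ->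
  `|(y *m intcol b) u 0 - (x *m intcol b) u 0| <= mesh R K t * \sum_v `|intcol b v 0|.
Proof.
move=> hy; rewrite !mxE -sumrB mulr_sumr (le_trans (ler_norm_sum _ _ _)) //.
apply: ler_sum => v _; rewrite -mulrBl normrM ler_wpM2r //.
by have /andP[h1 h2] := hy u v; rewrite ler_norml; apply/andP; split; lra.
Qed.

(* Otherwise [d.+1] independent integral rows [(q, r)] have a nonzero integral determinant which,
   after subtracting the centre of the cube, is smaller than 1. *)
Lemma simplex K d m (b : 'cV[int]_m) : (1 < K)%N -> (0 < d)%N -> b != 0 ->
  exists2 Lam : R, 0 < Lam & forall t (x : 'M[R]_(d, m)), exists a c, a != 0 /\
   forall y, cube K x t y -> mesh R K t.+1 * l1 a <= `|dotm a y - c| ->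
   forall (q : nat) (r : 'cV[R]_d), (0 < q)%N -> (forall i, r i 0 \is a Num.int) ->
     q%:R ^+ d.+1 < Lam * K%:R ^+ (t * d) ->
     exists i, mesh R K t.+2 <= `|(y *m intcol b) i 0 - r i 0 / q%:R|.
Proof.
move=> K1 d0 b0; have K0 : (0 < K)%N by apply: ltn_trans K1.
have K0R : 0 < K%:R :> R by rewrite ltr0n.
pose S : R := \sum_v `|intcol b v 0|.
have S1 : 1 <= S by exact: intcol_norm_ge1.
(* A rational point in play is within [mesh R K t] of the image of some [y] of the cube, and that
   image is within [S] times [mesh R K t] of the image of the corner [x]. *)
pose B := 1 + S; have B0 : 0 < B by rewrite /B; lra.
have F0 : 0 < (d.+1)`!%:R :> R by rewrite ltr0n fact_gt0.
(* Chosen so that the bound on the determinant comes out as exactly 1/2. *)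
pose Lam : R := (2 * B ^+ d * (d.+1)`!%:R)^-1.
have Lam0 : 0 < Lam by rewrite invr_gt0 !mulr_gt0 // exprn_gt0.
exists Lam => // t x.
pose V (v : 'rV[R]_(1 + d)) := exists (qr : nat * 'cV[R]_d),
  [/\ (0 < qr.1)%N, forall i, qr.2 i 0 \is a Num.int,
      qr.1%:R ^+ d.+1 < Lam * K%:R ^+ (t * d),
      exists2 y, cube K x t y & forall i, `|(y *m intcol b) i 0 - qr.2 i 0 / qr.1%:R| <= mesh R K t &
      v = row_mx (qr.1%:R%:M) (qr.2^T)].
have mt n : mesh R K n.+1 < mesh R K n.
  by rewrite (meshS R K0 n) ltr_pMl ?mesh_gt0 // ltr1n.
have [[M [VM Mu]]|[f f0 Vf]] := span_dichotomy V.
  exfalso.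
  have [qr hqr] := boolp.choice VM.
  pose eta := B * mesh R K t.
  have eta0 : 0 < eta by rewrite mulr_gt0 // mesh_gt0.
  pose cen : 'rV[R]_d := (x *m intcol b)^T.
  have cenE i : cen 0 i = (x *m intcol b) i 0 by rewrite mxE.
  clearbody cen.
  pose E : 'M[R]_(1 + d, d) := \matrix_(l, i) (((qr l).2 i 0 / (qr l).1%:R - cen 0 i) / eta).
  pose N : 'M[R]_(1 + d) := row_mx (const_mx 1) E.
  pose T : 'M[R]_(1 + d) := block_mx 1%:M cen 0 eta%:M.
  pose D : 'M[R]_(1 + d) := diag_mx (\row_l (qr l).1%:R).
  have q0 l : (qr l).1%:R != 0 :> R by have [h _ _ _ _] := hqr l; rewrite pnatr_eq0 -lt0n.
  have ME : M = D *m (N *m T).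
    apply/row_matrixP => l; have [_ _ _ _ ->] := hqr l.
    rewrite row_mul row_diag_mx mxE -scalemxAl -rowE.
    rewrite /N /T mul_row_block mulmx0 addr0 mulmx1 row_row_mx scale_row_mx.
    congr row_mx.
      by apply/rowP => i; rewrite !mxE mulr1 ord1.
    apply/rowP => i; rewrite mul_mx_scalar !mxE big_ord1 !mxE mul1r [eta * _]mulrC.
    rewrite divfK ?gt_eqF //; field.
    by rewrite q0.
  have Nle i j : `|N i j| <= 1.
    rewrite mxE; case: (fintype.split j) => k; first by rewrite mxE normr1.
    rewrite mxE normrM normfV (gtr0_norm eta0) ler_pdivrMr // mul1r.
    have [_ _ _ [y hy /(_ k) le] _] := hqr i.
    rewrite cenE (_ : _ - _ = - ((y *m intcol b) k 0 - (qr i).2 k 0 / (qr i).1%:R) +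
       ((y *m intcol b) k 0 - (x *m intcol b) k 0)); last by ring.
    rewrite (le_trans (ler_normD _ _)) // normrN /eta /B mulrDl mul1r.
    by rewrite lerD // mulrC mulmx_cube_close.
  have detE : \det M = \prod_l (qr l).1%:R * \det N * eta ^+ d.
    rewrite ME !det_mulmx det_diag det_ublock det1 mul1r det_scalar mulrA.
    by congr (_ * _ * _); apply: eq_bigr => l _; rewrite mxE.
  have d1 : 1 <= `|\det M|.
    apply: int_norm_ge1; last by rewrite -unitfE -unitmxE.
    apply: det_int => i j; have [q1 ri _ _ e] := hqr i.
    have -> : M i j = row i M 0 j by rewrite mxE.
    by rewrite e mxE; case: (fintype.split j) => k; rewrite !mxE ?ord1 ?mulr1n ?natr_int.
  pose X := Lam * K%:R ^+ (t * d).
  have X0 : 0 < X by rewrite mulr_gt0 // exprn_gt0.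
  have qX : \prod_l (qr l).1%:R <= X.
    rewrite -(@ler_pXn2r _ d.+1) ?nnegrE ?prodr_ge0 ?(ltW X0) //.
    rewrite -prodrXl.
    have -> : X ^+ d.+1 = \prod_(l < 1 + d) X by rewrite prodr_const card_ord.
    apply: ler_prod => l _; rewrite exprn_ge0 //=.
    by have [_ _ /ltW h _ _] := hqr l.
  have dN : `|\det N| <= (d.+1)`!%:R := det_le_fact Nle.
  have : `|\det M| <= X * (d.+1)`!%:R * eta ^+ d.
    rewrite detE !normrM (ger0_norm (prodr_ge0 _ _)); last by move=> l _.
    rewrite (ger0_norm (exprn_ge0 _ (ltW eta0))) ler_wpM2r ?exprn_ge0 ?(ltW eta0) //.
    by apply: ler_pM => //; apply: prodr_ge0.
  suff -> : X * (d.+1)`!%:R * eta ^+ d = 2^-1 by lra.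
  rewrite /X /eta /Lam /mesh exprMn exprVn -exprM; field.
  by rewrite !gt_eqF ?exprn_gt0.
pose g := dsubmx f.
have memV y (q : nat) (r : 'cV[R]_d) : cube K x t y -> (0 < q)%N ->
    (forall i, r i 0 \is a Num.int) -> q%:R ^+ d.+1 < Lam * K%:R ^+ (t * d) ->
    ~ (exists i, mesh R K t.+2 <= `|(y *m intcol b) i 0 - r i 0 / q%:R|) ->
    f 0 0 = - \sum_u (r u 0 / q%:R) * g u 0.
  move=> hy hq hr lt H.
  have : row_mx (q%:R%:M) (r^T) *m f = 0.
    apply: Vf; exists (q, r); split=> //; exists y => //= i.
    rewrite leNgt; apply/negP => h; apply: H; exists i; rewrite ltW //.
    by apply: lt_trans h; exact: lt_trans (mt _) (mt _).
  rewrite -[f in _ *m f]vsubmxK mul_row_col mul_scalar_mx => /matrixP /(_ 0 0).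
  have q0 : q%:R != 0 :> R by rewrite pnatr_eq0 -lt0n.
  rewrite !mxE (_ : lshift d 0 = 0); last exact: val_inj.
  move/eqP; rewrite addr_eq0 => /eqP e.
  apply: (mulfI q0); rewrite e mulrN mulr_sumr; congr (- _); apply: eq_bigr => u _.
  by rewrite [(r^T) 0 u]mxE /g; field.
have [v bv] : exists v, intcol b v 0 != 0.
  by have /cV0Pn [v bv] := b0; exists v; rewrite mxE intr_eq0.
(* If [g = 0], a single rational point in play would force [f = 0]: there is nothing to avoid and
   any nonzero [a] serves. *)
case: (eqVneq g 0) => [g0|g0].
  exists (const_mx 1), 0; split.
    by apply/eqP => /matrixP /(_ (Ordinal d0) v) /eqP; rewrite !mxE oner_eq0.
  move=> y hy _ q r hq hr lt; apply: contrapT => H.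
  have := memV y q r hy hq hr lt H; rewrite g0 big1 ?oppr0 => [f00|u _]; last by rewrite mxE mulr0.
  case/eqP: f0; rewrite -[f]vsubmxK -/g g0; apply/colP => i; rewrite !mxE.
  case: splitP => j _; rewrite !mxE // (_ : lshift d j = 0) //.
  by apply: val_inj; rewrite /= ord1.
(* The hyperplane of $\mathbb{R}^d$ through all points in play, pulled back along [y *m intcol R b].
   The norm of [a] gains the factor [S], which is at least 1, and the drop from [mesh R K t.+1] to
   [mesh R K t.+2] makes the comparison strict. *)
exists (g *m (intcol b)^T), (- f 0 0).
have aE u w : (g *m (intcol b)^T) u w = g u 0 * intcol b w 0 by rewrite mxE big_ord1 [X in _ * X]mxE.
have [u gu] := cV0Pn _ g0.
split.
  by apply/eqP => /matrixP /(_ u v) /eqP; rewrite aE [X in _ == X]mxE mulf_eq0 (negbTE gu) (negbTE bv).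
have l1E : l1 (g *m (intcol b)^T) = (\sum_u `|g u 0|) * S.
  rewrite /l1 mulr_suml; apply: eq_bigr => w _; rewrite mulr_sumr; apply: eq_bigr => w' _.
  by rewrite aE normrM.
have dotE y : dotm (g *m (intcol b)^T) y = \sum_u g u 0 * (y *m intcol b) u 0.
  apply: eq_bigr => w _; rewrite [X in _ * X]mxE mulr_sumr; apply: eq_bigr => w' _.
  by rewrite aE; ring.
have G0 : 0 < \sum_u `|g u 0|.
  by rewrite (bigD1 u) //= ltr_wpDr ?sumr_ge0 // normr_gt0.
move=> y hy le q r hq hr lt; apply: contrapT => H.
have f00 := memV y q r hy hq hr lt H.
move: le; rewrite l1E dotE opprK f00 -sumrB leNgt => /negP; apply.
apply: le_lt_trans (_ : (\sum_u `|g u 0|) * mesh R K t.+2 < _).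
  rewrite (le_trans (ler_norm_sum _ _ _)) // mulr_suml; apply: ler_sum => w _.
  rewrite [X in _ - X]mulrC -mulrBr normrM ler_wpM2l // leNgt; apply/negP => h.
  by apply: H; exists w; rewrite ltW.
rewrite mulrC [X in _ < X]mulrA [X in _ < X * _]mulrC -mulrA.
have : mesh R K t.+2 * \sum_u `|g u 0| < mesh R K t.+1 * \sum_u `|g u 0|.
  by rewrite ltr_pM2r.
move=> /lt_le_trans; rewrite [X in _ -> _ < X]mulrCA; apply.
by rewrite ler_wpM2l ?(ltW (mesh_gt0 R K0 _)) // ler_peMr // ltW.
Qed.

End Simplex.

(** * Hausdorff dimension *)

Section BadMatrices.
Variables (R : realType) (d m : nat).
Hypotheses (d_gt0 : (0 < d)%N) (m_gt0 : (0 < m)%N).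

Definition bad_matrices : set 'M[R]_(d, m) :=
  [set A : 'M[R]_(d, m) | (forall u v, 0 <= A u v <= 1) /\
     forall b : 'cV[int]_m, b != 0 -> badform (A *m intcol R b)].

(* Schedules countably many tasks: task [i] is handled at the stages [t] with [logn 2 t.+1 = i]. *)
Lemma next_stage i T : exists t, (T <= t < T + 2 ^ i.+1)%N /\ logn 2 t.+1 = i.
Proof.
have P0 : (0 < 2 ^ i)%N by rewrite expn_gt0.
pose l := ((T + 2 ^ i) %/ (2 ^ i.+1))%N.
have E : ((T + 2 ^ i) = l * 2 ^ i.+1 + (T + 2 ^ i) %% (2 ^ i.+1))%N by exact: divn_eq.
have M : ((T + 2 ^ i) %% (2 ^ i.+1) < 2 ^ i.+1)%N by rewrite ltn_pmod // expn_gt0.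
pose t := (2 ^ i * (2 * l).+1).-1; have tE : t.+1 = (2 ^ i * (2 * l).+1)%N.
  by rewrite prednK // muln_gt0 P0.
exists t; split; last first.
  rewrite tE lognM // pfactorK // logn_coprime ?addn0 //.
  by rewrite coprime2n /= mul2n odd_double.
move: E M tE; move: ((T + 2 ^ i) %% 2 ^ i.+1)%N => r; rewrite !expnS; clearbody l t.
by move: (2 ^ i)%N P0 => p P0 E M tE; nia.
Qed.

(** For the first [T] admitting the denominator [q], [q ^ d.+1] is comparable to [K ^ (T * d)]. Task
    [i] comes up within the next [2 ^ i.+1] stages, and this delay costs only a constant factor. *)
Lemma badsim_of_stages K (A : 'M[R]_(d, m)) (b : 'cV[int]_m) (i : nat) (Lam : R) : (1 < K)%N -> 0 < Lam ->
  (forall t, logn 2 t.+1 = i -> forall (q : nat) (r : 'cV[R]_d), (0 < q)%N ->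
     (forall u, r u 0 \is a Num.int) -> q%:R ^+ d.+1 < Lam * K%:R ^+ (t * d) ->
     exists u, mesh R K t.+2 <= `|(A *m intcol R b) u 0 - r u 0 / q%:R|) ->
  badsim (A *m intcol R b).
Proof.
move=> K1 L0 H; pose P := (2 ^ i.+1)%N.
have K0 : 0 < K%:R :> R by rewrite ltr0n ltnW.
have K1R : 1 <= K%:R :> R by rewrite ler1n ltnW.
pose c := Num.min 1 Lam * K%:R ^- ((P + 2) * d).
have c0 : 0 < c by rewrite mulr_gt0 ?invr_gt0 ?exprn_gt0 // lt_min ltr01.
exists c; split => // q r q0 rint.
have q0R : 0 < q%:R :> R by rewrite ltr0n.
have exT : exists T, q%:R ^+ d.+1 < Lam * K%:R ^+ (T * d).
  exists (`|Num.floor (q%:R ^+ d.+1 / Lam)|).+1%N.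
  rewrite mulrC -ltr_pdivrMr //.
  set z := _ / Lam; have z0 : 0 <= z by rewrite divr_ge0 ?exprn_ge0 // ltW.
  have h : z < (`|Num.floor z|%N).+1%:R.
    rewrite -natr1 -[X in X + _](_ : (Num.floor z)%:~R = _); last first.
      by rewrite -[in LHS](gez0_abs (_ : 0 <= Num.floor z)) // floor_ge0.
    by have := floor_itv z; rewrite intrD => /andP[].
  apply: (lt_le_trans h); rewrite -natrX ler_nat.
  apply: leq_trans (_ : K ^ (`|Num.floor z|).+1 <= _)%N; first exact/ltnW/ltn_expl.
  by rewrite leq_exp2l // leq_pmulr.
case: (ex_minnP exT) => T hT Tmin.
have [t [/andP[Tt tT] tl]] := next_stage i T.
have [|u hu] := H t tl q r q0 rint.
  apply: lt_le_trans hT _; rewrite ler_wpM2l ?(ltW L0) // ler_weXn2l //.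
  by rewrite leq_mul2r Tt orbT.
exists u.
have -> : q%:R * `|q%:R * (A *m intcol R b) u 0 - r u 0| ^+ d =
   q%:R ^+ d.+1 * `|(A *m intcol R b) u 0 - r u 0 / q%:R| ^+ d.
  rewrite (_ : q%:R * (A *m intcol R b) u 0 - r u 0 = q%:R * ((A *m intcol R b) u 0 - r u 0 / q%:R)); last first.
    by field; rewrite gt_eqF.
  by rewrite normrM normr_nat exprMn mulrA -exprS.
have mK : K%:R ^- ((T + P).+1 * d) <= `|(A *m intcol R b) u 0 - r u 0 / q%:R| ^+ d.
  apply: le_trans (_ : mesh R K t.+2 ^+ d <= _); last first.
    by apply: lerXn2r; rewrite ?nnegrE ?normr_ge0 // ltW // mesh_gt0 // ltnW.
  rewrite /mesh exprVn -exprM lef_pV2 ?posrE ?exprn_gt0 // ler_weXn2l //.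
  by rewrite leq_mul2r; apply/orP; right; rewrite /P; lia.
apply: le_trans (_ : q%:R ^+ d.+1 * K%:R ^- ((T + P).+1 * d) <= _); last first.
  by rewrite ler_wpM2l // exprn_ge0 // ltW.
(* Minimality of [T] bounds [q] from below only for positive [T]; for [T = 0] the bound [q >= 1] is
   used, whence the 1 in the minimum defining [c]. *)
case: T hT Tmin Tt tT mK => [|T'] hT Tmin Tt tT mK.
  apply: ler_pM; rewrite ?invr_ge0 ?exprn_ge0 ?(ltW K0) ?le_min ?ler01 ?(ltW L0) //.
    by rewrite ge_min exprn_ege1 // ler1n.
  rewrite lef_pV2 ?posrE ?exprn_gt0 // ler_weXn2l // leq_mul2r; apply/orP; right; lia.
have hT' : Lam * K%:R ^+ (T' * d) <= q%:R ^+ d.+1.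
  by rewrite leNgt; apply/negP => /Tmin; rewrite ltnn.
apply: le_trans (_ : Lam * K%:R ^+ (T' * d) * K%:R ^- ((T'.+1 + P).+1 * d) <= _); last first.
  by rewrite ler_wpM2r // invr_ge0 exprn_ge0 // ltW.
rewrite (_ : ((T'.+1 + P).+1 * d = T' * d + (P + 2) * d)%N); last by lia.
rewrite exprD invfM mulrA -(mulrA Lam) divff ?mulr1 ?expf_neq0 ?gt_eqF //.
by rewrite ler_wpM2r ?invr_ge0 ?exprn_ge0 ?(ltW K0) // ge_min lexx orbT.
Qed.

Lemma strategy K : (1 < K)%N -> exists (a : nat -> 'M[R]_(d, m) -> 'M[R]_(d, m)) c,
  (forall t x, a t x != 0) /\
  forall (x : nat -> 'M[R]_(d, m)) y, x 0%N = 0 -> (forall t, cube K (x t) t y) ->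
    (forall t y', cube K (x t.+1) t.+1 y' ->
         mesh R K t.+1 * l1 (a t (x t)) <= `|dotm (a t (x t)) y' - c t (x t)|) ->
    bad_matrices y.
Proof.
move=> K1.
have simp (b : 'cV[int]_m) : exists Lam : R, 0 < Lam /\ (b != 0 -> forall t (x : 'M[R]_(d, m)), exists ac,
   ac.1 != 0 /\ forall y, cube K x t y -> mesh R K t.+1 * l1 ac.1 <= `|dotm ac.1 y - ac.2| ->
   forall (q : nat) (r : 'cV[R]_d), (0 < q)%N -> (forall i, r i 0 \is a Num.int) ->
     q%:R ^+ d.+1 < Lam * K%:R ^+ (t * d) ->
     exists i, mesh R K t.+2 <= `|(y *m intcol R b) i 0 - r i 0 / q%:R|).
  case: (eqVneq b 0) => [->|b0]; first by exists 1.
  have [Lam L0 h] := @simplex R K d m b K1 d_gt0 b0; exists Lam; split => // _ t x.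
  by have [a [c [h1 h2]]] := h t x; exists (a, c).
have [Lam hLam] := boolp.choice simp.
(* The vector served at stage [t] is decoded from [logn 2 t.+1], so each one recurs with bounded
   gaps; a stage that decodes to nothing or to 0 plays the arbitrary [const_mx 1]. *)
have st (tx : nat * 'M[R]_(d, m)) : exists ac : 'M[R]_(d, m) * R, ac.1 != 0 /\
   forall b, choice.unpickle (logn 2 tx.1.+1) = Some b -> b != 0 ->
   forall y, cube K tx.2 tx.1 y -> mesh R K tx.1.+1 * l1 ac.1 <= `|dotm ac.1 y - ac.2| ->
   forall (q : nat) (r : 'cV[R]_d), (0 < q)%N -> (forall i, r i 0 \is a Num.int) ->
     q%:R ^+ d.+1 < Lam b * K%:R ^+ (tx.1 * d) ->
     exists i, mesh R K tx.1.+2 <= `|(y *m intcol R b) i 0 - r i 0 / q%:R|.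
  case: tx => t x /=.
  have c1 : const_mx 1 != 0 :> 'M[R]_(d, m).
    by apply/eqP => /matrixP /(_ (Ordinal d_gt0) (Ordinal m_gt0)) /eqP; rewrite !mxE oner_eq0.
  case E: (choice.unpickle _) => [b|]; last by exists (const_mx 1, 0).
  case: (eqVneq b 0) => [b0|b0].
    by exists (const_mx 1, 0); split => // b' [<-]; rewrite b0 eqxx.
  have [_ /(_ b0 t x) [ac [h1 h2]]] := hLam b.
  by exists ac; split => // b' [<-] _.
have [ac hac] := boolp.choice st.
exists (fun t x => (ac (t, x)).1), (fun t x => (ac (t, x)).2); split.
  by move=> t x; have [] := hac (t, x).
move=> x y x0 hy hgame; split.
  move=> u v; have := hy 0%N u v; rewrite x0 !mxE /mesh expr0 invr1 add0r.
  by [].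
move=> b b0.
have bs : badsim (y *m intcol R b).
  apply: (@badsim_of_stages K y b (choice.pickle b) (Lam b)) => //; first by case: (hLam b).
  move=> t tl; have [_ h] := hac (t, x t).
  by apply: h => //=; [rewrite tl choice.pickleK | exact: hgame].
move: bs; case: d d_gt0 y {hy hgame} => // d' _ y; exact: transference.
Qed.

End BadMatrices.

Section HausdorffDimension.
Variable R : realType.

Lemma mdist_entry p q (X Y : 'M[R]_(p, q)) u v : `|X u v - Y u v| <= Defs.mdist X Y.
Proof.
rewrite /Defs.mdist; apply: le_trans (le_bigmax _ _ u).
exact: (le_bigmax _ (fun j => `|X u j - Y u j|) v).
Qed.

Lemma mdist_le p q (X Y : 'M[R]_(p, q)) e : 0 <= e ->
  (forall u v, `|X u v - Y u v| <= e) -> Defs.mdist X Y <= e.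
Proof. by move=> e0 h; apply: bigmax_le => // u _; apply: bigmax_le. Qed.

Lemma mdist_ge0 p q (X Y : 'M[R]_(p, q)) : 0 <= Defs.mdist X Y.
Proof. exact: bigmax_ge_id. Qed.

Lemma le_diam p q (U : set 'M[R]_(p, q)) delta x y : diam_le U delta ->
  U x -> U y -> Defs.mdist x y <= diam U.
Proof.
move=> h Ux Uy; apply: ub_le_sup; last by exists x => //; exists y.
by exists delta => _ [a Ua [b Ub <-]]; apply: h.
Qed.

Lemma diam_leP p q (U : set 'M[R]_(p, q)) delta : diam_le U delta -> U !=set0 ->
  0 <= diam U <= delta.
Proof.
move=> h [x Ux]; apply/andP; split.
  exact: le_trans (mdist_ge0 x x) (le_diam h Ux Ux).
apply: ge_sup; first by exists (Defs.mdist x x), x => //; exists x.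
by move=> _ [a Ua [b Ub <-]]; apply: h.
Qed.

Lemma cover_cost_ge0 p q s (U : set 'M[R]_(p, q)) : 0 <= cover_cost s U.
Proof. by rewrite /cover_cost; case: ifP => // _; rewrite powR_ge0. Qed.

Lemma hausdorff_delta_ge0 p q s delta (A : set 'M[R]_(p, q)) : (0 <= hausdorff_delta s delta A)%E.
Proof.
apply/ereal_infP => _ [U _ <-]; apply: nneseries_ge0 => n _ _.
by rewrite lee_fin cover_cost_ge0.
Qed.

Lemma powR_le_exp (x s s' : R) : 0 <= x <= 1 -> 0 < s' -> s <= s' -> x `^ s' <= x `^ s.
Proof.
move=> /andP[]; rewrite le_eqVlt => /predU1P [<- _ s0 _|x0 x1 _ ss].
  by rewrite powR0 ?gt_eqF // powR_ge0.
have -> : s' = s + (s' - s) by rewrite addrC subrK.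
rewrite powRD; last by rewrite (gt_eqF x0) implybT.
rewrite ler_piMr ?powR_ge0 //.
rewrite -[leRHS](_ : 1 `^ (s' - s) = 1); last by rewrite powR1.
by apply: ge0_ler_powR; rewrite ?nnegrE ?subr_ge0 // ltW.
Qed.

Lemma powR_unbounded (e C : R) (N : nat) : 0 < e -> 0 <= C ->
  exists K : nat, (N <= K)%N /\ C <= K%:R `^ e.
Proof.
move=> e0 C0; pose z := C `^ e^-1; have z0 : 0 <= z by exact: powR_ge0.
have h : z <= (`|Num.floor z|%N).+1%:R.
  rewrite -natr1 -[X in X + _](_ : (Num.floor z)%:~R = _); last first.
    by rewrite -[in LHS](gez0_abs (_ : 0 <= Num.floor z)) // floor_ge0.
  by have := floor_itv z; rewrite intrD => /andP[_ /ltW].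
exists (N + `|Num.floor z|.+1)%N; split; first exact: leq_addr.
have -> : C = z `^ e by rewrite /z -powRrM mulVf ?gt_eqF // powRr1.
apply: ge0_ler_powR; rewrite ?nnegrE ?(ltW e0) //.
by apply: (le_trans h); rewrite ler_nat leq_addl.
Qed.

Variables (d m : nat).
Hypotheses (d_gt0 : (0 < d)%N) (m_gt0 : (0 < m)%N).

Lemma bad_matrices_measure_pos (s : R) : 0 <= s -> s < (d * m)%:R ->
  hausdorff_measure s (@bad_matrices R d m) <> 0%E.
Proof.
move=> s0 sp H.
(* The game needs a positive exponent below [d * m], and [s] may be 0. Raising the exponent is
   harmless, since sets of diameter at most 1 only become cheaper. *)
pose s' := (s + (d * m)%:R) / 2.
have s'0 : 0 < s' by rewrite /s'; lra.
have ss' : s <= s' by rewrite /s'; lra.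
have s'p : 0 < (d * m)%:R - s' by rewrite /s'; lra.
have [K [KL KP]] := @powR_unbounded _ (2 * (2 ^ (d * m))%:R) (2 * (4 * (d * m)).+1) s'p (mulr_ge0 (ler0n _ 2) (ler0n _ _)).
have K1 : (1 < K)%N by apply: leq_trans KL; lia.
have K0 : 0 < K%:R :> R by rewrite ltr0n ltnW.
pose kappa := K%:R `^ s'; have kappa0 : 0 < kappa by exact: powR_gt0.
have KLP : 2 * (2 ^ (d * m))%:R * K%:R `^ s' <= (K ^ (d * m))%:R.
  have -> : (K ^ (d * m))%:R = K%:R `^ ((d * m)%:R - s') * K%:R `^ s' :> R.
    rewrite -powRD ?subrK; last by rewrite (gt_eqF K0) implybT.
    by rewrite powR_mulrn // natrX.
  by rewrite ler_wpM2r // powR_ge0.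
have : (hausdorff_delta s 1 (@bad_matrices R d m) < (kappa^-1 / 2)%:E)%E.
  apply: (@le_lt_trans _ _ 0%E); last by rewrite lte_fin divr_gt0 ?invr_gt0.
  by rewrite -H; apply: le_ereal_sup_tmp; exists (hausdorff_delta s 1 (@bad_matrices R d m)) => //; exists 1 => //; exact: ltr01.
case/ereal_inf_lt => _ [U [cov dl] <-] lt.
(* A cover may contain sets of cost 0, whereas the game needs positive weights; the added terms sum
   to [kappa^-1 / 2]. *)
pose w n := cover_cost s (U n) + kappa^-1 / 2 / (2 ^ n.+1)%:R.
have e0 : 0 < kappa^-1 / 2 by rewrite divr_gt0 ?invr_gt0.
have [a [c [a0 win]]] := strategy R d_gt0 m_gt0 K1.
have [|n y y' Uy Uy' u v||x [y [x0 hy hg nU]]] :=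
   @hyperplane_game R d m K s' s'0 KL KLP U w _ _ a c a0 _.
- by move=> n; rewrite /w ltr_wpDl ?cover_cost_ge0 // divr_gt0 // ltr0n expn_gt0.
- have /andP[D0 D1] := diam_leP (dl n) (ex_intro _ y Uy).
  apply: le_trans (_ : cover_cost s (U n) <= _); last first.
    by rewrite lerDl divr_ge0 // ltW.
  rewrite /cover_cost asboolF; last by move=> e; rewrite e in Uy.
  apply: le_trans (_ : diam (U n) `^ s' <= _); last by apply: powR_le_exp; rewrite ?D0.
  apply: ge0_ler_powR; rewrite ?nnegrE ?(ltW s'0) //.
  exact: le_trans (mdist_entry _ _ _ _) (le_diam (dl n) Uy Uy').
- apply: le_lt_trans (epsilon_trick (A := fun n => (cover_cost s (U n))%:E) xpredT _ (ltW e0)) _.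
    by move=> n; rewrite lee_fin cover_cost_ge0.
  rewrite [X in (_ < X%:E)%E](splitr kappa^-1) EFinD lte_leD //.
by have [n _ Un] := cov y (win x y x0 hy hg); exact: (nU n Un).
Qed.

Lemma unit_grid K (x : R) : (0 < K)%N -> 0 <= x <= 1 ->
  exists k : 'I_K, mesh R K 1 * (k : nat)%:R <= x <= mesh R K 1 * (k : nat)%:R + mesh R K 1.
Proof.
move=> K0 /andP[x0 x1]; have K0R : 0 < K%:R :> R by rewrite ltr0n.
have mE : mesh R K 1 = K%:R^-1 by rewrite /mesh expr1.
case: (ltP x 1) => [xlt|xge]; last first.
  have xE : x = 1 by apply/eqP; rewrite eq_le x1.
  have lt : (K.-1 < K)%N by rewrite prednK.
  exists (Ordinal lt) => /=; rewrite mE xE -[X in _ && (_ <= _ + X)]mulr1 -mulrDr natr1 prednK //.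
  by rewrite mulVf ?gt_eqF // lexx andbT mulrC ler_pdivrMr // mul1r ler_nat leq_pred.
pose z := K%:R * x; have z0 : 0 <= z by rewrite mulr_ge0.
have f0 : 0 <= Num.floor z by rewrite floor_ge0.
have E : (`|Num.floor z|%N)%:R = (Num.floor z)%:~R :> R by rewrite -[in RHS](gez0_abs f0).
have /andP[h1 h2] := floor_itv z; rewrite intrD -E in h1 h2.
have lt : (`|Num.floor z| < K)%N.
  by rewrite -(ltr_nat R); apply: le_lt_trans h1 _; rewrite /z gtr_pMr.
exists (Ordinal lt) => /=; rewrite mE.
have -> : x = K%:R^-1 * z by rewrite /z mulKf // gt_eqF.
rewrite -[X in _ && (_ <= _ + X)]mulr1 -mulrDr !ler_pM2l ?invr_gt0 // h1 ltW //.
Qed.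

(** The unit cube is covered by [K ^ (d * m)] grid cubes of side [K^-1], at total cost $K^{dm-s}$,
    which is small for large [K]. *)
Lemma bad_matrices_measure0 (s : R) : (d * m)%:R < s ->
  hausdorff_measure s (@bad_matrices R d m) = 0%E.
Proof.
move=> sp.
suff H delta : 0 < delta -> hausdorff_delta s delta (@bad_matrices R d m) = 0%E.
  apply/eqP; rewrite eq_le; apply/andP; split.
    by apply: ge_ereal_sup => _ [delta delta0 <-]; rewrite H.
  by apply: le_ereal_sup_tmp; exists 0%E => //; exists 1; [exact: ltr01 | rewrite H].
move=> delta0; apply/eqP; rewrite eq_le hausdorff_delta_ge0 andbT.
apply/lee_addgt0Pr => e e0; rewrite add0e.
have s0 : 0 < s by apply: le_lt_trans sp.
have sp' : 0 < s - (d * m)%:R by lra.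
have ei0 : 0 <= e^-1 by rewrite invr_ge0 ltW.
have [K [KL KP]] := powR_unbounded (`|Num.floor delta^-1|%N).+1 sp' ei0.
have K0 : (0 < K)%N by apply: leq_trans KL.
have K0R : 0 < K%:R :> R by rewrite ltr0n.
have mE : mesh R K 1 = K%:R^-1 by rewrite /mesh expr1.
have m0 := mesh_gt0 R K0 1.
have md : mesh R K 1 <= delta.
  rewrite mE -[leRHS]invrK lef_pV2 ?posrE ?invr_gt0 //.
  apply: le_trans (_ : (`|Num.floor delta^-1|).+1%:R <= _); last by rewrite ler_nat.
  rewrite -natr1 -[X in X + _](_ : (Num.floor delta^-1)%:~R = _); last first.
    by rewrite -[in LHS](gez0_abs (_ : 0 <= Num.floor delta^-1)) // floor_ge0 invr_ge0 ltW.
  by have := floor_itv delta^-1; rewrite intrD => /andP[_ /ltW].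
pose l := enum {: 'M['I_K]_(d, m)}.
pose U n := if (n < size l)%N then cube K (child 0 (0 : 'M[R]_(d, m)) (nth (const_mx (Ordinal K0)) l n)) 1
            else set0.
have Udist n x y : U n x -> U n y -> Defs.mdist x y <= mesh R K 1.
  rewrite /U; case: ifP => // _ hx hy; apply: mdist_le => [|u v]; first exact: ltW.
  have /andP[x1 x2] := hx u v; have /andP[y1 y2] := hy u v.
  by rewrite ler_norml; apply/andP; split; lra.
apply: ge_ereal_inf; exists (\sum_(n <oo) (cover_cost s (U n))%:E)%E.
  exists U => //; split; last by move=> n x y Ux Uy; apply: le_trans md; apply: Udist Ux Uy.
  move=> A [hA _].
  have g uv : exists k : 'I_K, mesh R K 1 * (k : nat)%:R <= A uv.1 uv.2 <= mesh R K 1 * (k : nat)%:R + mesh R K 1.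
    exact: unit_grid.
  have [f hf] := boolp.choice g.
  pose i : 'M['I_K]_(d, m) := \matrix_(u, v) f (u, v).
  have il : i \in l by rewrite mem_enum.
  exists (index i l) => //; rewrite /U index_mem il => u v.
  rewrite nth_index // !mxE add0r; exact: (hf (u, v)).
have cost n : cover_cost s (U n) <= (if (n < size l)%N then mesh R K 1 `^ s else 0).
  rewrite /cover_cost; case: asboolP => [_|/eqP/set0P ne].
    by case: ifP => // _; rewrite powR_ge0.
  case: ifP => lt; last by move: ne => [x]; rewrite /U lt.
  have /andP[D0 D1] := diam_leP (Udist n) ne.
  by apply: ge0_ler_powR; rewrite ?nnegrE ?(ltW s0) // ltW.
apply: lime_le.
  by apply: is_cvg_nneseries => n _ _; rewrite lee_fin cover_cost_ge0.
apply: nearW => n; rewrite sumEFin lee_fin.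
apply: le_trans (_ : \sum_(0 <= i < n) (if (i < size l)%N then mesh R K 1 `^ s else 0) <= _).
  by apply: ler_sum.
apply: le_trans (_ : (size l)%:R * mesh R K 1 `^ s <= _).
  have x0 : 0 <= mesh R K 1 `^ s by exact: powR_ge0.
  have -> : \sum_(0 <= i < n) (if (i < size l)%N then mesh R K 1 `^ s else 0) = (minn n (size l))%:R * mesh R K 1 `^ s.
    elim: n => [|n IH]; first by rewrite big_geq // min0n mul0r.
    rewrite big_nat_recr //= IH; case: ltnP => h.
      by rewrite (minn_idPl h) -natr1 mulrDl mul1r.
    by rewrite addr0 (minn_idPr (leqW h)).
  by rewrite ler_wpM2r // ler_nat geq_minr.
have -> : (size l)%:R = K%:R `^ (d * m)%:R :> R.
  by rewrite /l -cardE card_mx card_ord powR_mulrn ?ler0n // natrX.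
have ms : mesh R K 1 `^ s * K%:R `^ s = 1.
  by rewrite -powRM ?(ltW m0) // mE mulVf ?powR1 // gt_eqF.
have Ks : K%:R `^ (d * m)%:R * K%:R `^ (s - (d * m)%:R) = K%:R `^ s.
  by rewrite -powRD ?(gt_eqF K0R) ?implybT // addrC subrK.
have Ks0 : 0 < K%:R `^ s by exact: powR_gt0.
have KP' : K%:R `^ (d * m)%:R <= e * K%:R `^ s.
  rewrite -Ks mulrCA ler_peMr ?powR_ge0 //.
  by have := ler_wpM2l (ltW e0) KP; rewrite mulfV ?gt_eqF.
apply: le_trans (ler_wpM2r (powR_ge0 _ _) KP') _.
by rewrite -mulrA [X in e * X]mulrC ms mulr1.
Qed.

Theorem hausdorff_dim_bad_matrices :
  hausdorff_dim (@bad_matrices R d m) = ((d * m)%:R)%:E.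
Proof.
apply/eqP; rewrite eq_le; apply/andP; split.
  apply/lee_addgt0Pr => e e0; apply: ereal_inf_lbound.
  exists ((d * m)%:R + e) => //; split; first by rewrite addr_ge0 // ltW.
  by apply: bad_matrices_measure0; rewrite ltrDl.
apply/ereal_infP => _ [s [s0 H] <-]; rewrite lee_fin leNgt; apply/negP => lt.
exact: bad_matrices_measure_pos H.
Qed.

End HausdorffDimension.

(** * Projections and the window *)

Section Projections.
Variables (R : realType) (d m : nat).
Implicit Types (A : 'M[R]_(d, m)) (t u v : 'rV[R]_(d + m)).

Lemma proj_along_eq n (U W : set 'rV[R]_n) (v u : 'rV[R]_n) : is_subspace U -> is_subspace W ->
  U `&` W = [set 0] -> U u -> W (v - u) -> proj_along U W v = u.
Proof.
move=> [U0 hU] [W0 hW] UW Uu Wu.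
rewrite /proj_along; case: xgetP => [x _ [Ux Wx]|/(_ u)]; last by case.
have subU a b : U a -> U b -> U (a - b).
  by move=> ha hb; rewrite addrC -scaleN1r; apply: hU.
have subW a b : W a -> W b -> W (a - b).
  by move=> ha hb; rewrite addrC -scaleN1r; apply: hW.
have : (U `&` W) (x - u).
  split; first exact: subU.
  by rewrite (_ : x - u = (v - u) - (v - x)); [exact: subW | rewrite opprB [RHS]addrC addrA subrK].
by rewrite UW => /= /eqP; rewrite subr_eq0 => /eqP.
Qed.

Lemma Egraph_subspace A : is_subspace (Egraph A).
Proof.
split; first by exists 0 => //; rewrite mul0mx row_mx0.
move=> a _ _ [x _ <-] [y _ <-]; exists (a *: x + y) => //.
by rewrite scale_row_mx add_row_mx mulmxDl scalemxAl.
Qed.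

Lemma Fspace_subspace : is_subspace (@Fspace R d m).
Proof.
split; first by exists 0 => //; rewrite row_mx0.
move=> a _ _ [x _ <-] [y _ <-]; exists (a *: x + y) => //.
by rewrite scale_row_mx add_row_mx scaler0 addr0.
Qed.

Lemma Egraph_Fspace A : Egraph A `&` @Fspace R d m = [set 0].
Proof.
apply/seteqP; split => [t [[x _ <-] [y _ /eq_row_mx [e _]]]|_ ->] /=.
  by rewrite -e mul0mx row_mx0.
by split; [case: (Egraph_subspace A) | case: Fspace_subspace].
Qed.

Definition star A t : 'rV[R]_m := rsubmx t - lsubmx t *m A.

Lemma starD A t u : star A (t + u) = star A t + star A u.
Proof. by rewrite /star !linearD /= mulmxDl opprD addrACA. Qed.
Lemma starN A t : star A (- t) = - star A t.
Proof. by rewrite /star !linearN /= mulNmx opprB addrC opprK. Qed.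

Lemma sub_graph_star A t : t - row_mx (lsubmx t) (lsubmx t *m A) = row_mx 0 (star A t).
Proof. by rewrite -{1}[t]hsubmxK opp_row_mx add_row_mx addrN. Qed.

Lemma pistarE A t : pistar A t = row_mx 0 (star A t).
Proof.
apply: proj_along_eq; [exact: Fspace_subspace | exact: Egraph_subspace | | by exists (star A t) |].
  by rewrite setIC Egraph_Fspace.
by exists (lsubmx t) => //; rewrite -sub_graph_star opprB addrC subrK.
Qed.

Lemma pi2E A t : pi2 A t = row_mx (lsubmx t) (lsubmx t *m A).
Proof.
apply: proj_along_eq; [exact: Egraph_subspace | exact: Fspace_subspace | exact: Egraph_Fspace | by exists (lsubmx t) |].
by exists (star A t) => //; rewrite sub_graph_star.
Qed.

Variables (A : 'M[R]_(d, m)) (F0 : set 'rV[R]_(d + m)).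
Hypothesis hF0 : admissible_F0 A F0.

Lemma pi1_spec v : Egraph A (pi1 A F0 v) /\ F0 (v - pi1 A F0 v).
Proof.
have [sF [[EF dec] _]] := hF0; have [e [f [He [Hf ->]]]] := dec v.
rewrite /pi1 (_ : proj_along _ _ _ = e); first by split=> //; rewrite addrC addKr.
by apply: proj_along_eq => //; [exact: Egraph_subspace | rewrite addrC addKr].
Qed.

Lemma pi1_uniq v e : Egraph A e -> F0 (v - e) -> pi1 A F0 v = e.
Proof.
have [sF [[EF _] _]] := hF0.
by move=> he hf; apply: proj_along_eq => //; exact: Egraph_subspace.
Qed.

Lemma pi1_linear a u v : pi1 A F0 (a *: u + v) = a *: pi1 A F0 u + pi1 A F0 v.
Proof.
have [[_ hF] _] := hF0; have [_ hE] := Egraph_subspace A.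
have [e1 f1] := pi1_spec u; have [e2 f2] := pi1_spec v.
apply: pi1_uniq; first exact: hE.
by rewrite opprD addrACA -scalerBr; apply: hF.
Qed.

Lemma pi1_0 : pi1 A F0 0 = 0.
Proof.
have [[F00 _] _] := hF0; have [E0 _] := Egraph_subspace A.
by apply: pi1_uniq => //; rewrite subrr.
Qed.

Lemma pi1D u v : pi1 A F0 (u + v) = pi1 A F0 u + pi1 A F0 v.
Proof. by have := pi1_linear 1 u v; rewrite !scale1r. Qed.
Lemma pi1N u : pi1 A F0 (- u) = - pi1 A F0 u.
Proof. by have := pi1_linear (-1) u 0; rewrite !scaleN1r pi1_0 !addr0. Qed.
Lemma pi1B u v : pi1 A F0 (u - v) = pi1 A F0 u - pi1 A F0 v.
Proof. by rewrite pi1D pi1N. Qed.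

Lemma pi1_E e : Egraph A e -> pi1 A F0 e = e.
Proof. by move=> he; apply: pi1_uniq => //; rewrite subrr; case: hF0 => [[]]. Qed.

Lemma pi1_inj z : Zpts z -> pi1 A F0 z = 0 -> z = 0.
Proof.
move=> hz e; have [_ [_ FZ]] := hF0; have [_] := pi1_spec z; rewrite e subr0 => fz.
by have : (F0 `&` @Zpts R (d + m)) z by []; rewrite FZ.
Qed.

Lemma pi1_mulmx : exists P : 'M[R]_(d + m), forall v, pi1 A F0 v = v *m P.
Proof.
exists (\matrix_i pi1 A F0 (delta_mx 0 i)) => v.
rewrite mulmx_sum_row {1}(row_sum_delta v).
elim/big_rec2: _ => [|i y1 y2 _ <-]; first exact: pi1_0.
by rewrite pi1_linear rowK.
Qed.

Lemma pi1_bound : exists2 C, 0 < C & forall v, supn (pi1 A F0 v) <= C * supn v.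
Proof.
have [P hP] := pi1_mulmx; have [C [C0 hC]] := supn_mulmx P.
by exists C => // v; rewrite hP.
Qed.

Lemma supn_row_mx n p (u : 'rV[R]_n) (v : 'rV[R]_p) : supn (row_mx u v) <= supn u + supn v.
Proof.
apply: supn_le => [|i]; first by rewrite addr_ge0 ?supn_ge0.
rewrite mxE; case: (fintype.split i) => j.
  by rewrite (le_trans (supn_ge _ _)) // lerDl supn_ge0.
by rewrite (le_trans (supn_ge _ _)) // lerDr supn_ge0.
Qed.

Lemma supn_lsubmx n p (t : 'rV[R]_(n + p)) : supn (lsubmx t) <= supn t.
Proof. by apply: supn_le => [|i]; rewrite ?supn_ge0 // mxE supn_ge. Qed.

(** As [pi1] fixes $E$, the difference is [pi1] of the $F$-component of [t]. It is bounded on the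
    strip, which makes the two types of patches comparable. *)
Lemma pi1_pi2 : exists2 C, 0 < C & forall t, supn (pi1 A F0 t - pi2 A t) <= C * supn (star A t).
Proof.
have [C C0 hC] := pi1_bound; exists C => // t.
have -> : pi1 A F0 t - pi2 A t = pi1 A F0 (row_mx 0 (star A t)).
  have Ep : Egraph A (pi2 A t) by rewrite pi2E; exists (lsubmx t).
  rewrite -{1}(pi1_E Ep) -pi1B pi2E; congr (pi1 A F0 _).
  exact: sub_graph_star.
rewrite (le_trans (hC _)) // ler_wpM2l ?(ltW C0) // (le_trans (supn_row_mx _ _)) //.
by rewrite supn0 add0r.
Qed.

Lemma pi2_bound : exists2 C, 0 < C & forall t, supn (pi2 A t) <= C * supn (lsubmx t).
Proof.
have [C [C0 hC]] := supn_mulmx A; exists (1 + C); first by rewrite addr_gt0.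
by move=> t; rewrite pi2E (le_trans (supn_row_mx _ _)) // mulrDl mul1r lerD2l.
Qed.

Lemma supn_lsub_pi2 t : supn (lsubmx t) <= supn (pi2 A t).
Proof. by rewrite pi2E -{1}(row_mxKl (lsubmx t) (lsubmx t *m A)) supn_lsubmx. Qed.

Lemma Zpts_row_mx n p (u : 'rV[R]_n) (v : 'rV[R]_p) : Zpts u -> Zpts v -> Zpts (row_mx u v).
Proof. by move=> hu hv i; rewrite mxE; case: (fintype.split i) => j. Qed.
Lemma Zpts_lsubmx n p (t : 'rV[R]_(n + p)) : Zpts t -> Zpts (lsubmx t).
Proof. by move=> h i; rewrite mxE. Qed.
Lemma Zpts_rsubmx n p (t : 'rV[R]_(n + p)) : Zpts t -> Zpts (rsubmx t).
Proof. by move=> h i; rewrite mxE. Qed.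

End Projections.

Section Window.
Variables (R : realType) (d m : nat) (A : 'M[R]_(d, m)).

(* The rows of [B] generate the window, so the strip is the preimage of the unit cube. *)
Definition coords (B : 'M[R]_m) (t : 'rV[R]_(d + m)) : 'rV[R]_m := star A t *m invmx B.

Lemma parallelotope_strip (W : set 'rV[R]_(d + m)) : integral_parallelotope W ->
  exists B : 'M[R]_m, [/\ B \in unitmx, forall i j, B i j \is a Num.int &
    forall t, strip A W t <-> forall j, 0 <= coords B t 0 j <= 1].
Proof.
move=> [w [hw [fw ->]]]; pose B : 'M[R]_m := \matrix_j rsubmx (w j).
have wE j : w j = row_mx 0 (row j B).
  by have [[y _ e] _] := hw j; rewrite rowK -e row_mxKr.
have Bu : B \in unitmx.
  rewrite -row_free_unit; apply/row_freeP; case/row_freeP: fw => D hD.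
  exists (dsubmx D); rewrite -hD.
  have -> : \matrix_j w j = row_mx 0 B.
    by apply/row_matrixP => j; rewrite rowK wE row_row_mx row0.
  by rewrite -[D in RHS]vsubmxK mul_row_col mul0mx add0r.
exists B; split => //.
  by move=> i j; have [_ /Zpts_rsubmx /(_ j)] := hw i; rewrite !mxE.
move=> t; rewrite /strip /preimage /= pistarE.
have sumE (c : 'I_m -> R) : \sum_j c j *: w j = row_mx 0 ((\row_j c j) *m B).
  rewrite mulmx_sum_row.
  transitivity (\sum_j row_mx (0 : 'rV[R]_d) ((\row_j c j) 0 j *: row j B)).
    by apply: eq_bigr => j _; rewrite mxE [in LHS]wE scale_row_mx scaler0.
  elim/big_rec2: _ => [|j x y _ ->]; first by rewrite row_mx0.
  by rewrite add_row_mx addr0.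
split.
  move=> [c hc]; rewrite sumE => /eq_row_mx [_ e] j.
  by rewrite /coords -e mulmxK // mxE.
move=> h; exists (fun j => coords B t 0 j) => //; rewrite sumE; congr row_mx.
rewrite -[RHS](mulmxKV Bu) /coords; congr (_ *m _); apply/rowP => j; by rewrite mxE.
Qed.

Lemma coordsD B t u : coords B (t + u) = coords B t + coords B u.
Proof. by rewrite /coords starD mulmxDl. Qed.
Lemma coordsN B t : coords B (- t) = - coords B t.
Proof. by rewrite /coords starN mulNmx. Qed.

Lemma coordsDE B t u j : coords B (t + u) 0 j = coords B t 0 j + coords B u 0 j.
Proof. by rewrite coordsD mxE. Qed.

Lemma coords_F B (c : 'rV[R]_m) : B \in unitmx -> coords B (row_mx 0 (c *m B)) = c.
Proof. by move=> Bu; rewrite /coords /star row_mxKr row_mxKl mul0mx subr0 mulmxK. Qed.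

Lemma ball_rV n (x y : 'rV[R]_n) e : 0 < e -> ball x e y <-> forall i, `|x 0 i - y 0 i| < e.
Proof.
move=> e0; split => [[_ h] i|h]; first exact: h.
by split => // i j; rewrite ord1; exact: h.
Qed.

(** Were coordinate [j] an integer, subtracting an integral combination of the edges would put the
    point in the closed cell with that coordinate equal to 0. It would then lie on the boundary of
    the strip, since a small step against edge [j] leaves the strip. *)
Lemma regular_coords (W : set 'rV[R]_(d + m)) s B : B \in unitmx ->
  (forall i j, B i j \is a Num.int) ->
  (forall t, strip A W t <-> forall j, 0 <= coords B t 0 j <= 1) ->
  regular A W s -> forall z j, Zpts z -> coords B (z + s) 0 j \isn't a Num.int.
Proof.
move=> Bu Bi hS reg z j hz; apply/negP => jint.
pose c : 'rV[R]_m := \row_i (Num.floor (coords B (z + s) 0 i))%:~R.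
have cZ : Zpts c by move=> i; rewrite mxE intr_int.
pose z' := z - row_mx 0 (c *m B).
have z'Z : Zpts z' by apply: ZptsB => //; apply: Zpts_row_mx; [exact: Zpts0 | exact: Zpts_mulmx].
have uE i : coords B (z' + s) 0 i = fr (coords B (z + s) 0 i).
  have -> : z' + s = (z + s) - row_mx 0 (c *m B) by rewrite /z' addrAC.
  by rewrite (coordsD B (z + s)) coordsN coords_F // /fr !mxE.
have uj : coords B (z' + s) 0 j = 0 by rewrite uE /fr floorK // subrr.
apply: (reg z' z'Z); split.
  apply: subset_closure; apply/hS => i; rewrite uE.
  by have /andP[-> /ltW ->] := fr_itv (coords B (z + s) 0 i).
rewrite /interior /= => /nbhs_ballP [e /= e0 be].
pose v : 'rV[R]_(d + m) := row_mx 0 (delta_mx 0 j *m B).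
have vb : 0 < 1 + supn v by have := supn_ge0 v; lra.
pose eta := e / (1 + supn v).
have eta0 : 0 < eta by rewrite divr_gt0.
have : strip A W (z' + s - eta *: v).
  apply: be; apply/(ball_rV _ _ e0) => i; rewrite !mxE opprD opprK addrA subrr add0r.
  rewrite -[X in `|_ * X|](_ : v 0 i = _); last by rewrite mxE.
  rewrite normrM (gtr0_norm eta0); apply: le_lt_trans (_ : eta * supn v < _).
    by rewrite ler_wpM2l ?supn_ge // ltW.
  by rewrite /eta mulrAC ltr_pdivrMr // ltr_pM2l //; lra.
move/hS => /(_ j); rewrite coordsD coordsN -scaleN1r.
have -> : coords B (eta *: v) = eta *: delta_mx 0 j.
  by rewrite -(coords_F (eta *: delta_mx 0 j) Bu) -scalemxAl scale_row_mx scaler0.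
have -> : (coords B (z' + s) + -1 *: (eta *: delta_mx 0 j)) 0 j = - eta.
  by rewrite mxE uj add0r !mxE !eqxx mulr1 mulN1r.
by move=> /andP[]; lra.
Qed.

(** If [A *m b] were integral, the badly approximable form would vanish at a unit vector [h] with a
    suitable integer [p]. *)
Lemma bad_matrices_irrational : bad_matrices A -> (0 < d)%N ->
  forall (tau : 'rV[R]_m) eps, 0 < eps ->
    exists (n : 'rV[R]_d) (p : 'rV[R]_m),
      [/\ Zpts n, Zpts p & supn (n *m A + p - tau) < eps].
Proof.
move=> [_ bad] d0; apply: kronecker => b bi b0 Abi.
pose bz : 'cV[int]_m := \col_i Num.floor (b i 0).
have bE : intcol R bz = b.
  by apply/colP => i; rewrite !mxE floorK ?bi.
have bz0 : bz != 0.
  by apply: contra b0 => /eqP e; rewrite -bE e; apply/eqP/colP => i; rewrite !mxE.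
have [c [c0 hc]] := bad bz bz0; rewrite bE in hc.
pose i0 := Ordinal d0; pose h : 'rV[R]_d := delta_mx 0 i0.
have hZ : Zpts h by move=> i; rewrite mxE natr_int.
have h0 : h != 0.
  by apply/eqP => /rowP /(_ i0) /eqP; rewrite !mxE !eqxx oner_eq0.
have hA : (h *m (A *m b)) 0 0 = (A *m b) i0 0 by rewrite -rowE mxE.
have := hc h (- (A *m b) i0 0) hZ h0; rewrite rpredN hA subrr normr0 mulr0 => /(_ (Abi i0)).
by rewrite leNgt c0.
Qed.

(** Moving along $E$ and by lattice vectors matches the first [d] coordinates exactly, which leaves
    a Kronecker problem in $F$. *)
Lemma bad_totally_irrational : bad_matrices A -> (0 < d)%N -> totally_irrational A.
Proof.
move=> bA d0; apply/seteqP; split => // t _ U /nbhs_ballP [e /= e0 be].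
have [n [p [hn hp lt]]] := bad_matrices_irrational bA d0 (star A t) e0.
pose x := lsubmx t + n.
exists (row_mx x (x *m A) + row_mx (- n) p); split.
  exists (row_mx x (x *m A)); first by exists x.
  by exists (row_mx (- n) p) => //; apply: Zpts_row_mx => //; apply: ZptsN.
apply: be; apply/(ball_rV _ _ e0) => i.
apply: le_lt_trans lt; rewrite distrC.
have -> : (row_mx x (x *m A) + row_mx (- n) p) 0 i - t 0 i = (row_mx x (x *m A) + row_mx (- n) p - t) 0 i.
  by rewrite !mxE.
have -> : row_mx x (x *m A) + row_mx (- n) p - t = row_mx 0 (n *m A + p - star A t).
  rewrite -{1}[t]hsubmxK opp_row_mx !add_row_mx /x /star mulmxDl; congr row_mx.
    by apply/rowP => l; rewrite !mxE; ring.
  by move: (_ *m A) (n *m A) => P Q; apply/rowP => l; rewrite !mxE; ring.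
by rewrite (le_trans (supn_ge _ _)) // (le_trans (supn_row_mx _ _)) // supn0 add0r.
Qed.

Lemma coords_dense (B : 'M[R]_m) : bad_matrices A -> (0 < d)%N ->
  forall (tau : 'rV[R]_m) eps, 0 < eps -> B \in unitmx ->
    exists2 g, Zpts g & supn (coords B g - tau) < eps.
Proof.
move=> bA d0 tau eps e0 Bu; have [C [C0 hC]] := supn_mulmx (invmx B).
have [|n [p [hn hp lt]]] := bad_matrices_irrational bA d0 (tau *m B) (eps := eps / C).
  by rewrite divr_gt0.
exists (row_mx (- n) p); first by apply: Zpts_row_mx => //; apply: ZptsN.
have -> : coords B (row_mx (- n) p) - tau = (n *m A + p - tau *m B) *m invmx B.
  by rewrite mulmxBl mulmxK // /coords /star row_mxKr row_mxKl mulNmx opprK addrC [p + _]addrC addrC.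
apply: le_lt_trans (hC _) _; rewrite mulrC -ltr_pdivlMr //.
Qed.

End Window.

(** * Counting orbit points *)

Section Cardinals.

Definition cnt (T : choiceType) (S : set T) : nat := #|` fset_set S|.

(** [J] disjoint copies of [S] inside [S']: every sparseness estimate below has this form. *)
Lemma cnt_packing (T T' : choiceType) (S : set T) (S' : set T') (J : nat) (f : 'I_J -> T -> T') :
  finite_set S -> finite_set S' -> (forall a x, S x -> S' (f a x)) ->
  (forall a b x y, S x -> S y -> f a x = f b y -> a = b /\ x = y) ->
  (J * cnt S <= cnt S')%N.
Proof.
move=> fS fS' h inj.
pose l := [seq f a x | a <- enum 'I_J, x <- enum_fset (fset_set S)].
have ul : uniq l.
  apply: allpairs_uniq; [exact: enum_uniq | exact: fset_uniq |].
  move=> [a x] [b y] /allpairsP [[a' x'] /= [_ ix [-> ->]]] /allpairsP [[b' y'] /= [_ iy [-> ->]]] /= e.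
  have Sx : S x' by move: ix; rewrite in_fset_set // => /set_mem.
  have Sy : S y' by move: iy; rewrite in_fset_set // => /set_mem.
  by have [-> ->] := inj _ _ _ _ Sx Sy e.
have sub : {subset l <= enum_fset (fset_set S')}.
  move=> _ /allpairsP [[a x] /= [_ ix ->]].
  have Sx : S x by move: ix; rewrite in_fset_set // => /set_mem.
  by rewrite in_fset_set //; apply/mem_set; exact: h.
by have := uniq_leq_size ul sub; rewrite size_allpairs size_enum_ord.
Qed.

Lemma cnt_inj (T T' : choiceType) (S : set T) (S' : set T') (f : T -> T') :
  finite_set S -> finite_set S' -> (forall x, S x -> S' (f x)) ->
  (forall x y, S x -> S y -> f x = f y -> x = y) -> (cnt S <= cnt S')%N.
Proof.
move=> fS fS' h inj; rewrite -[cnt S]mul1n.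
apply: (@cnt_packing _ _ S S' 1 (fun _ => f)) => // a b x y Sx Sy e.
by split; [rewrite !ord1 | exact: inj].
Qed.

Lemma cnt_sub (T : choiceType) (S S' : set T) : finite_set S' -> S `<=` S' -> (cnt S <= cnt S')%N.
Proof. by move=> f h; apply: (cnt_inj (f := id)) => //; apply: sub_finite_set f. Qed.

Lemma cnt_setU (T : choiceType) (S S' : set T) : finite_set S -> finite_set S' ->
  (cnt (S `|` S') <= cnt S + cnt S')%N.
Proof. by move=> f f'; rewrite /cnt fset_setU //; exact: leq_card_fsetU. Qed.

Lemma cnt0 (T : choiceType) : cnt (@set0 T) = 0%N.
Proof. by rewrite /cnt fset_set0 cardfs0. Qed.

Lemma finite_encoding (T : choiceType) (S : set T) (I : finType) (e : T -> I) :
  (forall x y, S x -> S y -> e x = e y -> x = y) -> finite_set S /\ (cnt S <= #|I|)%N.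
Proof.
move=> inj; have fS : finite_set S.
  case: (pselect (S !=set0)) => [[x0 Sx0]|n]; last first.
    suff -> : S = set0 by [].
    by apply/seteqP; split => // x Sx; case: n; exists x.
  pose g i := xget x0 [set x | S x /\ e x = i].
  apply: (@sub_finite_set _ _ (g @` [set: I])); last by apply: finite_image; exact: finite_finset.
  move=> x Sx; exists (e x) => //; rewrite /g; case: xgetP => [y _ [Sy ey]|/(_ x)].
    exact: inj.
  by case.
split => //; rewrite /cnt.
have ul : uniq [seq e x | x <- enum_fset (fset_set S)].
  rewrite map_inj_in_uniq ?fset_uniq // => x y; rewrite !in_fset_set // => /set_mem Sx /set_mem Sy; exact: inj.
by have := max_card (mem [seq e x | x <- enum_fset (fset_set S)]); rewrite (card_uniqP ul) size_map.
Qed.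

Lemma encoding_cnt (T : choiceType) (S : set T) (I : finType) (g : I -> T) : finite_set S ->
  (forall i, S (g i)) -> injective g -> (#|I| <= cnt S)%N.
Proof.
move=> fS h inj; rewrite cardE -(size_map g).
apply: uniq_leq_size; first by rewrite map_inj_uniq // enum_uniq.
by move=> _ /mapP [i _ ->]; rewrite in_fset_set //; apply/mem_set; exact: h.
Qed.

End Cardinals.

Section Counting.
Variables (R : realType) (d m : nat) (A : 'M[R]_(d, m)) (F0 : set 'rV[R]_(d + m)).
Variables (B : 'M[R]_m) (s : 'rV[R]_(d + m)).
Hypotheses (d_gt0 : (0 < d)%N) (hF0 : admissible_F0 A F0).
Hypotheses (Bu : B \in unitmx) (Bi : forall i j, B i j \is a Num.int).

Definition shifted_lattice : set 'rV[R]_(d + m) := [set z + s | z in @Zpts R (d + m)].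
(** An enlargement of the orbit in the strip with room, in both directions, for its translates by
    lattice vectors. *)
Definition ball_orbit (L T : R) : set 'rV[R]_(d + m) :=
  [set t | shifted_lattice t /\ (forall j, `|coords A B t 0 j| <= L) /\ supn (pi1 A F0 t) <= T].
Definition cell_orbit (T : R) : set 'rV[R]_(d + m) :=
  [set t | shifted_lattice t /\ (forall j, 0 <= coords A B t 0 j <= 1) /\ supn (pi1 A F0 t) <= T].
Definition tot (T : R) : nat := cnt (cell_orbit T).

Lemma star_coords t : star A t = coords A B t *m B.
Proof. by rewrite /coords mulmxKV. Qed.

Lemma star_bound : exists2 C : R, 0 < C & forall t L, 0 <= L ->
  (forall j, `|coords A B t 0 j| <= L) -> supn (star A t) <= C * L.
Proof.
have [C [C0 hC]] := supn_mulmx B; exists C => // t L L0 h.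
rewrite star_coords (le_trans (hC _)) // ler_wpM2l ?(ltW C0) //.
exact: supn_le.
Qed.

Lemma nat_above (x : R) : exists N : nat, x <= N%:R <= `|x| + 1.
Proof.
exists `|Num.ceil `|x| |%N.
have /andP[h1 h2] := ceil_itv `|x|; rewrite intrD in h1.
have c0 : 0 <= Num.ceil `|x| by rewrite -(ler0z R) (le_trans _ h2).
have -> : (`|Num.ceil `|x| |%N)%:R = (Num.ceil `|x|)%:~R :> R by rewrite -[in RHS](gez0_abs c0).
by have h3 := ler_norm x; apply/andP; split; lra.
Qed.

Lemma int_encoding (N : nat) (x y : R) : x \is a Num.int -> y \is a Num.int ->
  `|x| <= N%:R -> `|y| <= N%:R ->
  (inord `|Num.floor (x + N%:R)|%N : 'I_(2 * N).+1) = inord `|Num.floor (y + N%:R)|%N -> x = y.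
Proof.
move=> xi yi; rewrite !ler_norml => /andP[x1 x2] /andP[y1 y2].
have key z : z \is a Num.int -> - N%:R <= z -> z <= N%:R ->
    (`|Num.floor (z + N%:R)| < (2 * N).+1)%N /\ (`|Num.floor (z + N%:R)|%N)%:R = z + N%:R :> R.
  move=> zi z1 z2; have f0 : 0 <= Num.floor (z + N%:R) by rewrite floor_ge0; lra.
  have E : (`|Num.floor (z + N%:R)|%N)%:R = z + N%:R :> R.
    rewrite -[RHS](floorK (_ : z + N%:R \is a Num.int)); last by rewrite rpredD ?natr_int.
    by rewrite -[in RHS](gez0_abs f0).
  by split => //; rewrite ltnS -(ler_nat R) E natrM; lra.
have [lx ex] := key x xi x1 x2; have [ly ey] := key y yi y1 y2.
move/(congr1 val) => /=; rewrite !inordK // => e; move: ex; rewrite e ey; lra.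
Qed.

(** The first [d] integer coordinates are at most [N] in size, and the star map being bounded leaves
    boundedly many choices for the other [m]; hence growth of order $N^d$ rather than $N^{d+m}$. *)
Lemma ball_orbit_upper L : 0 <= L -> exists (a : nat) (c : R), 0 <= c /\
  forall T (N : nat), T + c <= N%:R -> finite_set (ball_orbit L T) /\
    (cnt (ball_orbit L T) <= (2 * N).+1 ^ d * a)%N.
Proof.
move=> L0; have [C1 C10 h1] := star_bound; have [C2 C20 h2] := pi1_pi2 hF0.
have [M /andP[hM _]] := nat_above (C1 * L + 1).
exists ((2 * M).+1 ^ m)%N, (C2 * (C1 * L) + supn s); split.
  by rewrite addr_ge0 ?supn_ge0 // !mulr_ge0 // ltW.
move=> T N hN.
pose p0 (t : 'rV[R]_(d + m)) i : R := (lsubmx t *m A) 0 i - rsubmx s 0 i.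
pose e (t : 'rV[R]_(d + m)) : {ffun 'I_d -> 'I_(2 * N).+1} * {ffun 'I_m -> 'I_(2 * M).+1} :=
  ([ffun i => inord `|Num.floor (lsubmx (t - s) ord0 i + N%:R)|%N],
   [ffun i => inord `|Num.floor (rsubmx (t - s) ord0 i - (Num.floor (p0 t i))%:~R + M%:R)|%N]).
have lb t i : ball_orbit L T t -> lsubmx (t - s) 0 i \is a Num.int /\ `|lsubmx (t - s) 0 i| <= N%:R.
  move=> [[z hz <-] [hL hT]]; rewrite addrK; split; first exact: Zpts_lsubmx.
  apply: (le_trans (supn_ge _ _)).
  have -> : z = (z + s) - s by rewrite addrK.
  apply: le_trans hN; rewrite linearB /= (le_trans (supnB _ _)) //.
  rewrite addrA lerD ?supn_lsubmx // (le_trans (supn_lsub_pi2 A _)) //.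
  have -> : pi2 A (z + s) = pi1 A F0 (z + s) - (pi1 A F0 (z + s) - pi2 A (z + s)) by rewrite subKr.
  rewrite (le_trans (supnB _ _)) // lerD // (le_trans (h2 _)) // ler_wpM2l ?(ltW C20) //.
  exact: h1.
have rb t i : ball_orbit L T t -> rsubmx (t - s) 0 i - (Num.floor (p0 t i))%:~R \is a Num.int /\
     `|rsubmx (t - s) 0 i - (Num.floor (p0 t i))%:~R| <= M%:R.
  move=> [[z hz <-] [hL hT]]; rewrite addrK; split.
    by rewrite rpredB ?intr_int //; exact: Zpts_rsubmx.
  apply: le_trans hM.
  have -> : rsubmx z 0 i - (Num.floor (p0 (z + s) i))%:~R = star A (z + s) 0 i + fr (p0 (z + s) i).
    rewrite /star /fr /p0 linearD /=; move: (_ *m A) => X; rewrite !mxE; ring.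
  have /andP[f0 f1] := fr_itv (p0 (z + s) i).
  rewrite (le_trans (ler_normD _ _)) // lerD //.
    by rewrite (le_trans (supn_ge _ _)) // h1.
  by rewrite ger0_norm // ltW.
suff inj t t' : ball_orbit L T t -> ball_orbit L T t' -> e t = e t' -> t = t'.
  have [fin] := finite_encoding inj.
  by rewrite card_prod !card_ffun !card_ord.
move=> ht ht' [/ffunP e1 /ffunP e2].
have El : lsubmx (t - s) = lsubmx (t' - s).
  apply/rowP => i; have := e1 i; rewrite !ffunE.
  by apply: int_encoding; [exact: (lb t i ht).1 | exact: (lb t' i ht').1 | exact: (lb t i ht).2 | exact: (lb t' i ht').2].
have lt : lsubmx t = lsubmx t' by move: El; rewrite !linearB /= => /addIr.
have Er : rsubmx (t - s) = rsubmx (t' - s).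
  apply/rowP => i; have := e2 i; rewrite !ffunE => /int_encoding h.
  have : rsubmx (t - s) 0 i - (Num.floor (p0 t i))%:~R = rsubmx (t' - s) 0 i - (Num.floor (p0 t' i))%:~R.
    by apply: h; [exact: (rb t i ht).1 | exact: (rb t' i ht').1 | exact: (rb t i ht).2 | exact: (rb t' i ht').2].
  by rewrite /p0 lt => /addIr.
by apply: (addIr (- s)); rewrite -[LHS]hsubmxK -[RHS]hsubmxK El Er.
Qed.

Lemma ball_orbit_finite L T : 0 <= L -> finite_set (ball_orbit L T).
Proof.
move=> L0; have [a [c [_ h]]] := ball_orbit_upper L0.
by have [N /andP[hN _]] := nat_above (T + c); have [] := h T N hN.
Qed.

Lemma cell_sub_ball T : cell_orbit T `<=` ball_orbit 1 T.
Proof.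
move=> t [h1 [h2 h3]]; split=> //; split => // j.
by have /andP[a b] := h2 j; rewrite ger0_norm.
Qed.

Lemma cell_orbit_finite T : finite_set (cell_orbit T).
Proof. by apply: sub_finite_set (@cell_sub_ball T) _; exact: ball_orbit_finite. Qed.

(** Brings [t] into the unit cell modulo the lattice spanned by the edges of the window. As the
    edges are integral vectors of $F$, the orbit and the first [d] coordinates are preserved. *)
Definition reduce (t : 'rV[R]_(d + m)) : 'rV[R]_(d + m) :=
  t - row_mx 0 ((\row_j (Num.floor (coords A B t 0 j))%:~R) *m B).

Lemma coords_reduce t j : coords A B (reduce t) 0 j = fr (coords A B t 0 j).
Proof. by rewrite /reduce coordsD coordsN coords_F // /fr !mxE. Qed.

Lemma lsubmx_reduce t : lsubmx (reduce t) = lsubmx t.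
Proof. by rewrite /reduce linearB /= row_mxKl subr0. Qed.

Lemma reduce_Zpts t : Zpts (t - reduce t).
Proof.
rewrite /reduce opprB addrC subrK; apply: Zpts_row_mx; first exact: Zpts0.
by apply: Zpts_mulmx => // i; rewrite mxE intr_int.
Qed.

Lemma reduce_orbit t : shifted_lattice t -> shifted_lattice (reduce t).
Proof.
move=> [z hz <-]; exists (z - ((z + s) - reduce (z + s))).
  by apply: ZptsB => //; exact: reduce_Zpts.
by move: (reduce (z + s)) => r; apply/rowP => i; rewrite !mxE; ring.
Qed.

Lemma pi1_reduce : exists2 C : R, 0 < C & forall t,
  supn (pi1 A F0 (reduce t) - pi2 A t) <= C.
Proof.
have [C1 C10 h1] := star_bound; have [C2 C20 h2] := pi1_pi2 hF0.
exists (C2 * (C1 * 1)); first by rewrite !mulr_gt0.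
move=> t; rewrite -[pi2 A t]/(pi2 A t) pi2E -lsubmx_reduce -pi2E.
rewrite (le_trans (h2 _)) // ler_wpM2l ?(ltW C20) // h1 // => j.
rewrite coords_reduce; have /andP[a b] := fr_itv (coords A B t 0 j).
by rewrite ger0_norm // ltW.
Qed.

(** Integral points with first coordinates in a box of side [N], shifted by [s], are reduced into
    the cell; they stay distinct because [reduce] keeps [lsubmx]. *)
Lemma tot_lower : exists b c : R, [/\ 0 < b, 0 <= c &
  forall T (N : nat), b * N%:R + c <= T -> (N ^ d <= tot T)%N].
Proof.
have [C1 C10 h1] := pi1_reduce; have [C2 C20 h2] := pi2_bound A.
exists C2, (C2 * supn s + C1); split => //.
  by rewrite addr_ge0 ?mulr_ge0 ?supn_ge0 // ltW.
move=> T N hN.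
pose g (f : {ffun 'I_d -> 'I_N}) := reduce (row_mx (\row_i (f i : nat)%:R) 0 + s).
have -> : (N ^ d = #|{ffun 'I_d -> 'I_N}|)%N by rewrite card_ffun !card_ord.
apply: (encoding_cnt (g := g)); first exact: cell_orbit_finite.
  move=> f; split; last split.
  - apply: reduce_orbit; exists (row_mx (\row_i (f i : nat)%:R) 0) => //.
    apply: Zpts_row_mx; last exact: Zpts0.
    by move=> i; rewrite mxE natr_int.
  - move=> j; rewrite coords_reduce.
    by have /andP[-> /ltW ->] := fr_itv (coords A B (row_mx (\row_i (f i : nat)%:R) 0 + s) 0 j).
  - apply: le_trans hN; rewrite /g; set t := row_mx _ _ + s.
    have -> : pi1 A F0 (reduce t) = (pi1 A F0 (reduce t) - pi2 A t) + pi2 A t by rewrite subrK.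
    rewrite (le_trans (supnD _ _)) // addrA [C2 * N%:R + _ + C1]addrC lerD //.
    rewrite (le_trans (h2 _)) // -mulrDr ler_wpM2l ?(ltW C20) // /t linearD /= row_mxKl.
    rewrite (le_trans (supnD _ _)) // lerD ?supn_lsubmx //.
    by apply: supn_le => // i; rewrite mxE normr_nat ler_nat ltnW.
have lg f : lsubmx (g f) = \row_i (f i : nat)%:R + lsubmx s.
  by rewrite /g lsubmx_reduce linearD /= row_mxKl.
clearbody g => f f' gff; have : lsubmx (g f) = lsubmx (g f') by rewrite gff.
rewrite (lg f) (lg f') => /rowP e.
apply/ffunP => i; apply: val_inj; have := e i; rewrite !mxE => /addIr /eqP.
by rewrite eqr_nat => /eqP.
Qed.

(** Both counts have order [T ^ d]. The constant [C] precedes [kappa], because the packings choose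
    their number of translates from [C] and obtain [kappa] only afterwards. *)
Lemma growth L : 0 <= L -> exists C : nat, forall kappa : R, exists T0 : R, forall T, T0 <= T ->
  (cnt (ball_orbit L (T + kappa)) <= C * tot T)%N.
Proof.
move=> L0; have [a [c [c0 up]]] := ball_orbit_upper L0.
have [b [c' [b0 c'0 low]]] := tot_lower.
have [D /andP[hD _]] := nat_above (8 * b + 1).
exists (D ^ d * a)%N => kappa.
exists (`|kappa| + c + c' + 4 * b + 2 + c' + c'); move=> T hT.
have k0 := normr_ge0 kappa; have k1 := ler_norm kappa.
have k2 : - kappa <= `|kappa| by rewrite -normrN ler_norm.
pose x := (T - c') / b.
have x2 : 2 <= x by rewrite /x ler_pdivlMr //; lra.
pose N0 := `|Num.floor x|%N.
have f0 : 0 <= Num.floor x by rewrite floor_ge0; lra.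
have E0 : N0%:R = (Num.floor x)%:~R :> R by rewrite -[in RHS](gez0_abs f0).
have /andP[fx1 fx2] := floor_itv x; rewrite intrD -E0 in fx1 fx2.
have hN0 : b * N0%:R + c' <= T.
  have : b * N0%:R <= b * x by rewrite ler_wpM2l // ltW.
  by rewrite /x mulrC mulrCA mulfV ?gt_eqF // mulr1; lra.
have [N /andP[hN hN']] := nat_above (T + kappa + c).
have [_ le] := up (T + kappa) N hN.
apply: leq_trans le _; rewrite mulnAC leq_mul2r; apply/orP; right.
apply: leq_trans (_ : (D * N0) ^ d <= _)%N; last first.
  by rewrite expnMn leq_mul2l low // orbT.
rewrite leq_exp2r // -(ler_nat R) natrM -natr1 natrM.
have : `|T + kappa + c| <= T + `|kappa| + c.
  by rewrite ger0_norm; lra.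
have : (8 * b + 1) * N0%:R <= D%:R * N0%:R by rewrite ler_wpM2r.
have : b * x = T - c' by rewrite /x mulrC divfK // gt_eqF.
have : b * x <= b * (N0%:R + 1) by rewrite ler_wpM2l // ltW.
have : 0 <= N0%:R :> R by [].
lra.
Qed.

Lemma union_cnt (T : choiceType) (I : eqType) (l : seq I) (X : I -> set T) (J N : nat) :
  (forall x, finite_set (X x)) -> (forall x, (J * cnt (X x) <= N)%N) ->
  finite_set [set t | exists2 x, x \in l & X x t] /\
  (J * cnt [set t | exists2 x, x \in l & X x t] <= size l * N)%N.
Proof.
move=> fX hX; elim: l => [|x l [IHf IH]].
  have -> : [set t | exists2 x, x \in [::] & X x t] = set0.
    by apply/seteqP; split => // t [].
  by rewrite cnt0 muln0; split => //; exact: finite_set0.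
have sub : [set t | exists2 y, y \in x :: l & X y t] `<=` X x `|` [set t | exists2 y, y \in l & X y t].
  move=> t [y]; rewrite inE => /predU1P [->|yl] Xy; first by left.
  by right; exists y.
have f2 : finite_set (X x `|` [set t | exists2 y, y \in l & X y t]) by rewrite finite_setU.
split; first exact: sub_finite_set f2.
have h1 := cnt_sub f2 sub; have h2 := cnt_setU (fX x) IHf; have h3 := hX x.
rewrite /= mulSn; apply: leq_trans (leq_add h3 IH).
by rewrite -mulnDr leq_mul2l (leq_trans h1 h2) orbT.
Qed.

Lemma translates_packing L L' T kappa (X : set 'rV[R]_(d + m)) (J : nat) (g : 'I_J -> 'rV[R]_(d + m)) :
  0 <= L -> 0 <= L' -> X `<=` ball_orbit L T ->
  (forall a, [/\ Zpts (g a), forall j, `|coords A B (g a) 0 j| <= L' & supn (pi1 A F0 (g a)) <= kappa]) ->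
  (forall a b t t', X t -> X t' -> t + g a = t' + g b -> a = b) ->
  (J * cnt X <= cnt (ball_orbit (L + L') (T + kappa)))%N.
Proof.
move=> L0 L'0 XL hg inj; apply: (cnt_packing (f := fun a t => t + g a)).
- by apply: sub_finite_set XL _; exact: ball_orbit_finite.
- by apply: ball_orbit_finite; exact: addr_ge0.
- move=> a t /XL [[z hz <-] [hL hT]]; have [gz gl gk] := hg a; split; last split.
  + by exists (z + g a); [exact: ZptsD | rewrite addrAC].
  + by move=> j; rewrite coordsDE (le_trans (ler_normD _ _)) // lerD.
  + by rewrite (pi1D hF0) (le_trans (supnD _ _)) // lerD.
- move=> a b t t' Xt Xt' e; have ab := inj a b t t' Xt Xt' e; split => //.
  by move: e; rewrite ab => /addIr.
Qed.

Hypothesis dense : forall (tau : 'rV[R]_m) eps, 0 < eps ->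
  exists2 g, Zpts g & supn (coords A B g - tau) < eps.

Lemma ord_eq_of_close (J : nat) (a b : 'I_J) (x : R) : 0 < x ->
  `|(a : nat)%:R * x - (b : nat)%:R * x| < x -> a = b.
Proof.
move=> x0; rewrite -mulrBl normrM (gtr0_norm x0) gtr_pMl // => h.
apply: val_inj; apply: (@nat_dist_lt R _ _ 1) => //; by rewrite !modn1.
Qed.

(** By density there are lattice vectors whose coordinates are close to the multiples of [J0%:R^-1];
    they carry a slab of width of order [eta] to disjoint slabs inside a fixed enlargement of the
    cell. *)
Lemma slab_cnt (J : nat) : exists2 eta : R, 0 < eta & exists T0, forall T, T0 <= T -> forall j q,
  (J * cnt [set t | cell_orbit T t /\ `|coords A B t 0 j - q| < eta]%R <= tot T)%N.
Proof.
have [C hC] := growth (ler0n R 3).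
(* The factor [C.+1] absorbs the constant of [growth]; the final successor keeps [J0] positive when
   [J = 0]. *)
pose J0 := (J * C.+1).+1.
have J00 : 0 < J0%:R :> R by [].
pose eta : R := (4 * J0%:R)^-1.
have e0 : 0 < eta by rewrite invr_gt0 mulr_gt0.
have J0E : J0%:R^-1 = 4 * eta.
  by rewrite /eta invfM mulrA mulfV ?mul1r // gt_eqF.
have Ji0 : 0 < J0%:R^-1 :> R by rewrite invr_gt0.
have hg (a : 'I_J0) : exists g, Zpts g /\ supn (coords A B g - const_mx ((a : nat)%:R * J0%:R^-1)) < eta.
  by have [g h1 h2] := dense (const_mx ((a : nat)%:R * J0%:R^-1)) e0; exists g.
have [g gP] := boolp.choice hg.
pose kappa := \sum_a supn (pi1 A F0 (g a)).
have [T0 hT0] := hC kappa.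
exists eta => //; exists T0 => T hT j q.
pose X : set 'rV[R]_(d + m) := [set t | cell_orbit T t /\ `|coords A B t 0 j - q| < eta].
have gj a i : `|coords A B (g a) 0 i - (a : nat)%:R * J0%:R^-1| < eta.
  have [_ h] := gP a; apply: le_lt_trans h.
  by have := supn_ge (coords A B (g a) - const_mx ((a : nat)%:R * J0%:R^-1)) i; rewrite !mxE.
have : (J0 * cnt X <= cnt (ball_orbit (1 + 2) (T + kappa)))%N.
  apply: (translates_packing (g := g)) => //.
  - by move=> t [h _]; exact: cell_sub_ball.
  - move=> a; have [gz _] := gP a; split => //.
      move=> i; have := gj a i.
      have a1 : (a : nat)%:R * J0%:R^-1 <= 1 :> R.
        by rewrite ler_pdivrMr // mul1r ler_nat ltnW.
      have a0 : 0 <= (a : nat)%:R * J0%:R^-1 :> R by rewrite mulr_ge0 // ltW.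
      have eta1 : 4 * eta <= 1 by rewrite -J0E invf_le1 // ler1n.
      by rewrite ltr_norml ler_norml; lra.
    by rewrite /kappa (bigD1 a) //= lerDl sumr_ge0 // => b _; rewrite supn_ge0.
  - move=> a b t t' [_ ht] [_ ht'] e.
    apply: (@ord_eq_of_close _ _ _ J0%:R^-1) => //; rewrite J0E.
    have : coords A B (t + g a) 0 j = coords A B (t' + g b) 0 j by rewrite e.
    rewrite !coordsDE; have := gj a j; have := gj b j; move: ht ht'.
    by rewrite J0E !ltr_norml; lra.
rewrite (_ : 1 + 2 = 3 :> R); last by ring.
move=> /leq_trans /(_ (hT0 T hT)) h.
by rewrite -(leq_pmul2l (ltn0Sn C)); move: h; rewrite /J0; change (cnt _) with (cnt X); nia.
Qed.

(** One face of the sup-norm annulus, packed along $E$: lattice vectors reduced into the cell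
    advance the coordinate [i] of [pi1] by prescribed amounts up to an error [D]. If that coordinate
    vanishes on $E$, the face is empty for large [T]. *)
Lemma annulus_piece_cnt (i : 'I_(d + m)) (b : bool) (kappa : R) (J : nat) : 0 <= kappa ->
  exists T0, forall T, T0 <= T ->
  (J * cnt [set t | cell_orbit T t /\ T - kappa < (-1) ^+ b * pi1 A F0 t 0 i]%R <= tot T)%N.
Proof.
move=> k0.
case: (pselect (forall x : 'rV[R]_d, row_mx x (x *m A) 0 i = 0)) => [z|/existsNP [x1 /eqP n0]].
  exists kappa => T hT.
  have -> : [set t | cell_orbit T t /\ T - kappa < (-1) ^+ b * pi1 A F0 t 0 i] = set0.
    apply/seteqP; split => // t [_]; have [[x _ <-] _] := pi1_spec hF0 t.
    by rewrite z mulr0; lra.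
  by rewrite cnt0 muln0.
pose x0 := (row_mx x1 (x1 *m A) 0 i)^-1 *: x1.
have x0E (la : R) : row_mx (la *: x0) ((la *: x0) *m A) 0 i = la.
  rewrite /x0 scalerA -scalemxAl -scale_row_mx [LHS]mxE -mulrA mulVf ?mulr1 //.
have [C1 C10 h1] := pi1_reduce; have [C2 C20 h2] := pi2_bound A.
pose D := C1 + C2; have D0 : 0 < D by rewrite addr_gt0.
pose fl (la : R) : 'rV[R]_d := \row_l (Num.floor ((la *: x0) 0 l))%:~R.
pose gg (la : R) := reduce (row_mx (fl la) 0).
have ggZ la : Zpts (gg la).
  have Zf : Zpts (row_mx (fl la) (0 : 'rV[R]_m)).
    by apply: Zpts_row_mx; [move=> l; rewrite mxE intr_int | exact: Zpts0].
  have := ZptsB Zf (reduce_Zpts (row_mx (fl la) 0)).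
  by rewrite subKr.
have ggi la : `|pi1 A F0 (gg la) 0 i - la| <= D.
  rewrite -[la in _ - la]x0E.
  set y := la *: x0; set t := row_mx (fl la) (0 : 'rV[R]_m).
  have -> : pi1 A F0 (gg la) 0 i - row_mx y (y *m A) 0 i =
     (pi1 A F0 (gg la) - pi2 A t) 0 i + (pi2 A (row_mx (fl la - y) 0)) 0 i.
    rewrite !pi2E !row_mxKl mulmxBl -(subrK (row_mx y (y *m A)) (row_mx (fl la) _)).
    rewrite opp_row_mx add_row_mx; move: (row_mx (fl la - y) _) (row_mx y _) (pi1 _ _ _) => u v w.
    by rewrite !mxE; ring.
  rewrite (le_trans (ler_normD _ _)) // /D lerD // (le_trans (supn_ge _ _)) //.
    exact: h1.
  rewrite (le_trans (h2 _)) // -[leRHS]mulr1 ler_wpM2l ?(ltW C20) // row_mxKl.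
  apply: supn_le => // l; rewrite mxE [X in X + _]mxE [X in _ + X]mxE distrC.
  by have /andP[f0 f1] := fr_itv (y 0 l); rewrite -/(fr (y 0 l)) ger0_norm // ltW.
have [C hC] := growth (ler0n R 2).
pose J0 := (J * C.+1)%N.
(* Two points of the face differ by at most [kappa] in this coordinate and each translation is off
   by at most [D], so steps of this length keep the translates disjoint. *)
pose stp := kappa + 2 * D + 1.
have stp0 : 0 < stp by rewrite /stp; lra.
pose g (a : 'I_J0) := gg ((a : nat)%:R * stp).
have gZ a : Zpts (g a) := ggZ _.
have gI a : `|pi1 A F0 (g a) 0 i - (a : nat)%:R * stp| <= D := ggi _.
have gC a j : `|coords A B (g a) 0 j| <= 1.
  rewrite /g /gg coords_reduce.
  have /andP[f0 f1] := fr_itv (coords A B (row_mx (fl ((a : nat)%:R * stp)) 0) 0 j).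
  by rewrite ger0_norm // ltW.
clearbody g.
pose K := \sum_a supn (pi1 A F0 (g a)).
have [T0 hT0] := hC K.
exists T0 => T hT.
pose X : set 'rV[R]_(d + m) := [set t | cell_orbit T t /\ T - kappa < (-1) ^+ b * pi1 A F0 t 0 i].
have Xi t : X t -> T - kappa < (-1) ^+ b * pi1 A F0 t 0 i <= T.
  move=> [[_ [_ hT']] ->] /=; apply: le_trans hT'; apply: le_trans (supn_ge _ i).
  by rewrite (le_trans (ler_norm _)) // normrM normrX normrN1 expr1n mul1r.
have : (J0 * cnt X <= cnt (ball_orbit (1 + 1) (T + K)))%N.
  apply: (translates_packing (g := g)) => //.
  - by move=> t [h _]; exact: cell_sub_ball.
  - move=> a; split => //.
    by rewrite /K (bigD1 a) //= lerDl sumr_ge0 // => c _; rewrite supn_ge0.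
  - move=> a c t t' /Xi ht /Xi ht' e.
    apply: (@ord_eq_of_close _ _ _ stp) => //.
    have e1 : pi1 A F0 t 0 i + pi1 A F0 (g a) 0 i = pi1 A F0 t' 0 i + pi1 A F0 (g c) 0 i.
      have : pi1 A F0 (t + g a) 0 i = pi1 A F0 (t' + g c) 0 i by rewrite e.
      by rewrite !(pi1D hF0) !mxE.
    have := gI a; have := gI c; rewrite ltr_norml !ler_norml.
    move: ht ht' e1; clear; case: b => /=; rewrite ?expr1 ?expr0 ?mulN1r ?mul1r /stp => *; lra.
rewrite (_ : 1 + 1 = 2 :> R) //.
move=> /leq_trans /(_ (hT0 T hT)) h.
by rewrite -(leq_pmul2l (ltn0Sn C)); move: h; rewrite /J0; change (cnt _) with (cnt X); nia.
Qed.

Lemma annulus_cnt (kappa : R) (J : nat) : exists T0, forall T, T0 <= T ->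
  (J * cnt [set t | cell_orbit T t /\ T - kappa < supn (pi1 A F0 t)]%R <= tot T)%N.
Proof.
pose k := `|kappa|; have k0 : 0 <= k by exact: normr_ge0.
have kk : kappa <= k by exact: ler_norm.
pose l := enum {: 'I_(d + m) * bool}; pose J' := (J * (size l).+1)%N.
have h (ib : 'I_(d + m) * bool) : exists T0, forall T, T0 <= T ->
   (J' * cnt [set t | cell_orbit T t /\ T - k < (-1) ^+ ib.2 * pi1 A F0 t 0 ib.1]%R <= tot T)%N.
  exact: annulus_piece_cnt.
have [f hf] := boolp.choice h.
exists (k + \sum_ib `|f ib|) => T hT.
have Tk : k <= T by apply: le_trans hT; rewrite lerDl sumr_ge0.
pose X (ib : 'I_(d + m) * bool) : set 'rV[R]_(d + m) := [set t | cell_orbit T t /\ T - k < (-1) ^+ ib.2 * pi1 A F0 t 0 ib.1].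
have fX (ib : 'I_(d + m) * bool) : finite_set (X ib).
  by apply: sub_finite_set (cell_orbit_finite T) => t [].
have hX (ib : 'I_(d + m) * bool) : (J' * cnt (X ib) <= tot T)%N.
  apply: hf; apply: le_trans hT; apply: le_trans (ler_norm _) _.
  rewrite (bigD1 ib) //= ler_wpDl // lerDl sumr_ge0 //.
have [fU U] := @union_cnt _ _ l X J' (tot T) fX hX.
have sub : [set t | cell_orbit T t /\ T - kappa < supn (pi1 A F0 t)] `<=` [set t | exists2 x, x \in l & X x t].
  move=> t [ct lt].
  have s0 : 0 < supn (pi1 A F0 t) \/ pi1 A F0 t = 0.
    by case: (eqVneq (pi1 A F0 t) 0) => [->|n]; [right | left; exact: supn_gt0].
  have p0 : T - k < supn (pi1 A F0 t) by apply: le_lt_trans lt; rewrite lerD2l lerN2.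
  have n0 : pi1 A F0 t != 0.
    by apply/eqP => e; move: p0; rewrite e supn0; lra.
  have [i e] := supn_attained n0.
  exists (i, pi1 A F0 t 0 i < 0); first by rewrite mem_enum.
  split => //=; rewrite e in p0; apply: (lt_le_trans p0).
  by case: ltrP => h0; rewrite ?expr1 ?expr0 ?mulN1r ?mul1r ?(ltr0_norm h0) ?(ger0_norm h0).
have := cnt_sub fU sub; move: U; rewrite /J' -/l; move: (size l) (cnt _) (cnt _) (tot T) => n c1 c2 t U le.
apply: leq_trans (_ : J * c2 <= _)%N; first by rewrite leq_mul2l le orbT.
rewrite -(leq_pmul2l (ltn0Sn n)); nia.
Qed.

(* Shift by a lattice vector close to the translation from [a1] to [a2]; the error is carried by
   thin slabs around the cell walls and by a thin annulus. *)
Lemma translate_cnt (E1 E2 : set 'rV[R]_(d + m)) (a1 a2 : 'I_m -> R) (Q : seq R) :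
  (forall t, E1 t -> shifted_lattice t /\ forall j, 0 <= coords A B t 0 j <= 1) ->
  (forall t, E2 t -> shifted_lattice t /\ forall j, 0 <= coords A B t 0 j <= 1) ->
  (forall t1 t2, shifted_lattice t1 -> shifted_lattice t2 ->
     (forall j q, q \in Q -> (q < coords A B t1 0 j - a1 j) = (q < coords A B t2 0 j - a2 j)) ->
     E1 t1 -> E2 t2) ->
  forall J : nat, exists T0, forall T, T0 <= T ->
   (J * cnt [set t | E1 t /\ (supn (pi1 A F0 t) <= T)%R] <=
    J * cnt [set t | E2 t /\ (supn (pi1 A F0 t) <= T)%R] + tot T)%N.
Proof.
move=> h1 h2 h12 J.
pose l := [seq (j, q) | j <- enum 'I_m, q <- Q].
(* The factors make all slabs together, and likewise the annulus, cost at most half of [tot T] after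
   multiplication by [J]. *)
have [eta eta0 [T1 hT1]] := slab_cnt (2 * J * (size l).+1).
have [g gz hg] := dense (\row_j (a2 j - a1 j)) eta0.
pose kappa := supn (pi1 A F0 g).
have [T2 hT2] := annulus_cnt kappa (2 * J).
exists (Num.max T1 T2) => T; rewrite ge_max => /andP[/hT1 {}hT1 /hT2 {}hT2].
pose X (x : 'I_m * R) : set 'rV[R]_(d + m) :=
  [set t | cell_orbit T t /\ `|coords A B t 0 x.1 - (a1 x.1 + x.2)| < eta].
have fX x : finite_set (X x) by apply: sub_finite_set (cell_orbit_finite T) => t [].
have [fU U] := @union_cnt _ _ l X _ (tot T) fX (fun x => hT1 x.1 (a1 x.1 + x.2)).
set S := [set t | exists2 x, x \in l & X x t] in fU U.
pose N : set 'rV[R]_(d + m) := [set t | cell_orbit T t /\ T - kappa < supn (pi1 A F0 t)].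
have fN : finite_set N by apply: sub_finite_set (cell_orbit_finite T) => t [].
pose E' : set 'rV[R]_(d + m) := [set t | E2 (t + g) /\ supn (pi1 A F0 (t + g)) <= T].
have fE2 : finite_set [set t | E2 t /\ supn (pi1 A F0 t) <= T].
  by apply: sub_finite_set (cell_orbit_finite T) => t [e le]; have [ot ct] := h2 t e.
have E'E : E' `<=` (fun t => t - g) @` [set t | E2 t /\ supn (pi1 A F0 t) <= T].
  by move=> t ht; exists (t + g) => //; rewrite addrK.
have fE' : finite_set E' by apply: sub_finite_set E'E _; exact: finite_image.
have cE' : (cnt E' <= cnt [set t | E2 t /\ (supn (pi1 A F0 t) <= T)%R])%N.
  by apply: (cnt_inj (f := fun t => t + g)) => // x y _ _ /addIr.
have sub : [set t | E1 t /\ supn (pi1 A F0 t) <= T] `<=` E' `|` (S `|` N).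
  move=> t [E1t tT]; have [ot ct] := h1 t E1t.
  case: (pselect (S t)) => [St|nS]; first by right; left.
  case: (ltP (T - kappa) (supn (pi1 A F0 t))) => [lt|le]; first by right; right.
  left; split; last first.
    by rewrite (pi1D hF0) (le_trans (supnD _ _)) // -/kappa; lra.
  apply: (h12 t) => //.
    by move: ot => [z hz <-]; exists (z + g); [exact: ZptsD | rewrite addrAC].
  move=> j q qQ.
  have far : eta <= `|coords A B t 0 j - (a1 j + q)|.
    rewrite leNgt; apply/negP => lt; apply: nS; exists (j, q) => //.
    by apply/allpairsP; exists (j, q); rewrite mem_enum.
  have gj : `|coords A B g 0 j - (a2 j - a1 j)| < eta.
    by apply: le_lt_trans hg; have := supn_ge (coords A B g - \row_i (a2 i - a1 i)) j; rewrite !mxE.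
  rewrite coordsDE; move: far gj; rewrite ltr_norml ler_normr => far /andP[g1 g2].
  by apply/idP/idP => hq; case/orP: far => far; lra.
have fSN : finite_set (S `|` N) by rewrite finite_setU.
have fall : finite_set (E' `|` (S `|` N)) by rewrite finite_setU.
have c1 := cnt_sub fall sub; have c2 := cnt_setU fE' fSN; have c3 := cnt_setU fU fN.
have {}hT2 : (2 * J * cnt N <= tot T)%N := hT2.
move: c1 c2 c3 cE' U hT2; move: (size l) => n.
move: (cnt _) (cnt _) (cnt _) (cnt _) (cnt _) (cnt _) (cnt _) (tot T) => x1 x2 x3 x4 x5 x6 x7 x8.
move=> l1 l2 l3 l4 l5 l6.
have l7 : (2 * J * x3 <= x8)%N by rewrite -(leq_pmul2l (ltn0Sn n)); nia.
have l8 : (x7 <= x1 + x3 + x2)%N by lia.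
have l9 : (J * x7 <= J * (x1 + x3 + x2))%N by rewrite leq_mul2l l8 orbT.
by move: l9; rewrite !mulnDr; lia.
Qed.

End Counting.

(** * Patch classes *)

Section CutForms.
Variables (R : realType) (d m : nat) (A : 'M[R]_(d, m)) (B : 'M[R]_m).
Hypotheses (d_gt0 : (0 < d)%N) (bA : bad_matrices A).
Hypotheses (Bu : B \in unitmx) (Bi : forall i j, B i j \is a Num.int).

Lemma col_mulmx p q r (M : 'M[R]_(p, q)) (N : 'M[R]_(q, r)) j : col j (M *m N) = M *m col j N.
Proof. by rewrite !colE mulmxA. Qed.

Lemma badform_divint (b : 'cV[R]_d) k : k \is a Num.int -> k != 0 -> badform b -> badform (k^-1 *: b).
Proof.
move=> ki k0 [c [c0 hc]]; exists (c / `|k|); split; first by rewrite divr_gt0 // normr_gt0.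
move=> h p hZ h0 pint; rewrite ler_pdivrMr ?normr_gt0 // -mulrA -normrM.
have -> : ((h *m (k^-1 *: b)) 0 0 + p) * k = (h *m b) 0 0 + p * k.
  have -> : (h *m (k^-1 *: b)) 0 0 = k^-1 * (h *m b) 0 0 by rewrite -scalemxAr [LHS]mxE.
  by rewrite mulrDl mulrAC mulVf // mul1r.
by apply: hc => //; rewrite rpredM.
Qed.

Let dB := \det B.
(** An integral substitute for column [j] of [invmx B]; a cut is then an integral combination of 1
    and the entries of [A *m adj j], divided by the integer [dB]. *)
Let adj j : 'cV[R]_m := col j (\adj B).

Lemma detB_int : dB \is a Num.int. Proof. exact: det_int. Qed.
Lemma detB_neq0 : dB != 0. Proof. by rewrite -unitfE -unitmxE. Qed.

Lemma adj_int j i : adj j i 0 \is a Num.int.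
Proof.
rewrite !mxE /cofactor rpredM ?rpredX ?rpredN ?rpred1 //.
by apply: det_int => u v; rewrite !mxE.
Qed.

Lemma col_invmx j : col j (invmx B) = dB^-1 *: adj j.
Proof. by rewrite /invmx Bu linearZ. Qed.

Lemma adj_neq0 j : adj j != 0.
Proof.
apply/eqP => e; have := col_invmx j; rewrite e scaler0 => e1.
have : B *m col j (invmx B) = 0 by rewrite e1 mulmx0.
rewrite -col_mulmx mulmxV // => /colP /(_ j) /eqP.
by rewrite !mxE eqxx oner_eq0.
Qed.

Lemma badform_adj j : badform (A *m adj j).
Proof.
pose bz : 'cV[int]_m := \col_i Num.floor (adj j i 0).
have bE : intcol R bz = adj j by apply/colP => i; rewrite [LHS]mxE [bz i 0]mxE floorK ?adj_int // .
rewrite -bE; apply: bA.2; apply: contra (adj_neq0 j) => /eqP e.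
by rewrite -bE e; apply/eqP/colP => i; rewrite !mxE.
Qed.

Lemma coords_adj z j : dB * coords A B z 0 j = (rsubmx z *m adj j) 0 0 - (lsubmx z *m (A *m adj j)) 0 0.
Proof.
have -> : coords A B z 0 j = (star A z *m col j (invmx B)) 0 0.
  by rewrite /coords -col_mulmx [RHS]mxE.
have -> : (star A z *m col j (invmx B)) 0 0 = dB^-1 * (star A z *m adj j) 0 0.
  by rewrite col_invmx -scalemxAr [LHS]mxE.
rewrite mulrA mulfV ?detB_neq0 // mul1r.
by rewrite /star mulmxBl -mulmxA !mxE.
Qed.

(** Differences of cuts are cuts, so this lower bound is the gap between distinct walls. *)
Lemma coords_separated : exists2 c : R, 0 < c & forall z j (N : R), Zpts z -> 1 <= N ->
  supn (lsubmx z) <= N -> coords A B z 0 j != 0 -> c <= N ^+ d * `|coords A B z 0 j|.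
Proof.
have hb j : exists c : R, 0 < c /\ forall (h : 'rV[R]_d) p, Zpts h -> h != 0 -> p \is a Num.int ->
    c <= supn h ^+ d * `|(h *m (A *m adj j)) 0 0 + p| by exact: badform_adj.
have [f hf] := boolp.choice hb.
(* The 1 serves the case [lsubmx z = 0], which [badform] does not cover: there [dB] times the
   coordinate is a nonzero integer. *)
pose c := \big[Num.min/1]_j f j.
have c0 : 0 < c.
  by rewrite /c; apply: lt_bigmin => // j _; have [] := hf j.
have dB0 : 0 < `|dB| by rewrite normr_gt0 detB_neq0.
exists (c / `|dB|); first by rewrite divr_gt0.
move=> z j N hz N1 zN n0.
rewrite ler_pdivrMr // -mulrA -normrM [_ * dB]mulrC coords_adj.
have qint : (rsubmx z *m adj j) 0 0 \is a Num.int.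
  rewrite mxE rpred_sum // => i _; rewrite rpredM ?adj_int //.
  exact: Zpts_rsubmx.
case: (eqVneq (lsubmx z) 0) => [l0|l0].
  have e : dB * coords A B z 0 j = (rsubmx z *m adj j) 0 0.
    by rewrite coords_adj l0 mul0mx [X in _ - X]mxE subr0.
  rewrite -coords_adj e; apply: le_trans (_ : 1 <= _).
    exact: bigmin_le_id.
  rewrite -[1]mulr1; apply: ler_pM => //; first by rewrite exprn_ege1.
  by apply: int_norm_ge1 => //; rewrite -e mulf_neq0 // detB_neq0.
have [_ h] := hf j.
apply: (le_trans (bigmin_le 1 j f)).
apply: le_trans (h (lsubmx z) (- (rsubmx z *m adj j) 0 0) (Zpts_lsubmx hz) l0 _) _.
  by rewrite rpredN.
rewrite distrC ler_wpM2r //; apply: lerXn2r => //; rewrite nnegrE ?supn_ge0 //.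
exact: le_trans N1.
Qed.

Lemma coords_row_mx h p j : coords A B (row_mx h (p *: row j B)) 0 j =
  (h *m (- (A *m col j (invmx B)))) 0 0 + p.
Proof.
have -> : coords A B (row_mx h (p *: row j B)) 0 j = (star A (row_mx h (p *: row j B)) *m col j (invmx B)) 0 0.
  by rewrite /coords -col_mulmx [RHS]mxE.
rewrite /star row_mxKl row_mxKr mulmxBl -scalemxAl.
have -> : row j B *m col j (invmx B) = 1%:M.
  by rewrite -row_mul -col_mulmx mulmxV //; apply/rowP => i; rewrite !mxE ord1 !eqxx.
rewrite mulmxN -mulmxA; move: (h *m _) => X.
by rewrite !mxE eqxx mulr1 addrC.
Qed.

(** Adding [p] times edge [j] shifts coordinate [j] by the integer [p], so [greedy] applies to the
    form given by column [j] of [invmx B], whose integral multiple is badly approximable. *)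
Lemma coords_greedy : exists2 C : R, 0 < C & forall j (I : nat) (x : R), exists z,
  [/\ Zpts z, supn (lsubmx z) <= C * (2 ^ I)%:R & 0 < coords A B z 0 j - x <= ((2 ^ I) ^ d)%:R^-1].
Proof.
have hb j : exists C : R, 0 < C /\ forall (I : nat) (x : R), exists (h : 'rV[R]_d) p,
    [/\ Zpts h, p \is a Num.int, supn h <= C * (2 ^ I)%:R &
      0 < (h *m (- (A *m col j (invmx B)))) 0 0 + p - x <= ((2 ^ I) ^ d)%:R^-1].
  apply: greedy => //; rewrite col_invmx -scalemxAr -scaleNr -invrN.
  by apply: badform_divint; [rewrite rpredN detB_int | rewrite oppr_eq0 detB_neq0 | exact: badform_adj].
have [f hf] := boolp.choice hb.
exists (1 + \sum_j f j).
  by rewrite ltr_wpDr // sumr_ge0 // => j _; have [/ltW] := hf j.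
move=> j I x; have [f0 /(_ I x) [h [p [hZ pi hs hx]]]] := hf j.
exists (row_mx h (p *: row j B)); split.
- apply: Zpts_row_mx => //; apply: ZptsZ => // i; by rewrite mxE.
- rewrite row_mxKl (le_trans hs) // ler_wpM2r // (bigD1 j) //=.
  have : 0 <= \sum_(i | i != j) f i by apply: sumr_ge0 => i _; have [/ltW] := hf i.
  lra.
- by rewrite coords_row_mx.
Qed.

End CutForms.

(** Buckets of length [delta] hold one point each. Empty buckets are filled with the default 0, so
    the list has exactly [K] entries and its index type depends on [K] alone. *)
Lemma separated_enum (R : realType) (S : set R) (delta eta : R) (K : nat) : 0 < delta ->
  (forall q, S q -> 0 <= q <= eta) -> (forall q q', S q -> S q' -> `|q - q'| < delta -> q = q') ->
  eta < K%:R * delta -> exists s : seq R, size s = K /\ forall q, S q -> q \in s.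
Proof.
move=> d0 hS sep lt.
pose g (i : nat) := xget 0 [set q | S q /\ Num.floor (q / delta) = i%:Z].
exists [seq g i | i <- iota 0 K]; rewrite size_map size_iota; split => // q Sq.
have /andP[q0 qe] := hS q Sq.
have fl q' : S q' -> Num.floor (q' / delta) = `|Num.floor (q' / delta)|%N.
  by move=> /hS /andP[q'0 _]; rewrite gez0_abs // floor_ge0 divr_ge0 // ltW.
have -> : q = g `|Num.floor (q / delta)|%N.
  rewrite /g; case: xgetP => [q' _ [Sq' e]|/(_ q)]; last by case; split => //; exact: fl.
  apply: sep => //; have h1 := floor_itv (q / delta); have h2 := floor_itv (q' / delta).
  rewrite e -fl // intrD in h2; rewrite intrD in h1.
  have : `|q / delta - q' / delta| < 1 by rewrite ltr_norml; lra.
  by rewrite -mulrBl normrM normfV (gtr0_norm d0) ltr_pdivrMr // mul1r.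
apply: map_f; rewrite mem_iota /= add0n -(ltr_nat R).
apply: le_lt_trans (_ : q / delta < _); last by rewrite ltr_pdivrMr //; exact: le_lt_trans lt.
have -> : (`|Num.floor (q / delta)|%N)%:R = (Num.floor (q / delta))%:~R :> R by rewrite [in RHS](fl q Sq).
exact: floor_le.
Qed.

(** * Patch classes as unions of grid cells *)

Section Classes.
Variables (R : realType) (d m : nat) (A : 'M[R]_(d, m)) (B : 'M[R]_m) (s : 'rV[R]_(d + m)).
Hypotheses (Bu : B \in unitmx) (Bi : forall i j, B i j \is a Num.int).
Hypothesis reg : forall z j, Zpts z -> coords A B (z + s) 0 j \isn't a Num.int.

Definition live (t : 'rV[R]_(d + m)) : Prop :=
  shifted_lattice s t /\ forall j, 0 <= coords A B t 0 j <= 1.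

Lemma coordsBE (t u : 'rV[R]_(d + m)) j : coords A B (t - u) 0 j = coords A B t 0 j - coords A B u 0 j.
Proof. by rewrite coordsDE coordsN [X in _ + X]mxE. Qed.

Lemma coords_wall j : coords A B (row_mx 0 (row j B)) 0 j = 1.
Proof. by rewrite rowE coords_F // mxE !eqxx. Qed.

Lemma Zpts_wall j : Zpts (row_mx (0 : 'rV[R]_d) (row j B)).
Proof. by apply: Zpts_row_mx; [exact: Zpts0 | move=> i; rewrite mxE]. Qed.

Lemma coords0 j : coords A B 0 0 j = 0.
Proof. by rewrite -(subrr (0 : 'rV[R]_(d + m))) coordsBE subrr. Qed.

Lemma orbitD t z : shifted_lattice s t -> Zpts z -> shifted_lattice s (t + z).
Proof. by move=> [u hu <-] hz; exists (u + z); [exact: ZptsD | rewrite addrAC]. Qed.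

Lemma coords_generic t z j : shifted_lattice s t -> Zpts z -> coords A B t 0 j != coords A B z 0 j.
Proof.
move=> ot hz; have [u hu e] := orbitD ot (ZptsN hz).
apply/eqP => eq; have := reg j hu; rewrite e coordsBE eq subrr.
by rewrite rpred0.
Qed.

Lemma live_strict t j : live t -> 0 < coords A B t 0 j < 1.
Proof.
move=> [ot ct]; have /andP[c0 c1] := ct j.
have n0 := coords_generic j ot (@Zpts0 R (d + m)); rewrite coords0 in n0.
have n1 := coords_generic j ot (Zpts_wall j); rewrite coords_wall in n1.
by rewrite !lt_neqAle c0 c1 n1 eq_sym n0.
Qed.

Variable Hr : set 'rV[R]_(d + m).

(** The patch lifted to the lattice and recentred at 0; [Hr] abstracts the condition imposed by the
    scaled $\Omega$, for either type of patch. *)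
Definition Disp t : set 'rV[R]_(d + m) :=
  [set z | [/\ Zpts z, Hr z & forall j, 0 <= coords A B (t + z) 0 j <= 1]].
Definition cls t : set 'rV[R]_(d + m) := [set u | live u /\ Disp u = Disp t].

Variables (n0 N : R).
Hypothesis N_ge1 : 1 <= N.
Hypothesis hcoarse : forall z, Zpts z -> (forall j, `|coords A B z 0 j| <= 1) ->
  supn (lsubmx z) < n0 -> Hr z.
Hypothesis hfine : forall z, Zpts z -> (forall j, `|coords A B z 0 j| <= 1) ->
  Hr z -> supn (lsubmx z) <= N.

(** Cuts that no class crosses: either the displacement is short enough for every patch to detect
    it, or the cut is a wall of the unit cell. *)
Definition effective z j := Zpts z /\
  (supn (lsubmx z) < n0 \/ coords A B z 0 j = 0 \/ coords A B z 0 j = 1).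

(* If the cut separated [t] from [t'], then [z] reduced modulo the integral vectors of F would
   give a displacement available at [t] only. *)
Lemma coarse_imp t t' z j : live t -> live t' -> Disp t = Disp t' -> effective z j ->
  coords A B z 0 j < coords A B t 0 j -> coords A B z 0 j < coords A B t' 0 j.
Proof.
move=> lt lt' e [hz ef] h.
have /andP[t0 t1] := live_strict j lt; have /andP[t0' t1'] := live_strict j lt'.
case: ef => [zn|[->//|z1]]; last by rewrite z1 in h; lra.
rewrite ltNge; apply/negP => le.
pose z' := reduce A B (t - z) - t.
have zZ : Zpts z'.
  rewrite -[z']opprK; apply: ZptsN.
  have -> : - z' = z + ((t - z) - reduce A B (t - z)).
    by rewrite /z'; move: (reduce _ _ _) => w; apply/rowP => i; rewrite !mxE; ring.
  by apply: ZptsD => //; exact: reduce_Zpts.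
have cz i : coords A B z' 0 i = fr (coords A B (t - z) 0 i) - coords A B t 0 i.
  by rewrite /z' coordsBE coords_reduce.
have z'1 i : `|coords A B z' 0 i| <= 1.
  have /andP[a1 a2] := live_strict i lt; have /andP[b1 b2] := fr_itv (coords A B (t - z) 0 i).
  by rewrite cz ler_norml; lra.
have lz : lsubmx z' = - lsubmx z.
  by rewrite /z' linearB /= lsubmx_reduce linearB /= addrAC subrr add0r.
have : Disp t z'.
  split => //; first by apply: hcoarse => //; rewrite lz supnN.
  move=> i; rewrite coordsDE cz addrC subrK.
  by have /andP[-> /ltW ->] := fr_itv (coords A B (t - z) 0 i).
rewrite e => -[_ _ /(_ j)]; rewrite coordsDE cz.
have -> : fr (coords A B (t - z) 0 j) = coords A B t 0 j - coords A B z 0 j.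
  rewrite /fr (_ : Num.floor _ = 0) ?subr0 ?coordsBE //.
  by apply: floor_def; rewrite add0r; lra.
have gen := coords_generic j lt'.1 hz.
by move: le; rewrite le_eqVlt (negbTE gen) /= => le; lra.
Qed.

Lemma coarse t t' z j : live t -> live t' -> Disp t = Disp t' -> effective z j ->
  (coords A B z 0 j < coords A B t 0 j) = (coords A B z 0 j < coords A B t' 0 j).
Proof. by move=> h1 h2 h3 h4; apply/idP/idP; apply: coarse_imp. Qed.

(** Whether [t + z] stays in the cell is decided by the cuts of [- z] and of the edge vector minus
    [z], whose first [d] coordinates have size at most [N]. *)
Lemma fine_imp t t' : live t -> live t' ->
  (forall z j, Zpts z -> supn (lsubmx z) <= N ->
     (coords A B z 0 j < coords A B t 0 j) = (coords A B z 0 j < coords A B t' 0 j)) ->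
  Disp t `<=` Disp t'.
Proof.
move=> lt lt' h z [hz hrz tz]; split => // j.
have ltz : live (t + z) by split => //; apply: orbitD => //; case: lt.
have z1 i : `|coords A B z 0 i| <= 1.
  have /andP[a1 a2] := live_strict i lt; have := live_strict i ltz; rewrite coordsDE.
  by rewrite ler_norml; lra.
have zN := hfine hz z1 hrz.
have /andP[c1 c2] := live_strict j ltz; rewrite coordsDE in c1 c2.
rewrite coordsDE; apply/andP; split.
  have := h (- z) j (ZptsN hz); rewrite linearN /= supnN => /(_ zN).
  rewrite coordsN mxE => e; have : - coords A B z 0 j < coords A B t 0 j by lra.
  by rewrite e; lra.
have := h (row_mx 0 (row j B) - z) j (ZptsB (Zpts_wall j) hz).
rewrite linearB /= row_mxKl sub0r supnN => /(_ zN).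
rewrite coordsBE coords_wall => e.
have : ~~ (1 - coords A B z 0 j < coords A B t 0 j) by rewrite -leNgt; lra.
by rewrite e -leNgt; lra.
Qed.

Lemma fine t t' : live t -> live t' ->
  (forall z j, Zpts z -> supn (lsubmx z) <= N ->
     (coords A B z 0 j < coords A B t 0 j) = (coords A B z 0 j < coords A B t' 0 j)) ->
  Disp t = Disp t'.
Proof.
by move=> h1 h2 h3; apply/seteqP; split; apply: fine_imp => // z j hz zN; rewrite h3.
Qed.

Variables (eta : R) (K : nat) (Qs : seq R).
Hypotheses (eta_ge0 : 0 <= eta) (sizeQs : size Qs = K).
Hypothesis hQs : forall z j, Zpts z -> supn (lsubmx z) <= 2 * N ->
  0 <= coords A B z 0 j <= eta -> coords A B z 0 j \in Qs.
Variables z1 z2 : 'rV[R]_(d + m) -> 'I_m -> 'rV[R]_(d + m).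
Hypothesis anchors : forall t j, live t ->
  [/\ effective (z1 t j) j, effective (z2 t j) j,
      supn (lsubmx (z1 t j)) <= N, supn (lsubmx (z2 t j)) <= N &
      coords A B (z1 t j) 0 j < coords A B t 0 j < coords A B (z2 t j) 0 j /\
      coords A B (z2 t j) 0 j - coords A B (z1 t j) 0 j <= eta].

(** Positions are read relative to the lower anchor of [t], so that the walls become differences of
    cuts and come from the one list [Qs]. *)
Definition grid_cell t u : {ffun 'I_m -> {ffun 'I_K -> bool}} :=
  [ffun j => [ffun i : 'I_K => nth 0 Qs i < coords A B u 0 j - coords A B (z1 t j) 0 j]].

(** The shape of the class of [t] up to translation, in a finite type that depends on [m] and [K]
    but not on the radius. *)
Definition cell_pattern t : {ffun {ffun 'I_m -> {ffun 'I_K -> bool}} -> bool} :=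
  [ffun f => `[< exists2 u, cls t u & f = grid_cell t u >]].

(** Some [t'] in the class of [t2] occupies the cell of [u1]. No cut of size at most [N] separates
    [u2] from [t']: outside the anchors both lie on the same side, and between them the cut is a
    wall in [Qs]. *)
Lemma cell_pattern_cls t1 t2 : live t1 -> live t2 -> cell_pattern t1 = cell_pattern t2 ->
  forall u1 u2, shifted_lattice s u1 -> shifted_lattice s u2 ->
  (forall j q, q \in Qs -> (q < coords A B u1 0 j - coords A B (z1 t1 j) 0 j) =
                           (q < coords A B u2 0 j - coords A B (z1 t2 j) 0 j)) ->
  cls t1 u1 -> cls t2 u2.
Proof.
move=> l1 l2 /ffunP /[swap] u1 /(_ (grid_cell t1 u1)) + u2 o1 o2 same c1.
rewrite [LHS]ffunE [RHS]ffunE => e12.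
have /asboolP [t' [lt' Dt'] cell] : `[< exists2 u, cls t2 u & grid_cell t1 u1 = grid_cell t2 u >].
  by rewrite -e12; apply/asboolP; exists u1.
have same' j q : q \in Qs -> (q < coords A B u2 0 j - coords A B (z1 t2 j) 0 j) =
                             (q < coords A B t' 0 j - coords A B (z1 t2 j) 0 j).
  move=> qQ; rewrite -same //.
  have iK : (index q Qs < K)%N by rewrite -sizeQs index_mem.
  by move/ffunP: cell => /(_ j); rewrite !ffunE => /ffunP /(_ (Ordinal iK)); rewrite !ffunE /= nth_index.
have cuts z j : Zpts z -> supn (lsubmx z) <= N ->
   (coords A B z 0 j < coords A B u2 0 j) = (coords A B z 0 j < coords A B t' 0 j).
  move=> hz zN; have [e1 e2 n1 n2 [/andP[a1 a2] ae]] := anchors j l2.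
  set x1 := coords A B (z1 t2 j) 0 j in a1 ae *; set x2 := coords A B (z2 t2 j) 0 j in a2 ae *.
  have b1 : x1 < coords A B t' 0 j by rewrite -(coarse l2 lt' (esym Dt') e1).
  have b2 : coords A B t' 0 j < x2.
    have : ~~ (x2 < coords A B t' 0 j) by rewrite -(coarse l2 lt' (esym Dt') e2) -leNgt ltW.
    by rewrite -leNgt le_eqVlt (negbTE (coords_generic j lt'.1 e2.1)).
  (* The point [u2] is not yet known to lie in the cell; the walls 0 and [x2 - x1] confine it
     between the anchors. *)
  have q0 : 0 \in Qs.
    have := hQs (z := 0) (j := j) (@Zpts0 _ _); rewrite coords0 linear0 supn0 lexx eta_ge0; apply => //.
    by move: N_ge1; lra.
  have qx : x2 - x1 \in Qs.
    rewrite -coordsBE; apply: hQs; first by apply: ZptsB; [exact: e2.1 | exact: e1.1].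
      by rewrite linearB /= (le_trans (supnB _ _)) //; lra.
    by rewrite coordsBE -/x1 -/x2; lra.
  have c1' : x1 < coords A B u2 0 j.
    by have := same' j _ q0; rewrite !subr_gt0 b1.
  have c2 : coords A B u2 0 j < x2.
    have := same' j _ qx; rewrite !ltrBrDr !subrK [in RHS]ltNge (ltW b2) /= => /negbT.
    by rewrite -leNgt le_eqVlt (negbTE (coords_generic j o2 e2.1)).
  case: (lerP (coords A B z 0 j) x1) => h1.
    by rewrite (le_lt_trans h1 c1') (le_lt_trans h1 b1).
  case: (lerP x2 (coords A B z 0 j)) => h2.
    by rewrite !ltNge (ltW (lt_le_trans c2 h2)) (ltW (lt_le_trans b2 h2)).
  have := same' j (coords A B z 0 j - x1); rewrite !ltrBrDr !subrK; apply.
  rewrite -coordsBE; apply: hQs; first by apply: ZptsB => //; exact: e1.1.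
    by rewrite linearB /= (le_trans (supnB _ _)) //; lra.
  by rewrite coordsBE -/x1; lra.
have N0 : 0 <= N by move: N_ge1; lra.
(* The cell walls 0 and 1 are themselves cuts of size 0. *)
have l2' : live u2.
  split => // j; have /andP[h1 h2] := live_strict j lt'; apply/andP; split.
    have := cuts 0 j (@Zpts0 _ _); rewrite coords0 linear0 supn0 => /(_ N0).
    by rewrite h1 => /ltW.
  have := cuts _ j (Zpts_wall j); rewrite coords_wall row_mxKl supn0 => /(_ N0).
  by rewrite [in RHS]ltNge (ltW h2) /= => /negbT; rewrite -leNgt.
split => //; rewrite -Dt'; exact: fine.
Qed.

End Classes.

(** * Anchors and a uniform bound on the number of walls *)

Section Anchors.
Variables (R : realType) (d m : nat) (A : 'M[R]_(d, m)) (B : 'M[R]_m).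
Hypotheses (d_gt0 : (0 < d)%N) (bA : bad_matrices A).
Hypotheses (Bu : B \in unitmx) (Bi : forall i j, B i j \is a Num.int).

(** The alternative [I = 0] covers radii at which no displacement is guaranteed to belong to the
    patch, [x] being possibly negative. *)
Lemma dyadic_scale (C x : R) : 0 < C -> exists I : nat,
  x <= C * (2 ^ I.+1)%:R /\ (C * (2 ^ I)%:R < x \/ I = 0%N).
Proof.
move=> C0; pose P I := x <= C * (2 ^ I)%:R.
have exP : exists I, P I.
  have [k /andP[hk _]] := nat_above (x / C); exists k; rewrite /P mulrC -ler_pdivrMr //.
  by apply: (le_trans hk); rewrite ler_nat ltnW // ltn_expl.
case: (ex_minnP exP) => -[|I] PI hI.
  exists 0%N; move: PI; rewrite /P expn0 mulr1 => PI; split; last by right.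
  by apply: (le_trans PI); rewrite expn1; lra.
exists I; split => //; left; rewrite ltNge; apply/negP => h.
by have := hI I h; rewrite ltnn.
Qed.

(** At the dyadic scale [X] boxes have side [2 / X ^+ d], and cuts of size a multiple of [X] are
    separated by a multiple of [X ^- d]. The quotient, and with it the number of walls, is
    independent of [r]. *)
Lemma bounded_cuts (e0 M kappa : R) : 0 < e0 -> 0 <= M -> 0 <= kappa ->
  exists K : nat, forall r : R, 0 <= r -> exists (N eta : R) (Qs : seq R),
  [/\ 1 <= N, M * r + kappa <= N, 0 <= eta, size Qs = K &
   (forall z j, Zpts z -> supn (lsubmx z) <= 2 * N ->
     0 <= coords A B z 0 j <= eta -> coords A B z 0 j \in Qs) /\
   (forall x j, 0 < x < 1 -> exists z1 z2,
     [/\ effective A B (e0 * r - kappa) z1 j, effective A B (e0 * r - kappa) z2 j,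
      supn (lsubmx z1) <= N, supn (lsubmx z2) <= N &
      coords A B z1 0 j < x < coords A B z2 0 j /\
      coords A B z2 0 j - coords A B z1 0 j <= eta])].
Proof.
move=> e00 M0 k0.
have [Cg Cg0 greedyC] := coords_greedy d_gt0 bA Bu Bi.
have [c c0 sep] := coords_separated bA Bu Bi.
(* Since [r] is at most [(2 * Cg + kappa) / e0] times [X], the size [N = G * X] exceeds both
   [M * r + kappa] and the size [Cg * X] of the anchors. *)
pose G := 1 + Cg + M * ((2 * Cg + kappa) / e0) + kappa.
have q0 : 0 <= (2 * Cg + kappa) / e0 by apply: divr_ge0; lra.
have Mq0 : 0 <= M * ((2 * Cg + kappa) / e0) by apply: mulr_ge0.
have G1 : 1 <= G by rewrite /G; lra.
have G0 : 0 < G by lra.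
have [K0 /andP[hK0 _]] := nat_above (2 * (4 * G) ^+ d / c + 1).
exists #|{: 'I_m * 'I_K0}| => r r0.
have [I [hI1 hI2]] := dyadic_scale (e0 * r - kappa) Cg0.
set X : R := (2 ^ I)%:R.
have X1 : 1 <= X by rewrite /X ler1n expn_gt0.
have rX : r <= (2 * Cg + kappa) / e0 * X.
  rewrite mulrAC ler_pdivlMr //; move: hI1; rewrite expnS natrM -/X => hI1.
  have : 0 <= kappa * (X - 1) by apply: mulr_ge0; lra.
  lra.
pose N := G * X; pose eta : R := 2 / X ^+ d.
have N1 : 1 <= N by rewrite /N; apply: (le_trans G1); rewrite ler_peMr //; lra.
have Xd0 : 0 < X ^+ d by apply: exprn_gt0; lra.
have eta0 : 0 <= eta by apply: divr_ge0; lra.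
have CN : Cg * X <= N.
  by rewrite /N /G; have : 0 <= (1 + M * ((2 * Cg + kappa) / e0) + kappa) * X; [apply: mulr_ge0; lra|lra].
(* Walls have size at most [2 * N], hence their differences at most [4 * N]. *)
pose delta := c / (4 * N) ^+ d.
have N4d : 0 < (4 * N) ^+ d by apply: exprn_gt0; lra.
have delta0 : 0 < delta by exact: divr_gt0.
have etaK : eta < K0%:R * delta.
  rewrite /delta mulrA ltr_pdivlMr // /eta /N mulrA exprMn [_ * X ^+ d]mulrC mulrA divfK ?gt_eqF //.
  have : 2 * (4 * G) ^+ d < (2 * (4 * G) ^+ d / c + 1) * c.
    by rewrite [ltRHS]mulrDl divfK ?gt_eqF // mul1r; lra.
  move=> h; apply: (lt_le_trans h); by rewrite ler_wpM2r // ltW.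
have ex j : exists s : seq R, size s = K0 /\ forall q,
    [set q | exists z, [/\ Zpts z, supn (lsubmx z) <= 2 * N, 0 <= coords A B z 0 j <= eta & q = coords A B z 0 j]] q -> q \in s.
  apply: (separated_enum delta0) etaK => [q [z [_ _ h ->]] //|q q' [z [hz zN _ ->]] [z' [hz' zN' _ ->]]].
  rewrite -coordsBE => h; apply/eqP; rewrite -subr_eq0 -coordsBE; apply: contraT => n0.
  have := sep (z - z') j (4 * N) (ZptsB hz hz') _ _ n0.
  have N14 : 1 <= 4 * N by lra.
  have zz : supn (lsubmx (z - z')) <= 4 * N.
    by rewrite linearB /= (le_trans (supnB _ _)) //; lra.
  move=> /(_ N14 zz); move: h; rewrite /delta ltr_pdivlMr // mulrC; lra.
have [f hf] := boolp.choice ex.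
exists N, eta, (codom (fun x : 'I_m * 'I_K0 => nth 0 (f x.1) x.2)); split => //.
- rewrite /N /G; have h1 : M * r <= M * ((2 * Cg + kappa) / e0) * X by rewrite -mulrA ler_wpM2l.
  have h2 : 0 <= kappa * (X - 1) by apply: mulr_ge0; lra.
  have h3 : 0 <= (1 + Cg) * X by apply: mulr_ge0; lra.
  lra.
- exact: size_codom.
split.
  move=> z j hz zN hc; have [sz hin] := hf j.
  have qs : coords A B z 0 j \in f j by apply: hin; exists z.
  set q := coords A B z 0 j in qs *.
  have iK : (index q (f j) < K0)%N by rewrite -sz index_mem.
  by apply/codomP; exists (j, Ordinal iK); rewrite /= nth_index.
move=> x j /andP[x0 x1].
case: hI2 => [lt|I0].
  have [z1 [h1 n1 /andP[g1 g1']]] := greedyC j I (- x).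
  have [z2 [h2 n2 /andP[g2 g2']]] := greedyC j I x.
  have lz1 : supn (lsubmx (- z1)) <= Cg * X by rewrite linearN /= supnN.
  have cz1 : coords A B (- z1) 0 j = - coords A B z1 0 j by rewrite coordsN [LHS]mxE.
  exists (- z1), z2; split.
  - split; first exact: ZptsN.
    by left; exact: le_lt_trans lz1 lt.
  - by split => //; left; exact: le_lt_trans n2 lt.
  - exact: le_trans CN.
  - exact: le_trans CN.
  - rewrite cz1; split; first by apply/andP; split; lra.
    move: g1' g2'; rewrite natrX -/X /eta; lra.
(* At the lowest scale the walls of the cell are the anchors; their distance 1 is below
   [eta = 2]. *)
have X1' : X = 1 by rewrite /X I0 expn0.
exists 0, (row_mx 0 (row j B)); split.
- by split; [exact: Zpts0 | right; left; exact: coords0].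
- by split; [exact: Zpts_wall | right; right; exact: coords_wall].
- by rewrite linear0 supn0; lra.
- by rewrite row_mxKl supn0; lra.
- by rewrite coords0 coords_wall // x0 x1 subr0 /eta X1' expr1n divr1 ler1n.
Qed.
End Anchors.

(** * Frequencies *)

(* Neither limit is assumed to exist: the two families have the same limit points, so [lim] takes
   the same value on both. *)
Lemma lim_ratio_eq (R : realType) (n1 n2 D : R -> nat) :
  (forall J, exists T0, forall T, T0 <= T -> (J * n1 T <= J * n2 T + D T)%N) ->
  (forall J, exists T0, forall T, T0 <= T -> (J * n2 T <= J * n1 T + D T)%N) ->
  lim ((fun T => (n1 T)%:R / (D T)%:R : R) @ +oo) =
  lim ((fun T => (n2 T)%:R / (D T)%:R : R) @ +oo).
Proof.
move=> h12 h21.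
have close (f g D' : R -> nat) :
    (forall J, exists T0, forall T, T0 <= T -> (J * f T <= J * g T + D' T)%N) ->
    (forall J, exists T0, forall T, T0 <= T -> (J * g T <= J * f T + D' T)%N) ->
    ((fun T => (f T)%:R / (D' T)%:R : R) - (fun T => (g T)%:R / (D' T)%:R : R)) @ +oo --> (0 : R).
  move=> fg gf; apply/cvgr0Pnorm_le => e e0.
  have [J /andP[hJ _]] := nat_above (e^-1 + 1).
  have [T1 hT1] := fg J; have [T2 hT2] := gf J.
  near=> T.
  have h1 : (J * f T <= J * g T + D' T)%N by apply: hT1; near: T; apply: nbhs_pinfty_ge; rewrite num_real.
  have h2 : (J * g T <= J * f T + D' T)%N by apply: hT2; near: T; apply: nbhs_pinfty_ge; rewrite num_real.
  have J0 : 0 < J%:R :> R by apply: lt_le_trans hJ; rewrite addr_gt0 // invr_gt0.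
  rewrite /= -[(_ - _) T]/((f T)%:R / (D' T)%:R - (g T)%:R / (D' T)%:R).
  case: (eqVneq (D' T) 0%N) => [->|D0].
    by rewrite invr0 !mulr0 subrr normr0 ltW.
  have D0' : 0 < (D' T)%:R :> R by rewrite ltr0n lt0n.
  rewrite -mulrBl normrM normfV (gtr0_norm D0') ler_pdivrMr //.
  have eJ : 1 <= e * J%:R.
    have : e * e^-1 = 1 by rewrite mulfV // gt_eqF.
    have : e * (e^-1 + 1) <= e * J%:R by rewrite ler_pM2l.
    rewrite mulrDr; lra.
  rewrite -(ler_pM2l J0).
  have -> : J%:R * `|(f T)%:R - (g T)%:R| = `|J%:R * (f T)%:R - J%:R * (g T)%:R| :> R.
    by rewrite -mulrBr normrM (gtr0_norm J0).
  apply: (@le_trans _ _ (D' T)%:R).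
    move: h1 h2; rewrite -!(ler_nat R) !natrD !natrM ler_norml; lra.
  by rewrite mulrA [J%:R * e]mulrC ler_peMl // ltW.
rewrite /lim /lim_in; congr (get _); apply: funext => l; apply: propext.
by split; apply: cvg_sub0; exact: close.
Unshelve. all: by end_near.
Qed.

Section Patches.
Variables (R : realType) (d m : nat) (A : 'M[R]_(d, m)) (F0 W : set 'rV[R]_(d + m)).
Variables (s : 'rV[R]_(d + m)) (B : 'M[R]_m).
Hypotheses (hF0 : admissible_F0 A F0) (Bu : B \in unitmx).
Hypothesis stripE : forall t, strip A W t <-> forall j, 0 <= coords A B t 0 j <= 1.

Lemma liftedE t : lifted A W s t <-> live A B s t.
Proof. by split=> -[h1 h2]; split => //; apply/stripE. Qed.

Lemma shifted_latticeB t u : shifted_lattice s t -> shifted_lattice s u -> Zpts (t - u).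
Proof.
by move=> [z hz <-] [w hw <-]; rewrite opprD addrACA subrr addr0; exact: ZptsB.
Qed.

Lemma pi1_shifted_inj t u : shifted_lattice s t -> shifted_lattice s u ->
  pi1 A F0 t = pi1 A F0 u -> t = u.
Proof.
move=> ht hu e; apply/eqP; rewrite -subr_eq0; apply/eqP.
by apply: (pi1_inj hF0 (shifted_latticeB ht hu)); rewrite pi1B // e subrr.
Qed.

Lemma Yset_pi1 t : live A B s t -> Yset A F0 W s (pi1 A F0 t).
Proof. by move=> h; exists t => //; apply/liftedE. Qed.

Lemma tilde_pi1 t : live A B s t -> tilde A F0 W s (pi1 A F0 t) = t.
Proof.
move=> lt; rewrite /tilde; case: xgetP => [u _ [/liftedE lu e]|/(_ t)].
  by apply: pi1_shifted_inj e; [case: lu | case: lt].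
by case; split => //; apply/liftedE.
Qed.

Definition displaced (Hr : set 'rV[R]_(d + m)) t :=
  [set pi1 A F0 (t + z) | z in Disp A B Hr t].

Lemma patch1E Om r t : live A B s t -> patch1 A F0 W s Om (pi1 A F0 t) r =
  displaced (fun z => scaled r Om (pi1 A F0 z)) t.
Proof.
move=> lt; apply/seteqP; split => [_ [[u /liftedE lu <-] h]|_ [z [hz hr hc] <-]].
  exists (u - t); last by rewrite addrC subrK.
  split; first by apply: shifted_latticeB; [case: lu | case: lt].
    by rewrite pi1B.
  by move=> j; rewrite addrC subrK; case: lu.
split; last by rewrite pi1D // addrAC subrr add0r.
by apply: Yset_pi1; split => //; apply: orbitD => //; case: lt.
Qed.

Lemma patch2E Om r t : live A B s t -> patch2 A F0 W s Om (pi1 A F0 t) r =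
  displaced (fun z => scaled r Om (pi2 A z)) t.
Proof.
move=> lt; apply/seteqP; split => [_ [[u /liftedE lu <-] h]|_ [z [hz hr hc] <-]].
  exists (u - t); last by rewrite addrC subrK.
  split; first by apply: shifted_latticeB; [case: lu | case: lt].
    by rewrite !tilde_pi1 in h.
  by move=> j; rewrite addrC subrK; case: lu.
have ltz : live A B s (t + z) by split => //; apply: orbitD => //; case: lt.
by split; [exact: Yset_pi1 | rewrite !tilde_pi1 // addrAC subrr add0r].
Qed.

Section Frequencies.
Variables (P : 'rV[R]_(d + m) -> R -> set 'rV[R]_(d + m)) (r : R) (Hr : set 'rV[R]_(d + m)).
Hypothesis PE : forall t, live A B s t -> P (pi1 A F0 t) r = displaced Hr t.

(** The condition on $F_0$ makes [pi1] injective on the orbit, so a patch determines its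
    displacements. *)
Lemma patch_equivE t u : live A B s t -> live A B s u ->
  patch_equiv P r (pi1 A F0 u) (pi1 A F0 t) <-> Disp A B Hr u = Disp A B Hr t.
Proof.
move=> lt lu; rewrite /patch_equiv !PE //; split => [e|e].
  have shift w : pi1 A F0 (t + w) + (pi1 A F0 u - pi1 A F0 t) = pi1 A F0 (u + w).
    by rewrite -pi1B // -pi1D //; congr pi1; apply/rowP => i; rewrite !mxE; ring.
  have inj z w : Zpts z -> Zpts w -> pi1 A F0 (u + z) = pi1 A F0 (u + w) -> z = w.
    move=> hz hw /(@pi1_shifted_inj _ _ _ _) h; apply: (addrI u); apply: h; apply: orbitD => //; by case: lu.
  apply/seteqP; split => z hz.
    have : displaced Hr u (pi1 A F0 (u + z)) by exists z.
    rewrite e => -[_ [w hw <-]]; rewrite shift => /esym /inj -> //; [by case: hz | by case: hw].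
  have : displaced Hr u (pi1 A F0 (u + z)) by rewrite e; exists (pi1 A F0 (t + z)); [exists z | exact: shift].
  move=> [w hw /inj <- //]; [by case: hw | by case: hz].
have shift w : pi1 A F0 (t + w) + (pi1 A F0 u - pi1 A F0 t) = pi1 A F0 (u + w).
  by rewrite -pi1B // -pi1D //; congr pi1; apply/rowP => i; rewrite !mxE; ring.
apply/seteqP; split => [_ [z hz <-]|_ [_ [z hz <-] <-]].
  by exists (pi1 A F0 (t + z)); [exists z => //; rewrite -e | exact: shift].
by rewrite shift; exists z => //; rewrite e.
Qed.

Lemma count_pi1 (E : set 'rV[R]_(d + m)) (T : R) : (forall t, E t -> live A B s t) ->
  count_set [set y | (pi1 A F0 @` E) y /\ supn y <= T] =
  (cnt [set t | E t /\ supn (pi1 A F0 t) <= T])%:R.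
Proof.
move=> El; rewrite -[LHS]/((cnt _)%:R); congr (_%:R).
have fE : finite_set [set t | E t /\ supn (pi1 A F0 t) <= T].
  by apply: sub_finite_set (cell_orbit_finite s hF0 Bu T) => t [/El []].
have -> : [set y | (pi1 A F0 @` E) y /\ supn y <= T] =
          pi1 A F0 @` [set t | E t /\ supn (pi1 A F0 t) <= T].
  apply/seteqP; split => [_ [[t Et <-] le]|_ [t [Et le] <-]]; first by exists t.
  by split => //; exists t.
have fI := finite_image (pi1 A F0) fE.
apply/eqP; rewrite eqn_leq; apply/andP; split.
  apply: (cnt_inj (f := tilde A F0 W s)) => // [_ [t [Et le] <-]|_ _ [t [Et _] <-] [u [Eu _] <-]].
    by rewrite tilde_pi1 //; exact: El.
  by rewrite !tilde_pi1 => [->||]; [|exact: El|exact: El].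
apply: (cnt_inj (f := pi1 A F0)) => // [t u [/El [lt _] _] [/El [lu _] _]].
exact: pi1_shifted_inj.
Qed.

Lemma frequencyE t : live A B s t -> frequency A F0 W s P r (pi1 A F0 t) =
  lim ((fun T => (cnt [set u | cls A B s Hr t u /\ supn (pi1 A F0 u) <= T])%:R /
                 (tot A F0 B s T)%:R : R) @ +oo).
Proof.
move=> lt; rewrite /frequency; set f := (X in lim (fmap X _)); set g := (X in _ = lim (fmap X _)).
suff -> : f = g by []; apply: funext => T; rewrite /f /g.
congr (_ / _).
  rewrite -count_pi1; last by move=> u [].
  congr count_set; apply/seteqP; split => [_ [[u /liftedE lu <-] [le eq]]|_ [[u [lu Du] <-] le]].
    by split => //; exists u => //; split => //; apply/(patch_equivE lt lu).
  by split; [exact: Yset_pi1 | split => //; apply/(patch_equivE lt lu)].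
rewrite -(_ : count_set [set y | (pi1 A F0 @` live A B s) y /\ supn y <= T] = (tot A F0 B s T)%:R).
  congr count_set; apply/seteqP; split => [_ [[u /liftedE lu <-] le]|_ [[u lu <-] le]].
    by split => //; exists u.
  by split => //; exact: Yset_pi1.
rewrite count_pi1 //; congr (cnt _)%:R.
by apply/seteqP; split => u => [[[h1 h2] h3]|[h1 [h2 h3]]].
Qed.

End Frequencies.
End Patches.

(** * Uniform bound on the number of frequencies *)

Section Finiteness.
Variables (R : realType) (d m : nat) (A : 'M[R]_(d, m)) (F0 W : set 'rV[R]_(d + m)).
Variables (s : 'rV[R]_(d + m)) (B : 'M[R]_m).
Hypotheses (d_gt0 : (0 < d)%N) (bA : bad_matrices A).
Hypotheses (hF0 : admissible_F0 A F0) (Bu : B \in unitmx).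
Hypothesis Bi : forall i j, B i j \is a Num.int.
Hypothesis stripE : forall t, strip A W t <-> forall j, 0 <= coords A B t 0 j <= 1.
Hypothesis reg : forall z j, Zpts z -> coords A B (z + s) 0 j \isn't a Num.int.

(** The frequency is determined by the cell pattern, since equal patterns give translated classes;
    [K], and so the number of patterns, does not depend on [r]. *)
Lemma freq_values_bounded (P : 'rV[R]_(d + m) -> R -> set 'rV[R]_(d + m))
    (H : R -> set 'rV[R]_(d + m)) (e0 M kappa : R) :
  0 < e0 -> 0 <= M -> 0 <= kappa ->
  (forall r z, 0 <= r -> (forall j, `|coords A B z 0 j| <= 1) ->
     supn (lsubmx z) < e0 * r - kappa -> H r z) ->
  (forall r z, 0 <= r -> (forall j, `|coords A B z 0 j| <= 1) ->
     H r z -> supn (lsubmx z) <= M * r + kappa) ->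
  (forall r t, 0 <= r -> live A B s t -> P (pi1 A F0 t) r = displaced A F0 B (H r) t) ->
  exists C : nat, forall r, 0 <= r ->
    finite_set (freq_values A F0 W s P r) /\
    (cnt (freq_values A F0 W s P r) <= C)%N.
Proof.
move=> e00 M0 k0 Hin Hout PE.
have [K hK] := bounded_cuts d_gt0 bA Bu Bi e00 M0 k0.
exists #|{: {ffun {ffun 'I_m -> {ffun 'I_K -> bool}} -> bool}}| => r r0.
have [N [eta [Qs [N1 MN eta0 sQ [hQ cuts]]]]] := hK r r0.
set n0 := e0 * r - kappa in cuts.
have ex (p : 'rV[R]_(d + m) * 'I_m) : exists z : 'rV[R]_(d + m) * 'rV[R]_(d + m), live A B s p.1 ->
    [/\ effective A B n0 z.1 p.2, effective A B n0 z.2 p.2,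
      supn (lsubmx z.1) <= N, supn (lsubmx z.2) <= N &
      coords A B z.1 0 p.2 < coords A B p.1 0 p.2 < coords A B z.2 0 p.2 /\
      coords A B z.2 0 p.2 - coords A B z.1 0 p.2 <= eta].
  case: (pselect (live A B s p.1)) => [lp|np]; last by exists (0, 0).
  have [z1 [z2 h]] := cuts _ p.2 (live_strict Bu Bi reg p.2 lp).
  by exists (z1, z2).
have [f hf] := boolp.choice ex.
pose z1 t j := (f (t, j)).1; pose z2 t j := (f (t, j)).2.
have anchors t j : live A B s t ->
    [/\ effective A B n0 (z1 t j) j, effective A B n0 (z2 t j) j,
      supn (lsubmx (z1 t j)) <= N, supn (lsubmx (z2 t j)) <= N &
      coords A B (z1 t j) 0 j < coords A B t 0 j < coords A B (z2 t j) 0 j /\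
      coords A B (z2 t j) 0 j - coords A B (z1 t j) 0 j <= eta] by exact: (hf (t, j)).
have hc z : Zpts z -> (forall j, `|coords A B z 0 j| <= 1) -> supn (lsubmx z) < n0 -> H r z.
  by move=> _; exact: Hin.
have hn z : Zpts z -> (forall j, `|coords A B z 0 j| <= 1) -> H r z -> supn (lsubmx z) <= N.
  by move=> _ h1 h2; apply: le_trans MN; exact: Hout.
pose sh := cell_pattern A B s (H r) K Qs z1.
have transfer t1 t2 : live A B s t1 -> live A B s t2 -> sh t1 = sh t2 ->
    forall J, exists T0, forall T, T0 <= T ->
      (J * cnt [set u | cls A B s (H r) t1 u /\ (supn (pi1 A F0 u) <= T)%R] <=
       J * cnt [set u | cls A B s (H r) t2 u /\ (supn (pi1 A F0 u) <= T)%R] + tot A F0 B s T)%N.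
  move=> l1 l2 sh12.
  have dense tau eps : 0 < eps -> exists2 g, Zpts g & supn (coords A B g - tau) < eps.
    by move=> he; exact: coords_dense.
  apply: (translate_cnt d_gt0 hF0 Bu Bi dense (a1 := fun j => coords A B (z1 t1 j) 0 j)
    (a2 := fun j => coords A B (z1 t2 j) 0 j) (Q := Qs)) => [t [[]]//|t [[]]//|u1 u2 o1 o2 same].
  exact: (cell_pattern_cls Bu Bi reg N1 hc hn eta0 sQ hQ anchors l1 l2 sh12 o1 o2 same).
(* A live representative of each value turns the pattern into an injective encoding of the
   values. *)
pose rep x := xget 0 [set t | live A B s t /\ frequency A F0 W s P r (pi1 A F0 t) = x].
have repP x : freq_values A F0 W s P r x ->
    live A B s (rep x) /\ frequency A F0 W s P r (pi1 A F0 (rep x)) = x.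
  move=> [_ [t /(liftedE s stripE) lt <-] e].
  by rewrite /rep; case: xgetP => [//|/(_ t)]; case.
apply: (finite_encoding (e := fun x => sh (rep x))) => x y /repP [lx ex'] /repP [ly ey'] eq.
clearbody rep sh; apply: (etrans (esym ex')); apply: (etrans _ ey').
have freqE := frequencyE hF0 Bu stripE (fun t => PE r t r0).
rewrite (freqE _ lx) (freqE _ ly); apply: lim_ratio_eq.
  exact: transfer lx ly eq.
exact: transfer ly lx (esym eq).
Qed.

(** Sandwiches the scaled $\Omega$ between balls in the first [d] coordinates. The additive [C2]
    lets [p] be [pi1], which follows [lsubmx] on the strip only up to a bounded error. *)
Lemma Omega_range (Om : set 'rV[R]_(d + m)) (p : 'rV[R]_(d + m) -> 'rV[R]_(d + m)) (C1 C2 : R) :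
  admissible_Omega A Om -> (forall z, Egraph A (p z)) -> 0 < C1 -> 0 <= C2 ->
  (forall z, (forall j, `|coords A B z 0 j| <= 1) ->
    supn (p z) <= C1 * supn (lsubmx z) + C2 /\ supn (lsubmx z) <= supn (p z) + C2) ->
  exists e0 M kappa, [/\ 0 < e0, 0 <= M, 0 <= kappa,
    (forall r z, 0 <= r -> (forall j, `|coords A B z 0 j| <= 1) ->
       supn (lsubmx z) < e0 * r - kappa -> scaled r Om (p z)) &
    (forall r z, 0 <= r -> (forall j, `|coords A B z 0 j| <= 1) ->
       scaled r Om (p z) -> supn (lsubmx z) <= M * r + kappa)].
Proof.
move=> [_ [[M hM] [_ [eps [eps0 hO]]]]] pE C10 C20 hp.
have k1 : 0 <= C2 / C1 by apply: divr_ge0 => //; exact: ltW.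
exists (eps / C1), `|M|, (C2 / C1 + C2); split => //.
- exact: divr_gt0.
- exact: addr_ge0.
- move=> r z r0 hz lt; have [h1 h2] := hp z hz.
  have lt' : supn (p z) < eps * r.
    have : C1 * supn (lsubmx z) < C1 * (eps / C1 * r - (C2 / C1 + C2)) by rewrite ltr_pM2l.
    have -> : C1 * (eps / C1 * r - (C2 / C1 + C2)) = eps * r - C2 - C1 * C2 by field; rewrite gt_eqF.
    have : 0 <= C1 * C2 by rewrite mulr_ge0 // ltW.
    lra.
  (* At [r = 0] the premise would make a norm negative. *)
  have r1 : 0 < r.
    rewrite lt_neqAle r0 andbT; apply/eqP => r0'; move: lt'; rewrite -r0' mulr0.
    by rewrite ltNge supn_ge0.
  exists (r^-1 *: p z); last by rewrite scalerA mulfV ?scale1r // gt_eqF.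
  apply: hO.
    by have [x _ <-] := pE z; exists (r^-1 *: x) => //; rewrite scale_row_mx scalemxAl.
  by rewrite supnZ gtr0_norm ?invr_gt0 // mulrC ltr_pdivrMr.
- move=> r z r0 hz [w hw e]; have [h1 h2] := hp z hz.
  apply: (le_trans h2); rewrite -e supnZ ger0_norm // mulrC.
  have : r * supn w <= r * `|M| by rewrite ler_wpM2l // (le_trans (hM w hw)) // ler_norm.
  rewrite (mulrC `|M|) (mulrC (supn w)); lra.
Qed.

End Finiteness.

Lemma pi2_Egraph (R : realType) d m (A : 'M[R]_(d, m)) t : Egraph A (pi2 A t).
Proof. by rewrite pi2E; exists (lsubmx t). Qed.

(* k = d + m, with d >= 1 and m = k - d >= 1 *)
Theorem theorem1p1 (d m : nat) (hd : (1 <= d)%N) (hm : (1 <= m)%N) :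
  exists LL : set 'M[Rdefinitions.R]_(d, m),
    hausdorff_dim LL = ((d * m)%:R)%:E /\
    forall A : 'M[Rdefinitions.R]_(d, m), LL A ->
      totally_irrational A /\
      forall (F0 Om W : set 'rV[Rdefinitions.R]_(d + m))
             (s : 'rV[Rdefinitions.R]_(d + m)),
        admissible_F0 A F0 ->
        admissible_Omega A Om ->
        regular A W s ->
        is_window W -> integral_parallelotope W ->
        exists C : nat, forall r : Rdefinitions.R, 0 <= r ->
          (finite_set (freq_values A F0 W s (patch1 A F0 W s Om) r) /\
           (#|` fset_set (freq_values A F0 W s (patch1 A F0 W s Om) r)| <= C)%N) /\
          (finite_set (freq_values A F0 W s (patch2 A F0 W s Om) r) /\
           (#|` fset_set (freq_values A F0 W s (patch2 A F0 W s Om) r)| <= C)%N).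
Proof.
exists (@bad_matrices Rdefinitions.R d m).
split; first exact: hausdorff_dim_bad_matrices.
move=> A bA; split; first exact: bad_totally_irrational.
move=> F0 Om W s hF0 hOm regW _ parW.
have [B [Bu Bi stripE]] := parallelotope_strip A parW.
have reg z j : Zpts z -> coords A B (z + s) 0 j \isn't a Num.int.
  exact: regular_coords.
have [C1 C10 hC1] := pi2_bound A.
have [C2 C20 hC2] := pi1_pi2 hF0.
have [C3 C30 hC3] := star_bound A Bu.
have C23 : 0 <= C2 * C3 by rewrite mulr_ge0 // ltW.
have near12 z : (forall j, `|coords A B z 0 j| <= 1) -> supn (pi1 A F0 z - pi2 A z) <= C2 * C3.
  move=> hz; apply: (le_trans (hC2 z)); rewrite ler_pM2l //.
  by have := hC3 z 1 ler01 hz; rewrite mulr1.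
have [e1 [M1 [k1 [e10 M10 k10 in1 out1]]]] : exists e0 M kappa, [/\ 0 < e0, 0 <= M, 0 <= kappa,
    (forall r z, 0 <= r -> (forall j, `|coords A B z 0 j| <= 1) ->
       supn (lsubmx z) < e0 * r - kappa -> scaled r Om (pi1 A F0 z)) &
    (forall r z, 0 <= r -> (forall j, `|coords A B z 0 j| <= 1) ->
       scaled r Om (pi1 A F0 z) -> supn (lsubmx z) <= M * r + kappa)].
  apply: (@Omega_range _ d m A B Om _ C1 (C2 * C3)) => // [z|z hz]; first by case: (pi1_spec hF0 z).
  have h := near12 z hz; split.
    have -> : pi1 A F0 z = pi2 A z + (pi1 A F0 z - pi2 A z) by rewrite addrC subrK.
    by apply: (le_trans (supnD _ _)); apply: lerD.
  apply: (le_trans (supn_lsub_pi2 A z)).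
  have -> : pi2 A z = pi1 A F0 z - (pi1 A F0 z - pi2 A z) by rewrite opprB addrC subrK.
  by apply: (le_trans (supnB _ _)); rewrite lerD2l.
have [e2 [M2 [k2 [e20 M20 k20 in2 out2]]]] : exists e0 M kappa, [/\ 0 < e0, 0 <= M, 0 <= kappa,
    (forall r z, 0 <= r -> (forall j, `|coords A B z 0 j| <= 1) ->
       supn (lsubmx z) < e0 * r - kappa -> scaled r Om (pi2 A z)) &
    (forall r z, 0 <= r -> (forall j, `|coords A B z 0 j| <= 1) ->
       scaled r Om (pi2 A z) -> supn (lsubmx z) <= M * r + kappa)].
  apply: (@Omega_range _ d m A B Om _ C1 0) => // [z|z _]; first exact: pi2_Egraph.
  by rewrite !addr0; split; [exact: hC1 | exact: supn_lsub_pi2].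
have [D1 hD1] := freq_values_bounded hd bA hF0 Bu Bi stripE reg e10 M10 k10 in1 out1
  (fun r t _ => patch1E hF0 stripE Om r (t := t)).
have [D2 hD2] := freq_values_bounded hd bA hF0 Bu Bi stripE reg e20 M20 k20 in2 out2
  (fun r t _ => patch2E hF0 stripE Om r (t := t)).
exists (maxn D1 D2) => r r0.
have [f1 c1] := hD1 r r0; have [f2 c2] := hD2 r r0.
split; split; [exact: f1 | exact: leq_trans c1 (leq_maxl _ _) | exact: f2 | exact: leq_trans c2 (leq_maxr _ _)].
Qed.
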